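(* Let $\mu$ be a Borel probability measure on $\Omega$ which is invariant and ergodic under $(\tau_x)_{x\in\mathbb R^d}$ and satisfies $\mu(\Omega_{\mathfrak r})=1$ for some $\mathfrak r>0$. Then there exist a sequence $(\omega_n)_{n\in\mathbb N}\subset\Omega_{\mathfrak r}$ and an increasing sequence of positive numbers $(M_n)_{n\in\mathbb N}$ with $M_n\to\infty$ such that: (1) each $\omega_n$ is $M_n$-periodic in each variable, i.e. $\tau_{M_n e_i}\omega_n=\omega_n$ for all $n$ and $i=1,\dots,d$ ($e_i$ the canonical basis); (2) the probability measures on $(\Omega_{\mathfrak r},\mathcal B(\Omega_{\mathfrak r}))$ $$\mu_n(A):=\frac1{M_n^d}\int_{[-M_n/2,M_n/2]^d}\mathbf 1_A(\tau_y\omega_n)\,dy$$ converge weakly to $\mu$, i.e. $\lim_{n\to\infty}\int_{\Omega_{\mathfrak r}}F\,d\mu_n=\int_{\Omega_{\mathfrak r}}F\,d\mu$ for every bounded $\mathrm d_{\mathfrak r}$-continuous $F:\Omega_{\mathfrak r}\to\mathbb R$.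
   Context: Fix $d\ge1$, $\lambda,\Lambda>0$. $\mathcal S_d^+$ is the set of symmetric non-negative definite real $d\times d$ matrices, $\|a\|=\sum_{i,j}|a_{ij}|$. $\Omega$ is the set of continuous $\omega:\mathbb R^d\to\mathcal S_d^+$ with $\|\omega(x)\|\le\Lambda$, $\operatorname{Tr}\omega(x)\ge\lambda$, with the topology of locally uniform convergence and its Borel $\sigma$-field; $\tau_x\omega(y)=\omega(x+y)$. For $\mathfrak r>0$, $\Omega_{\mathfrak r}$ is the set of $\omega\in\Omega$ that are continuously differentiable and satisfy $\omega(x)-\mathfrak r I_d\in\mathcal S_d^+$ for all $x$, with the Polish metric $\mathrm d_{\mathfrak r}(\omega_1,\omega_2)=\sum_{K\ge1}2^{-K}\frac{\|\omega_1-\omega_2\|_{1,\infty,K}}{1+\|\omega_1-\omega_2\|_{1,\infty,K}}$, $\|\omega\|_{1,\infty,K}=\sup_{|x|\le K}|\omega(x)|+\sup_{|x|\le K}|\nabla\omega(x)|$; $\Omega_{\mathfrak r}$ is a Borel subset of $\Omega$ and is $\tau$-invariant. *)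

(* Defs.v *)
From HB Require Import structures.
From mathcomp Require Import all_boot all_order all_algebra.
From mathcomp Require Import all_classical all_reals all_analysis.
Import Order.TTheory GRing.Theory Num.Theory.
Import numFieldNormedType.Exports.



Unset Printing Implicit Defensive.

Local Open Scope classical_set_scope.
Local Open Scope ring_scope.

Section Environments.
Variables (R : realType) (d : nat).

Definition Fn := 'rV[R]_d -> 'M[R]_d.

Definition mnorm (a : 'M[R]_d) : R := \sum_i \sum_j `|a i j|.

Definition psd (a : 'M[R]_d) : Prop :=
  a^T = a /\ forall v : 'rV[R]_d, 0 <= (v *m a *m v^T) 0 0.

Definition Omega (lam Lam : R) : set Fn :=
  [set w : Fn | continuous w /\
     forall x, [/\ psd (w x), mnorm (w x) <= Lam & lam <= \tr (w x)]].

Definition C1 (w : Fn) : Prop :=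
  (forall x, differentiable w x) /\
  (forall i : 'I_d, continuous (fun x => 'D_('e_i) w x)).

Definition OmegaR (lam Lam r : R) : set Fn :=
  [set w : Fn | Omega lam Lam w /\ C1 w /\ forall x, psd (w x - r%:M)].

Definition tau (x : 'rV[R]_d) (w : Fn) : Fn := fun y => w (x + y).

Definition supK (f : 'rV[R]_d -> R) (K : nat) : R :=
  sup [set f x | x in [set x : 'rV[R]_d | `|x| <= K%:R]].

Definition metric_sum (s : nat -> R) : R :=
  limn (fun N => \sum_(1 <= K < N) (2 ^- K * (s K / (1 + s K)))).

Definition dist0 (w1 w2 : Fn) : R :=
  metric_sum (fun K => supK (fun x => mnorm (w1 x - w2 x)) K).

Definition distR (w1 w2 : Fn) : R :=
  metric_sum (fun K => supK (fun x => mnorm (w1 x - w2 x)) K +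
    supK (fun x => \sum_(i < d) mnorm ('D_('e_i) w1 x - 'D_('e_i) w2 x)) K).

Definition OmegaOpen (lam Lam : R) : set (set Fn) :=
  [set A | A `<=` Omega lam Lam /\
    forall w, A w -> exists2 e : R, 0 < e &
      forall w', Omega lam Lam w' -> dist0 w w' < e -> A w'].

(* measurable space: carrier Fn with the sigma-algebra generated by the open
   subsets of Omega; its trace on Omega is the Borel sigma-field of Omega *)
Definition OmegaMeas (lam Lam : R) := g_sigma_algebraType (OmegaOpen lam Lam).

Fixpoint iter_int (a b : R) (k : nat) (g : (nat -> R) -> R) (x : nat -> R) : R :=
  match k with
  | 0 => g x
  | k'.+1 => (\int[@lebesgue_measure R]_(t in `[a, b]%classic)
               iter_int a b k' g (fun j => if j == k' then t else x j))
  end.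

(* int F d mu_M,w = M^-d int_{[-M/2,M/2]^d} F (tau_y w) dy *)
Definition cube_avg (M : R) (w : Fn) (F : Fn -> R) : R :=
  M ^- d * iter_int (- (M / 2)) (M / 2) d
    (fun y => F (tau (\row_(i < d) y i) w)) (fun _ => 0).

End Environments.

(* Main.v *)
(* Idea. Fix countably many bounded test functions on OmegaR, each depending on
   the environment and its gradient on a bounded window only, such that every
   nonnegative bounded continuous function is the supremum of the members below it
   and the family is stable under finite maxima.  By the L1 mean ergodic theorem,
   for all large M some environment v has averages over the cube of side M close
   to the mu-integrals, simultaneously for finitely many test functions.  Composing
   v with an M-periodic C1 map of R^d that is the identity well inside the cube
   yields a periodic element of OmegaR (its values are values of v) whose averages
   differ by O(1/M), because the windows only notice a boundary layer.  Monotone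
   approximation from below, applied to C + F and C - F, passes to every bounded
   continuous F.

   The mean ergodic theorem is proved by minimising the L2 norm over convex
   combinations of translates: the parallelogram identity makes the cube averages
   of a minimising sequence converge almost surely, and the upper limit of cube
   averages is strictly invariant, so ergodicity applies to its level sets. *)

(* Three constraints shape the argument. The sigma-field on [Omega] is defined by locally uniform
   convergence, without reference to gradients, while the test functions read gradients; so
   membership in [OmegaR] and the gradients themselves are expressed through difference quotients,
   that is, through values at points. Ergodicity is assumed for strictly invariant sets only, so the
   level sets must be invariant at every point and not merely up to null sets; this is why the
   minimising sequence is averaged over cubes of growing side before its upper limit is taken.
   Finally, averages in space have to be linked with expectations: every function averaged along an
   orbit is uniformly continuous on bounded sets, so its cube average is an iterated limit of
   Riemann sums, hence a limit of convex combinations of translates, and its expectation is known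
   without exchanging two integrals. *)
Require Import Defs.
From HB Require Import structures.
From mathcomp Require Import all_boot all_order all_algebra.
From mathcomp Require Import all_classical all_reals all_analysis.
From mathcomp Require Import measurable_realfun ring lra.
Set Implicit Arguments.
Unset Strict Implicit.

Import Order.TTheory GRing.Theory Num.Theory.
Import numFieldNormedType.Exports.
Local Open Scope classical_set_scope.
Local Open Scope ring_scope.

(** * Averages over intervals and boxes *)

Section OneDimensionalAverage.
Context {R : realType}.
Implicit Types (f g : R -> R) (a b : R).

(** The same as continuity on the line, with the modulus on bounded sets made explicit: averaging
    out one of several variables requires a modulus that is uniform in that variable. *)
Definition luc1 (f : R -> R) := forall B e : R, 0 < e ->
  exists2 del : R, 0 < del & forall x y, `|x| <= B -> `|y| <= B ->
    `|x - y| <= del -> `|f x - f y| <= e.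

Definition integ a b f : R := (\int[@lebesgue_measure R]_(t in `[a, b]) f t)%R.

Definition avg a b f := (b - a)^-1 * integ a b f.

Lemma luc1_continuous f : luc1 f -> continuous f.
Proof.
move=> lf x; apply/cvgrPdist_le => /= e e0.
have [del d0 H] := lf (`|x| + 1) e e0.
have m0 : 0 < Num.min 1 del by rewrite lt_min ltr01.
exists (Num.min 1 del) => //= y /=; rewrite lt_min => /andP[y1 yd].
apply: H; last exact: ltW.
  by rewrite lerDl.
have -> : y = x - (x - y) by ring.
by rewrite (le_trans (ler_normB _ _))// lerD2l ltW.
Qed.

Lemma luc1_integrable f a b : luc1 f ->
  (@lebesgue_measure R).-integrable `[a, b] (EFin \o f).
Proof.
move=> /luc1_continuous cf; apply: continuous_compact_integrable.
  exact: segment_compact.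
exact: continuous_subspaceT.
Qed.

Lemma luc1_cst (c : R) : luc1 (fun=> c).
Proof. by move=> B e e0; exists 1 => // x y _ _ _; rewrite subrr normr0 ltW. Qed.

Lemma luc1D f g : luc1 f -> luc1 g -> luc1 (fun t => f t + g t).
Proof.
move=> lf lg B e e0; have e2 : 0 < e / 2 by rewrite divr_gt0.
have [d1 d10 H1] := lf B _ e2; have [d2 d20 H2] := lg B _ e2.
exists (Num.min d1 d2); first by rewrite lt_min d10.
move=> x y xB yB; rewrite le_min => /andP[xy1 xy2].
have := H1 _ _ xB yB xy1; have := H2 _ _ xB yB xy2.
rewrite !ler_norml; lra.
Qed.

Lemma luc1Z (c : R) f : luc1 f -> luc1 (fun t => c * f t).
Proof.
move=> lf B e e0; have c1 : 0 < `|c| + 1 by rewrite ltr_wpDl.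
have [d1 d10 H1] := lf B (e / (`|c| + 1)) (divr_gt0 e0 c1).
exists d1 => // x y xB yB xy; rewrite -mulrBr normrM.
have := H1 _ _ xB yB xy; rewrite ler_pdivlMr// => H.
apply: le_trans H; rewrite mulrC ler_wpM2l// lerDl//.
Qed.

Lemma integ_cst a b c : a <= b -> integ a b (fun=> c) = c * (b - a).
Proof.
move=> ab; rewrite /integ Rintegral_cst//= lebesgue_measure_itv/= lte_fin.
case: ltgtP ab => [ab _//|//|-> _]; rewrite ?EFinN -?EFinB//=.
by rewrite subrr.
Qed.

Lemma integD a b f g : luc1 f -> luc1 g ->
  integ a b (fun t => f t + g t) = integ a b f + integ a b g.
Proof. by move=> lf lg; rewrite /integ RintegralD//; exact: luc1_integrable. Qed.

Lemma integZ a b c f : luc1 f -> integ a b (fun t => c * f t) = c * integ a b f.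
Proof. by move=> lf; rewrite /integ RintegralZl//; exact: luc1_integrable. Qed.

Lemma le_integ a b f g : luc1 f -> luc1 g ->
  (forall t, a <= t <= b -> f t <= g t) -> integ a b f <= integ a b g.
Proof.
move=> lf lg fg; apply: le_Rintegral => //; try exact: luc1_integrable.
Qed.

Lemma integ_split a b c f : luc1 f -> a <= b -> b <= c ->
  integ a c f = integ a b f + integ b c f.
Proof.
move=> lf ab bc; rewrite /integ.
have h := @Rintegral_itvB R f (BLeft a) (BRight c) b (luc1_integrable a c lf).
rewrite -(@Rintegral_itv_obnd_cbnd R b (BRight c) f); last first.
  apply: integrableS (luc1_integrable b c lf) => //.
  by move=> x /=; rewrite !in_itv/= => /andP[/ltW -> ->].
by rewrite -h ?bnd_simp// addrC subrK.
Qed.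

Lemma integ_near a b c e f : luc1 f -> a <= b ->
  (forall t, a <= t <= b -> `|f t - c| <= e) ->
  `|integ a b f - c * (b - a)| <= e * (b - a).
Proof.
move=> lf ab fc.
have h1 : integ a b (fun=> c - e) <= integ a b f.
  apply: le_integ => // [|t /fc]; first exact: luc1_cst.
  by rewrite ler_norml; lra.
have h2 : integ a b f <= integ a b (fun=> c + e).
  apply: le_integ => // [|t /fc]; first exact: luc1_cst.
  by rewrite ler_norml; lra.
move: h1 h2; rewrite !integ_cst// ler_norml; nra.
Qed.

(** Left Riemann sums divided by the length: a mean of [N.+1] values with equal weights. That they
    are convex combinations is what later places cube averages in the closed convex hull of the
    translates. *)
Definition riemann a b f (N : nat) : R :=
  N.+1%:R^-1 * \sum_(i < N.+1) f (a + (b - a) * (i%:R / N.+1%:R)).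

Lemma integ_sum a h f n : luc1 f -> 0 <= h ->
  integ a (a + h * n%:R) f =
  \sum_(i < n) integ (a + h * i%:R) (a + h * i.+1%:R) f.
Proof.
move=> lf h0; elim: n => [|n IH].
  rewrite big_ord0 mulr0 addr0 /integ set_itv1; exact: Rintegral_set1.
rewrite big_ord_recr/= -IH; apply: integ_split => //.
  by rewrite lerDl mulr_ge0.
by rewrite lerD2l ler_wpM2l// ler_nat.
Qed.

(** Once the cell length [h] is below the modulus for [e], each cell contributes an error of at most
    [e * h]. *)
Lemma riemann_cvg a b f : luc1 f -> a < b -> riemann a b f @ \oo --> avg a b f.
Proof.
move=> lf ab; apply/cvgrPdist_le => /= e e0.
have [del d0 H] := lf (`|a| + `|b|) e e0.
near=> N.
have ba0 : 0 < b - a by rewrite subr_gt0.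
pose h := (b - a) / N.+1%:R.
have h0 : 0 < h by rewrite divr_gt0.
have hd : h <= del.
  rewrite /h ler_pdivrMr// -ler_pdivrMl//.
  apply: (@le_trans _ _ N%:R); last by rewrite ler_nat.
  near: N; exact: nbhs_infty_ger.
have bE : b = a + h * N.+1%:R by rewrite /h divfK ?pnatr_eq0//; ring.
rewrite /avg {2}bE integ_sum//; last exact: ltW.
rewrite /riemann.
have -> : N.+1%:R^-1 = (b - a)^-1 * h.
  by rewrite /h mulrA mulVf ?mul1r// gt_eqF.
rewrite -mulrA -mulrBr mulr_sumr -sumrB normrM gtr0_norm ?invr_gt0//.
rewrite mulrC ler_pdivrMr//.
apply: (le_trans (ler_norm_sum _ _ _)).
apply: (@le_trans _ _ (\sum_(i < N.+1) e * h)); last first.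
  rewrite sumr_const card_ord -[X in X <= _]mulr_natr -mulrA.
  by rewrite ler_pM2l// /h divfK// pnatr_eq0.
apply: ler_sum => i _.
have iE : (b - a) * (i%:R * ((b - a)^-1 * h)) = h * i%:R by field; rewrite gt_eqF.
rewrite iE.
have hh : a + h * i.+1%:R - (a + h * i%:R) = h by rewrite -natr1; ring.
have := @integ_near (a + h * i%:R) (a + h * i.+1%:R) (f (a + h * i%:R)) e f lf.
rewrite hh [f _ * h]mulrC; apply.
  by rewrite -subr_ge0 hh ltW.
have hi0 : 0 <= h * i%:R by rewrite mulr_ge0// ltW.
have hib : a + h * i.+1%:R <= b.
  by rewrite bE lerD2l ler_wpM2l ?(ltW h0)// ler_nat.
move=> t /andP[t1 t2]; apply: H.
- have := ler_norm a; have := ler_norm b; have := ler_norm (- a).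
  have := ler_norm (- b); have := normr_ge0 a; have := normr_ge0 b.
  rewrite !normrN ler_norml; lra.
- have := ler_norm a; have := ler_norm b; have := ler_norm (- a).
  have := ler_norm (- b); have := normr_ge0 a; have := normr_ge0 b.
  rewrite !normrN ler_norml; lra.
- rewrite ler_norml; lra.
Unshelve. all: by end_near.
Qed.

Lemma luc1_shift f s : luc1 f -> luc1 (fun t => f (t + s)).
Proof.
move=> lf B e e0; have [d1 d10 H1] := lf (B + `|s|) e e0.
exists d1 => // x y xB yB xy; apply: H1.
- by rewrite (le_trans (ler_normD _ _))// lerD2r.
- by rewrite (le_trans (ler_normD _ _))// lerD2r.
- by rewrite opprD addrACA subrr addr0.
Qed.

(** Both sides have literally the same Riemann sums, so uniqueness of the limit replaces a change of
    variables. *)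
Lemma avg_shift a b s f : luc1 f -> a < b ->
  avg a b (fun t => f (t + s)) = avg (a + s) (b + s) f.
Proof.
move=> lf ab.
have h1 := @riemann_cvg _ _ _ (luc1_shift s lf) ab.
have h2 : riemann (a + s) (b + s) f @ \oo --> avg (a + s) (b + s) f.
  by apply: riemann_cvg => //; rewrite ltrD2r.
have E : riemann a b (fun t => f (t + s)) = riemann (a + s) (b + s) f.
  apply/funext => N; rewrite /riemann; congr (_ * _); apply: eq_bigr => i _.
  by congr f; ring.
rewrite E in h1; exact: (cvg_unique _ h1 h2).
Qed.

Lemma avgD a b f g : luc1 f -> luc1 g ->
  avg a b (fun t => f t + g t) = avg a b f + avg a b g.
Proof. by move=> lf lg; rewrite /avg integD// mulrDr. Qed.

Lemma avgZ a b c f : luc1 f -> avg a b (fun t => c * f t) = c * avg a b f.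
Proof. by move=> lf; rewrite /avg integZ// mulrCA. Qed.

Lemma avg_cst a b c : a < b -> avg a b (fun=> c) = c.
Proof.
move=> ab; rewrite /avg integ_cst ?ltW// mulrC mulfK//.
by rewrite subr_eq0 gt_eqF.
Qed.

Lemma le_avg a b f g : luc1 f -> luc1 g -> a < b ->
  (forall t, a <= t <= b -> f t <= g t) -> avg a b f <= avg a b g.
Proof.
move=> lf lg ab fg; rewrite /avg ler_pM2l ?invr_gt0 ?subr_gt0//.
exact: le_integ.
Qed.

Lemma avgB_le a b e f g : luc1 f -> luc1 g -> a < b ->
  (forall t, a <= t <= b -> `|f t - g t| <= e) ->
  `|avg a b f - avg a b g| <= e.
Proof.
move=> lf lg ab fg.
have lN : luc1 (fun t => f t + -1 * g t) by apply: luc1D => //; exact: luc1Z.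
have -> : avg a b f - avg a b g = avg a b (fun t => f t + -1 * g t).
  by rewrite avgD ?avgZ ?mulN1r//; exact: luc1Z.
rewrite ler_norml -[X in X <= _ <= _](@avg_cst a b)// -[X in _ <= _ <= X](@avg_cst a b e)//.
by rewrite !le_avg//; try exact: luc1_cst; move=> t /fg; rewrite ler_norml; lra.
Qed.

(* Both averages are compared with the mass of [f] on the smaller interval; the
   two corrections are each at most [C] times the lost proportion of length. *)
Lemma avg_nested a b a' b' C f : luc1 f -> a <= a' -> a' < b' -> b' <= b ->
  (forall t, a <= t <= b -> `|f t| <= C) ->
  `|avg a b f - avg a' b' f| <= 2 * C * (1 - (b' - a') / (b - a)).
Proof.
move=> lf aa' ab' bb' fC.
have ba0 : 0 < b - a by lra.
have ba0' : 0 < b' - a' by lra.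
have E : integ a b f = integ a a' f + (integ a' b' f + integ b' b f).
  by rewrite -!integ_split//; lra.
have H1 : `|integ a a' f| <= C * (a' - a).
  have := @integ_near a a' 0 C f lf aa'; rewrite mul0r subr0; apply=> t ?.
  by rewrite subr0 fC//; lra.
have H2 : `|integ b' b f| <= C * (b - b').
  have := @integ_near b' b 0 C f lf bb'; rewrite mul0r subr0; apply=> t ?.
  by rewrite subr0 fC//; lra.
have H3 : `|integ a' b' f| <= C * (b' - a').
  have := @integ_near a' b' 0 C f lf (ltW ab'); rewrite mul0r subr0; apply=> t ?.
  by rewrite subr0 fC//; lra.
set u := integ a a' f in H1 E; set v := integ b' b f in H2 E.
set w := integ a' b' f in H3 E *.
have -> : avg a b f - avg a' b' f =
    (b - a)^-1 * (u + v - w / (b' - a') * ((b - a) - (b' - a'))).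
  by rewrite /avg E -/w; field; rewrite !gt_eqF.
rewrite normrM gtr0_norm ?invr_gt0// mulrC ler_pdivrMr//.
have -> : 2 * C * (1 - (b' - a') / (b - a)) * (b - a)
   = C * (a' - a) + C * (b - b') + C * ((b - a) - (b' - a')).
  by field; rewrite gt_eqF.
apply: (le_trans (ler_normB _ _)); apply: lerD.
  by apply: (le_trans (ler_normD _ _)); exact: lerD.
rewrite normrM (ger0_norm (x := _ - _ - _)); last by lra.
rewrite ler_wpM2r//; first by lra.
by rewrite normrM normfV (gtr0_norm ba0') ler_pdivrMr.
Qed.

End OneDimensionalAverage.

Section IteratedAverage.
Context {R : realType}.
Variable d : nat.
Implicit Types (h g : (nat -> R) -> R) (a b x : nat -> R) (k : nat).

Definition upd x k (t : R) : nat -> R := fun j => if j == k then t else x j.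

(** Points are sequences so that iterated averages recurse on the number of variables, as [iter_int]
    does; only the coordinates below [d] are tested, and they alone can influence [h]
    ([lucn_dep]). *)
Definition lucn h := forall B e : R, 0 < e ->
  exists2 del : R, 0 < del & forall x y,
    (forall i, (i < d)%N -> `|x i| <= B) -> (forall i, (i < d)%N -> `|y i| <= B) ->
    (forall i, (i < d)%N -> `|x i - y i| <= del) -> `|h x - h y| <= e.

Fixpoint ibox a b k h x : R :=
  if k is k'.+1 then avg (a k') (b k') (fun t => ibox a b k' h (upd x k' t))
  else h x.

Lemma lucn_slice h x k : lucn h -> luc1 (fun t => h (upd x k t)).
Proof.
move=> lh B e e0.
have [del d0 H] := lh (`|B| + \sum_(j < d) `|x j|) e e0.
have xb i : (i < d)%N -> `|x i| <= \sum_(j < d) `|x j|.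
  by move=> id; rewrite (bigD1 (Ordinal id))//= lerDl sumr_ge0.
have S0 : 0 <= \sum_(j < d) `|x j| by rewrite sumr_ge0.
have ub t i : `|t| <= B -> (i < d)%N ->
    `|upd x k t i| <= `|B| + \sum_(j < d) `|x j|.
  move=> tB id; rewrite /upd; case: eqP => _.
    by rewrite (le_trans tB)// (le_trans (ler_norm _))// lerDl.
  by rewrite (le_trans (xb _ id))// lerDr.
exists del => // s t sB tB st; apply: H => i id; [exact: ub|exact: ub|].
by rewrite /upd; case: eqP => // _; rewrite subrr normr0 ltW.
Qed.

Lemma lucn_cst (c : R) : lucn (fun=> c).
Proof. by move=> B e e0; exists 1 => // x y _ _ _; rewrite subrr normr0 ltW. Qed.

Lemma lucnD h g : lucn h -> lucn g -> lucn (fun y => h y + g y).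
Proof.
move=> lf lg B e e0; have e2 : 0 < e / 2 by rewrite divr_gt0.
have [d1 d10 H1] := lf B _ e2; have [d2 d20 H2] := lg B _ e2.
exists (Num.min d1 d2); first by rewrite lt_min d10.
move=> x y xB yB xy.
have h1 : `|h x - h y| <= e / 2.
  by apply: H1 => // i id; rewrite (le_trans (xy _ id))// ge_min lexx.
have h2 : `|g x - g y| <= e / 2.
  by apply: H2 => // i id; rewrite (le_trans (xy _ id))// ge_min lexx orbT.
move: h1 h2; rewrite !ler_norml; lra.
Qed.

Lemma lucnZ (c : R) h : lucn h -> lucn (fun y => c * h y).
Proof.
move=> lf B e e0; have c1 : 0 < `|c| + 1 by rewrite ltr_wpDl.
have [d1 d10 H1] := lf B (e / (`|c| + 1)) (divr_gt0 e0 c1).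
exists d1 => // x y xB yB xy; rewrite -mulrBr normrM.
have := H1 _ _ xB yB xy; rewrite ler_pdivlMr// => H.
by apply: le_trans H; rewrite mulrC ler_wpM2l// lerDl.
Qed.

(** Points that agree below [d] satisfy every closeness condition, so their values differ by at most
    any positive [e]; half of a nonzero difference gives the contradiction. *)
Lemma lucn_dep h x y : lucn h -> (forall j, (j < d)%N -> x j = y j) -> h x = h y.
Proof.
move=> lh xy; apply/eqP; rewrite -subr_eq0 -normr_eq0; apply/negP => /negP hxy.
have e0 : 0 < `|h x - h y| / 2 by rewrite divr_gt0// lt_neqAle eq_sym hxy /=.
have [del d0 H] := lh (\sum_(j < d) `|x j|) _ e0.
have xb i : (i < d)%N -> `|x i| <= \sum_(j < d) `|x j|.
  by move=> id; rewrite (bigD1 (Ordinal id))//= lerDl sumr_ge0.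
have yb i : (i < d)%N -> `|y i| <= \sum_(j < d) `|x j|.
  by move=> id; rewrite -xy// xb.
have xyd i : (i < d)%N -> `|x i - y i| <= del.
  by move=> id; rewrite xy// subrr normr0 ltW.
have := H x y xb yb xyd.
rewrite leNgt ltr_pdivrMr// ltr_pMr ?ltr1n//.
by move: e0; rewrite pmulr_lgt0.
Qed.

Section FixedBox.
Variables (a b : nat -> R).
Hypothesis ab : forall j, a j < b j.

Lemma lucn_ibox k h : lucn h -> lucn (ibox a b k h).
Proof.
move=> lh; elim: k => //= k IH B e e0.
(* The radius also covers the interval [[a k, b k]], over which coordinate [k] now runs. *)
have [del d0 H] := IH (Num.max B (`|a k| + `|b k|)) e e0.
exists del => // x y xB yB xy; apply: avgB_le => //; try exact: lucn_slice.
move=> t /andP[at_ tb]; apply: H => i id; rewrite /upd; case: eqP => ik.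
- rewrite le_max; apply/orP; right.
  have := ler_norm (a k); have := ler_norm (b k); have := ler_norm (- a k).
  have := ler_norm (- b k); have := normr_ge0 (a k); have := normr_ge0 (b k).
  rewrite !normrN ler_norml; lra.
- by rewrite le_max xB.
- rewrite le_max; apply/orP; right.
  have := ler_norm (a k); have := ler_norm (b k); have := ler_norm (- a k).
  have := ler_norm (- b k); have := normr_ge0 (a k); have := normr_ge0 (b k).
  rewrite !normrN ler_norml; lra.
- by rewrite le_max yB.
- by rewrite subrr normr0 ltW.
- exact: xy.
Qed.

Lemma luc1_ibox k j h x : lucn h -> luc1 (fun t => ibox a b k h (upd x j t)).
Proof. by move=> lh; apply/lucn_slice/lucn_ibox. Qed.

Lemma iboxD k h g x : lucn h -> lucn g ->
  ibox a b k (fun y => h y + g y) x = ibox a b k h x + ibox a b k g x.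
Proof.
move=> lh lg; elim: k x => //= k IH x.
rewrite -avgD; try exact: luc1_ibox.
by congr avg; apply/funext => t; rewrite IH.
Qed.

Lemma iboxZ k (c : R) h x : lucn h ->
  ibox a b k (fun y => c * h y) x = c * ibox a b k h x.
Proof.
move=> lh; elim: k x => //= k IH x.
rewrite -avgZ; try exact: luc1_ibox.
by congr avg; apply/funext => t; rewrite IH.
Qed.

Lemma ibox_cst k c x : ibox a b k (fun=> c) x = c.
Proof.
elim: k x => //= k IH x; rewrite -[RHS](@avg_cst _ (a k) (b k))//.
by congr avg; apply/funext => t; rewrite IH.
Qed.

Lemma le_ibox k h g x : lucn h -> lucn g -> (forall y, h y <= g y) ->
  ibox a b k h x <= ibox a b k g x.
Proof.
move=> lh lg hg; elim: k x => //= k IH x.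
by apply: le_avg => //; exact: luc1_ibox.
Qed.

Lemma iboxB_le k h g (e : R) x : lucn h -> lucn g -> (forall y, `|h y - g y| <= e) ->
  `|ibox a b k h x - ibox a b k g x| <= e.
Proof.
move=> lh lg hg; elim: k x => //= k IH x.
by apply: avgB_le => //; exact: luc1_ibox.
Qed.

Lemma ibox_bound k h (C : R) x : lucn h -> (forall y, `|h y| <= C) ->
  `|ibox a b k h x| <= C.
Proof.
move=> lh hC; rewrite -[ibox _ _ _ _ _]subr0 -(ibox_cst k 0 x).
by apply: iboxB_le => // [|y]; [exact: lucn_cst|rewrite subr0].
Qed.

Lemma ibox_dep k h x y : lucn h ->
  (forall j, (k <= j < d)%N -> x j = y j) -> ibox a b k h x = ibox a b k h y.
Proof.
move=> lh; elim: k x y => [|k IH] x y xy /=.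
  by apply: (lucn_dep lh) => j jd; exact: xy.
congr avg; apply/funext => t; apply: IH => j /andP[kj jd]; rewrite /upd.
by case: eqP => // /eqP jk; apply: xy; rewrite jd ltn_neqAle eq_sym jk kj.
Qed.

Lemma eq_ibox k h g x : lucn h -> lucn g -> (k <= d)%N ->
  (forall y, (forall j, (j < k)%N -> a j <= y j <= b j) ->
     (forall j, (k <= j)%N -> y j = x j) -> h y = g y) ->
  ibox a b k h x = ibox a b k g x.
Proof.
move=> lh lg; elim: k x => [|k IH] x kd hg /=; first exact: hg.
rewrite /avg; congr (_ * _); apply: eq_Rintegral => t.
rewrite inE/= in_itv/= => tab; apply: IH => [|y yab yx]; first exact: ltnW.
apply: hg => j.
  rewrite ltnS leq_eqVlt => /predU1P[->|]; last exact: yab.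
  by rewrite yx// /upd eqxx.
by move=> kj; rewrite yx ?(ltnW kj)// /upd gtn_eqF.
Qed.

End FixedBox.

(** The intervals are exchanged one coordinate at a time, each exchange costing at most [e] by
    [avg_nested]. *)
Lemma ibox_nested (a b a' b' : nat -> R) k (C e : R) h x :
  (forall j, (a j <= a' j) && (a' j < b' j) && (b' j <= b j)) ->
  (forall j, 2 * C * (1 - (b' j - a' j) / (b j - a j)) <= e) ->
  lucn h -> (forall y, `|h y| <= C) ->
  `|ibox a b k h x - ibox a' b' k h x| <= k%:R * e.
Proof.
move=> aabb Ce lh hC.
have ab j : a j < b j by have := aabb j; lra.
have ab' j : a' j < b' j by have := aabb j; lra.
elim: k x => [x|k IH x] /=; first by rewrite subrr normr0 mul0r.
rewrite -[in leRHS]natr1 mulrDl mul1r.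
rewrite -(subrK (avg (a k) (b k) (fun t => ibox a' b' k h (upd x k t)))
  (avg (a k) (b k) _)) -addrA.
apply: (le_trans (ler_normD _ _)); apply: lerD.
  apply: avgB_le => //; try exact: luc1_ibox.
apply: le_trans (Ce k); apply: avg_nested; try (have := aabb k; lra).
  exact: luc1_ibox.
by move=> t _; exact: ibox_bound.
Qed.

Lemma ibox_shift (a b s : nat -> R) k h x : (forall j, a j < b j) -> lucn h ->
  ibox a b k (fun y => h (fun j => y j + s j)) x =
  ibox (fun j => a j + s j) (fun j => b j + s j) k h (fun j => x j + s j).
Proof.
move=> ab lh; have abs j : a j + s j < b j + s j by rewrite ltrD2r.
elim: k x => //= k IH x; rewrite -avg_shift//; last exact: luc1_ibox.
congr avg; apply/funext => t; rewrite IH; congr ibox; apply/funext => j.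
by rewrite /upd; case: eqP => // ->.
Qed.

Definition cube (M : R) h : R :=
  ibox (fun=> - (M / 2)) (fun=> M / 2) d h (fun=> 0).

Lemma half_lt (M : R) : 0 < M -> - (M / 2) < M / 2. Proof. by move=> M0; lra. Qed.

Lemma cubeD (M : R) h g : 0 < M -> lucn h -> lucn g ->
  cube M (fun y => h y + g y) = cube M h + cube M g.
Proof. by move=> M0 lh lg; apply: iboxD => // _; exact: half_lt. Qed.

Lemma cubeZ (M c : R) h : 0 < M -> lucn h -> cube M (fun y => c * h y) = c * cube M h.
Proof. by move=> M0 lh; apply: iboxZ => // _; exact: half_lt. Qed.

Lemma cube_cst (M c : R) : 0 < M -> cube M (fun=> c) = c.
Proof. by move=> M0; apply: ibox_cst => // _; exact: half_lt. Qed.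

Lemma le_cube (M : R) h g : 0 < M -> lucn h -> lucn g -> (forall y, h y <= g y) ->
  cube M h <= cube M g.
Proof. by move=> M0 lh lg hg; apply: le_ibox => // _; exact: half_lt. Qed.

(** The shifted and the centred cube both have side [M] and both lie in the cube of half-side
    [M / 2 + r]; comparing each of them with the large one costs [4 C r / M] per coordinate, whence
    the 8. *)
Lemma cube_shift_le (M r C : R) h (s : nat -> R) : 0 < M -> 0 <= r -> lucn h ->
  (forall y, `|h y| <= C) -> (forall j, `|s j| <= r) ->
  `|cube M (fun y => h (fun j => y j + s j)) - cube M h| <= 8 * C * d%:R * r / M.
Proof.
move=> M0 r0 lh hC sr.
have C0 : 0 <= C by rewrite (le_trans _ (hC (fun=> 0))).
rewrite /cube ibox_shift//; last by move=> _; exact: half_lt.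
rewrite (ibox_dep _ _ (y := fun=> 0) lh); last first.
  by move=> j /andP[/leq_ltn_trans h1 /h1]; rewrite ltnn.
pose L := M / 2 + r.
have small (m1 m2 : nat -> R) :
    (forall j, [/\ - L <= m1 j, m2 j <= L & m2 j - m1 j = M]) ->
    `|ibox (fun=> - L) (fun=> L) d h (fun=> 0) - ibox m1 m2 d h (fun=> 0)|
      <= d%:R * (4 * C * r / M).
  move=> H; apply: (@ibox_nested _ _ _ _ _ C) => // j.
    by have [-> -> mM] := H j; rewrite /= andbT -subr_gt0 mM.
  have [_ _ ->] := H j.
  have -> : L - - L = M + 2 * r by rewrite /L; field.
  have Mr0 : 0 < M + 2 * r by lra.
  have -> : 2 * C * (1 - M / (M + 2 * r)) = 4 * C * r / (M + 2 * r).
    by field; rewrite gt_eqF.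
  rewrite ler_wpM2l ?mulr_ge0// lef_pV2 ?posrE//; lra.
rewrite -(subrK (ibox (fun=> - L) (fun=> L) d h (fun=> 0)) (ibox _ _ d h _)) -addrA.
apply: (le_trans (ler_normD _ _)).
have -> : 8 * C * d%:R * r / M =
    d%:R * (4 * C * r / M) + d%:R * (4 * C * r / M) by ring.
apply: lerD; last first.
  by apply: small => j; rewrite /L; split; [lra|lra|field].
rewrite distrC; apply: small => j; have := sr j; rewrite ler_norml /L => /andP[s1 s2];
  by split; [lra|lra|field].
Qed.

Lemma cube_shrink_le (M L C : R) h : 0 < L -> 2 * L < M -> lucn h -> (forall y, `|h y| <= C) ->
  `|cube M h - cube (M - 2 * L) h| <= d%:R * (4 * C * L / M).
Proof.
move=> L0 LM lh hC; have M0 : 0 < M by lra.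
apply: (@ibox_nested _ _ _ _ _ C) => // [j|j]; first lra.
rewrite le_eqVlt; apply/orP; left; apply/eqP; field; lra.
Qed.

End IteratedAverage.

(** * Row vectors and expectations *)

Lemma cvg_le_cst {R : realType} (u : nat -> R) (l C : R) :
  (forall n, u n <= C) -> u @ \oo --> l -> l <= C.
Proof.
move=> uC; apply: (@closed_cvg _ _ _ _ u (fun t => t <= C)); first exact: closed_le.
exact: nearW.
Qed.

Section RowVectors.
Context {R : realType}.
Variable d : nat.
Implicit Types (x y : 'rV[R]_d) (f g : 'rV[R]_d -> R).

Lemma rV_norm_leP x (B : R) : 0 <= B ->
  reflect (forall i, `|x 0 i| <= B) (`|x| <= B).
Proof.
move=> B0; rewrite /Num.norm/= mx_normrE; apply: (iffP (bigmax_leP _ _ _ _)).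
  by move=> [_ H] i; exact: (H (0, i)).
by move=> H; split=> // -[i j] _; rewrite ord1; exact: H.
Qed.

Lemma rV_coord_le x i : `|x 0 i| <= `|x|.
Proof. by move: i; apply/rV_norm_leP. Qed.

Definition luc f := forall B e : R, 0 < e ->
  exists2 del : R, 0 < del & forall x y, `|x| <= B -> `|y| <= B ->
    `|x - y| <= del -> `|f x - f y| <= e.

Lemma rV_ball_compact (B : R) : compact [set x : 'rV[R]_d | `|x| <= B].
Proof.
apply: bounded_closed_compact.
  exists B; split=> [|M BM x /= xB]; first exact: num_real.
  by rewrite (le_trans xB)// ltW.
rewrite (_ : [set _ | _] = (fun x : 'rV[R]_d => `|x|) @^-1` [set t | t <= B])//.
apply: closed_comp => [x _|]; [exact: norm_continuous|exact: closed_le].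
Qed.

(** Heine-Cantor on closed balls, through the near-covering form of compactness: the modulus [del]
    is the parameter that tends to [0^'+]. *)
Lemma continuous_luc f : continuous f -> luc f.
Proof.
move=> cf B e e0.
have cK : compact [set x : 'rV[R]_d | `|x| <= B] by exact: rV_ball_compact.
move/compact_near_coveringP : cK => /(_ R (0^'+)
  (fun del x => forall y, `|x - y| <= del -> `|f x - f y| <= e) _) [].
  move=> x _; have e2 : 0 < e / 2 by rewrite divr_gt0.
  have /cvgrPdist_lt /(_ _ e2) /nbhs_ballP[r /= r0 H] := cf x.
  have r2 : 0 < r / 2 by rewrite divr_gt0.
  near=> x' del => /= y x'y.
  have xx' : `|x - x'| < r / 2.
    by near: x'; apply/nbhs_ballP; exists (r / 2) => //= z; rewrite -ball_normE.
  have dr : del < r / 2 by near: del; exact: nbhs_right_lt.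
  have h1 : `|f x - f x'| < e / 2.
    by apply: H; rewrite -ball_normE /=; lra.
  have h2 : `|f x - f y| < e / 2.
    apply: H; rewrite -ball_normE /=.
    have -> : x - y = (x - x') + (x' - y) by rewrite addrA subrK.
    by apply: le_lt_trans (ler_normD _ _) _; lra.
  have -> : f x' - f y = (f x - f y) - (f x - f x') by ring.
  by apply: le_trans (ler_normB _ _) _; lra.
move=> r /= r0 H; exists (r / 2); first by rewrite divr_gt0.
move=> x y xB yB xy; apply: (H (r / 2)) => //=; last by rewrite divr_gt0.
by rewrite sub0r normrN gtr0_norm ?divr_gt0// ltr_pdivrMr// ltr_pMr// ltr1n.
Unshelve. all: by end_near. Qed.

Lemma luc_row f : luc f -> lucn d (fun y : nat -> R => f (\row_i y i)).
Proof.
move=> lf B e e0; have [del d0 H] := lf `|B| e e0; exists del => // x y xB yB xy.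
apply: H; apply/rV_norm_leP; rewrite ?normr_ge0 ?(ltW d0)// => i; rewrite ?mxE.
- by rewrite (le_trans (xB _ (ltn_ord i)))// ler_norm.
- by rewrite (le_trans (yB _ (ltn_ord i)))// ler_norm.
- by rewrite xy// ltn_ord.
Qed.

Lemma luc_cst (c : R) : luc (fun=> c).
Proof. by move=> B e e0; exists 1 => // x y _ _ _; rewrite subrr normr0 ltW. Qed.

Lemma lucD f g : luc f -> luc g -> luc (fun t => f t + g t).
Proof.
move=> lf lg B e e0; have e2 : 0 < e / 2 by rewrite divr_gt0.
have [d1 d10 H1] := lf B _ e2; have [d2 d20 H2] := lg B _ e2.
exists (Num.min d1 d2); first by rewrite lt_min d10.
move=> x y xB yB; rewrite le_min => /andP[xy1 xy2].
have := H1 _ _ xB yB xy1; have := H2 _ _ xB yB xy2.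
rewrite !ler_norml; lra.
Qed.

Lemma lucZ (c : R) f : luc f -> luc (fun t => c * f t).
Proof.
move=> lf B e e0; have c1 : 0 < `|c| + 1 by rewrite ltr_wpDl.
have [d1 d10 H1] := lf B (e / (`|c| + 1)) (divr_gt0 e0 c1).
exists d1 => // x y xB yB xy; rewrite -mulrBr normrM.
have := H1 _ _ xB yB xy; rewrite ler_pdivlMr// => H.
by apply: le_trans H; rewrite mulrC ler_wpM2l// lerDl.
Qed.

Lemma luc_norm f : luc f -> luc (fun t => `|f t|).
Proof.
move=> lf B e e0; have [d1 d10 H1] := lf B e e0; exists d1 => // x y xB yB xy.
exact: le_trans (ler_dist_dist _ _) (H1 _ _ xB yB xy).
Qed.

Lemma luc_shift f (s : 'rV[R]_d) : luc f -> luc (fun t => f (t + s)).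
Proof.
move=> lf B e e0; have [d1 d10 H1] := lf (B + `|s|) e e0.
exists d1 => // x y xB yB xy; apply: H1.
- by rewrite (le_trans (ler_normD _ _))// lerD2r.
- by rewrite (le_trans (ler_normD _ _))// lerD2r.
- by rewrite opprD addrACA subrr addr0.
Qed.

End RowVectors.

Section Expectation.
Context {R : realType} {dd : measure_display} {T : measurableType dd}.
Variables (mu : probability T R) (X : set T).
Hypothesis mX : measurable X.
Hypothesis X1 : mu X = 1%E.
Implicit Types f g : T -> R.

Definition bdd f (C : R) := forall w, X w -> `|f w| <= C.
(** One class closed under all operations used below, in which integrability is automatic because
    [X] has mass 1. *)
Definition bm f := measurable_fun X f /\ exists C, bdd f C.
Definition Ex f : R := (\int[mu]_(w in X) f w)%R.

Lemma bm_integrable f : bm f -> mu.-integrable X (EFin \o f).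
Proof.
move=> [mf [C fC]]; apply: measurable_bounded_integrable => //.
  have h : (mu X < +oo)%E by rewrite X1 ltry.
  exact: h.
exists C; split=> [|M CM x /= xX]; first exact: num_real.
by rewrite (le_trans (fC _ xX))// ltW.
Qed.

Lemma bm_cst c : bm (fun=> c).
Proof. by split=> //; exists `|c| => w _. Qed.

Lemma bmD f g : bm f -> bm g -> bm (fun w => f w + g w).
Proof.
move=> [mf [C fC]] [mg [D gD]]; split; first exact: measurable_funD.
exists (C + D) => w wX.
by rewrite (le_trans (ler_normD _ _))// lerD// ?fC// gD.
Qed.

Lemma bmM f g : bm f -> bm g -> bm (fun w => f w * g w).
Proof.
move=> [mf [C fC]] [mg [D gD]]; split; first exact: measurable_funM.
by exists (C * D) => w wX; rewrite normrM ler_pM// ?fC// gD.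
Qed.

Lemma bmZ c f : bm f -> bm (fun w => c * f w).
Proof. by move=> bf; apply: (bmM (bm_cst c)). Qed.

Lemma bmB f g : bm f -> bm g -> bm (fun w => f w - g w).
Proof.
move=> bf bg; have := bmD bf (bmZ (-1) bg).
by under eq_fun do rewrite mulN1r.
Qed.

Lemma bm_norm f : bm f -> bm (fun w => `|f w|).
Proof.
move=> [mf [C fC]]; split; first exact: measurableT_comp.
by exists C => w wX; rewrite normr_id fC.
Qed.

Lemma bm_sum n (f : nat -> T -> R) : (forall k, bm (f k)) ->
  bm (fun w => \sum_(k < n) f k w).
Proof.
move=> bf; elim: n => [|n IH].
  by under eq_fun do rewrite big_ord0; exact: bm_cst.
by under eq_fun do rewrite big_ord_recr/=; exact: bmD.
Qed.

Lemma ExD f g : bm f -> bm g -> Ex (fun w => f w + g w) = Ex f + Ex g.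
Proof. by move=> bf bg; rewrite /Ex RintegralD//; exact: bm_integrable. Qed.

Lemma ExZ c f : bm f -> Ex (fun w => c * f w) = c * Ex f.
Proof. by move=> bf; rewrite /Ex RintegralZl//; exact: bm_integrable. Qed.

Lemma ExB f g : bm f -> bm g -> Ex (fun w => f w - g w) = Ex f - Ex g.
Proof. by move=> bf bg; rewrite /Ex RintegralB//; exact: bm_integrable. Qed.

Lemma Ex_cst c : Ex (fun=> c) = c.
Proof. by rewrite /Ex Rintegral_cst// [X in fine X](X1 : _ = 1%E) mulr1. Qed.

Lemma Ex_sum n (f : nat -> T -> R) : (forall k, bm (f k)) ->
  Ex (fun w => \sum_(k < n) f k w) = \sum_(k < n) Ex (f k).
Proof.
move=> bf; elim: n => [|n IH].
  by rewrite big_ord0 -[RHS]Ex_cst; congr Ex; apply/funext => w; rewrite big_ord0.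
rewrite big_ord_recr/= -IH -ExD//; last exact: bm_sum.
by congr Ex; apply/funext => w; rewrite big_ord_recr.
Qed.

Lemma le_Ex f g : bm f -> bm g -> (forall w, X w -> f w <= g w) -> Ex f <= Ex g.
Proof. by move=> bf bg fg; apply: le_Rintegral => //; exact: bm_integrable. Qed.

Lemma Ex_dominated (f : nat -> T -> R) g C : (forall n, measurable_fun X (f n)) ->
  (forall n, bdd (f n) C) -> (forall w, X w -> f ^~ w @ \oo --> g w) ->
  [/\ measurable_fun X g, bdd g C,
      Ex \o f @ \oo --> Ex g & (fun n => Ex (fun w => `|f n w - g w|)) @ \oo --> 0].
Proof.
move=> mf fC fg.
have mg : measurable_fun X g by exact: measurable_fun_cvg mf fg.
have gC : bdd g C.
  move=> w wX; have /cvg_norm ng := fg _ wX.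
  by apply: (cvg_le_cst _ ng) => n /=; exact: fC.
have bg : bm g by split=> //; exists C.
have bf n : bm (f n) by split=> //; exists C.
have := @dominated_convergence _ T R mu X mX (fun n => EFin \o f n) (EFin \o g)
   (cst C%:E).
case.
- by move=> n; apply/measurable_EFinP.
- exact/measurable_EFinP.
- by apply: aeW => w wX; apply/fine_cvgP; split; [exact: nearW|exact: fg].
- exact: (bm_integrable (bm_cst C)).
- by apply: aeW => w n wX /=; rewrite lee_fin fC.
move=> ig H1 H2; split=> //.
  apply: fine_cvg; rewrite fineK//; exact: integrable_fin_num (bm_integrable bg).
by move/fine_cvg : H1.
Qed.

End Expectation.

(** * The mean ergodic theorem *)

Section MeanErgodicTheorem.
Context {R : realType} {dd : measure_display} {T : measurableType dd}.
Variables (d : nat) (mu : probability T R) (X : set T).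
Hypothesis mX : measurable X.
Hypothesis X1 : mu X = 1%E.
Variable act : 'rV[R]_d -> T -> T.
Hypothesis actD : forall x y w, act x (act y w) = act (x + y) w.
Hypothesis act0 : forall w, act 0 w = w.
Hypothesis Xact : forall x w, X w -> X (act x w).
Hypothesis mact : forall x, measurable_fun setT (act x).
Hypothesis mu_act : forall x A, measurable A -> mu (act x @^-1` A) = mu A.
Hypothesis mu_erg : forall A, measurable A -> A `<=` X ->
  (forall x, act x @^-1` A = A) -> mu A = 0%E \/ mu A = 1%E.
Implicit Types f g F : T -> R.

Local Notation Ex := (Ex mu X).
Local Notation bm := (bm X).
Local Notation bdd := (bdd X).

Lemma Xact_pre x : act x @^-1` X = X.
Proof.
apply/seteqP; split=> w /=; last exact: Xact.
by move=> /(Xact (- x)); rewrite actD addNr act0.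
Qed.

Lemma bdd_act x f C : bdd f C -> bdd (fun w => f (act x w)) C.
Proof. by move=> fC w /(Xact x)/fC. Qed.

Lemma measurable_act x f : measurable_fun X f -> measurable_fun X (fun w => f (act x w)).
Proof.
move=> mf _ B mB; have mP := mf mX B mB.
have := mact x measurableT mP; rewrite setTI => h.
suff -> : X `&` (fun w => f (act x w)) @^-1` B = act x @^-1` (X `&` f @^-1` B) by [].
by rewrite -[in LHS](Xact_pre x).
Qed.

Lemma bm_act x f : bm f -> bm (fun w => f (act x w)).
Proof.
move=> [mf [C fC]]; split; first exact: measurable_act.
by exists C; exact: bdd_act.
Qed.

Lemma Ex_act_ge0 x f : bm f -> (forall w, X w -> 0 <= f w) ->
  Ex (fun w => f (act x w)) = Ex f.
Proof.
move=> [mf _] f0; rewrite /Ex /Rintegral; congr fine.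
have mEf : measurable_fun X (EFin \o f) by exact/measurable_EFinP.
have := @ge0_integral_pushforward _ _ T T R (act x) (mact x) mu X (EFin \o f) mX mEf.
rewrite Xact_pre => <-; last by move=> w; rewrite inE => /f0; rewrite lee_fin.
by apply: eq_measure_integral => A mA _; exact: mu_act.
Qed.

(** Adding a bound [C] reduces to the non-negative case, where the pushforward formula applies
    directly. *)
Lemma Ex_act x f : bm f -> Ex (fun w => f (act x w)) = Ex f.
Proof.
move=> bf; have [_ [C fC]] := bf; have bC : bm (fun=> C) by exact: bm_cst.
have := @Ex_act_ge0 x (fun w => f w + C) (bmD bf bC).
rewrite !ExD ?Ex_cst//; last exact: bm_act.
move=> H; apply: (addIr C); apply: H => w /fC; rewrite ler_norml; lra.
Qed.

(** Correcting [g] by [C + D] times the indicator of [N] makes the inequality hold everywhere on [X]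
    and leaves the expectation unchanged. *)
Lemma le_Ex_ae (N : set T) f g : measurable N -> mu N = 0%E -> bm f -> bm g ->
  (forall w, X w -> ~ N w -> f w <= g w) -> Ex f <= Ex g.
Proof.
move=> mN N0 bf bg fg; have [_ [C fC]] := bf; have [_ [D gD]] := bg.
have bI : bm (\1_N : T -> R).
  split; first exact: measurable_funTS.
  by exists 1 => w _; rewrite indicE; case: (_ \in _); rewrite ?normr1 ?normr0.
have -> : Ex g = Ex (fun w => g w + (C + D) * \1_N w).
  rewrite ExD//; last exact: bmZ.
  rewrite ExZ// (_ : Ex \1_N = 0) ?mulr0 ?addr0//.
  rewrite /Ex /Rintegral integral_indic// (@subset_measure0 _ _ _ mu _ N)//.
  exact: measurableI.
apply: le_Ex => //; first by apply: bmD => //; exact: bmZ.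
move=> w wX; rewrite indicE; case: (asboolP (N w)) => [Nw|nNw].
  rewrite mem_set// mulr1; have := fC w wX; have := gD w wX.
  by rewrite !ler_norml; lra.
by rewrite memNset// mulr0 addr0 fg.
Qed.

(** With [lim] false, the finite convex combinations of translates of [F]; with [lim] true, the
    smallest such class that is also closed under pointwise limits on [X]. The large class contains
    the cube averages; the small one keeps continuity along orbits. The flag lets both share their
    inductions. *)
Inductive conv (lim : bool) F : (T -> R) -> Prop :=
| conv_refl : conv lim F F
| conv_act x g : conv lim F g -> conv lim F (fun w => g (act x w))
| conv_mix (t : R) g h : 0 <= t <= 1 -> conv lim F g -> conv lim F h ->
    conv lim F (fun w => t * g w + (1 - t) * h w)
| conv_lim (g_ : nat -> T -> R) g : lim -> (forall n, conv lim F (g_ n)) ->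
    (forall w, X w -> g_ ^~ w @ \oo --> g w) -> conv lim F g.

Lemma conv_bdd lim F g C : measurable_fun X F -> bdd F C -> conv lim F g ->
  measurable_fun X g /\ bdd g C.
Proof.
move=> mF FC; elim => {g} [//|x g _ [mg gC]|t g h /andP[t0 t1] _ [mg gC] _ [mh hC]|g_ g _ _ IH gg].
- by split; [exact: measurable_act|exact: bdd_act].
- split.
    by apply: measurable_funD; apply: measurable_funM.
  move=> w wX; have := gC w wX; have := hC w wX; rewrite !ler_norml.
  by move=> /andP[h1 h2] /andP[g1 g2]; apply/andP; split; nra.
- split; first by apply: measurable_fun_cvg gg => n; have [] := IH n.
  move=> w wX; have /cvg_norm ng := gg _ wX.
  by apply: (cvg_le_cst _ ng) => n /=; have [_] := IH n; exact.
Qed.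

Lemma conv_bm lim F g : bm F -> conv lim F g -> bm g.
Proof.
by move=> [mF [C FC]] cg; have [mg gC] := conv_bdd mF FC cg; split=> //; exists C.
Qed.

Lemma conv_trans lim F g h : conv lim F g -> conv lim g h -> conv lim F h.
Proof.
move=> cg; elim=> {h} [//|x h _ ch|t h k t01 _ ch _ ck|g_ h l _ IH gh].
- exact: conv_act.
- exact: conv_mix.
- exact: conv_lim gh.
Qed.

Lemma conv_weak F g : conv false F g -> conv true F g.
Proof.
elim=> {g} [|x h _ ch|t h k t01 _ ch _ ck|//].
- exact: conv_refl.
- exact: conv_act.
- exact: conv_mix.
Qed.

Lemma conv_Ex lim F g : bm F -> conv lim F g -> Ex g = Ex F.
Proof.
move=> bF; elim => {g} [//|x g cg IH|t g h _ cg IHg ch IHh|g_ g _ cg IH gg].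
- by rewrite Ex_act//; exact: conv_bm cg.
- have bg := conv_bm bF cg; have bh := conv_bm bF ch.
  by rewrite ExD ?ExZ ?IHg ?IHh//; [ring|exact: bmZ|exact: bmZ].
- have [mF [C FC]] := bF.
  have [|||_ _ + _] := @Ex_dominated _ _ _ mu X mX X1 g_ g C.
  + by move=> n; have [] := conv_bdd mF FC (cg n).
  + by move=> n; have [] := conv_bdd mF FC (cg n).
  + exact: gg.
  rewrite (_ : _ \o _ = fun=> Ex F); last by apply/funext => n /=; rewrite IH.
  by move=> h; apply/esym; apply: cvg_unique h; [exact: Rhausdorff|exact: cvg_cst].
Qed.

(** Translation preserves the second moment, mixing does not raise it because the square is convex,
    and dominated convergence carries the bound to limits. Hence the cube average of a
    near-minimiser is again a near-minimiser. *)
Lemma conv_sq lim F g : bm F -> conv lim F g ->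
  Ex (fun w => g w * g w) <= Ex (fun w => F w * F w).
Proof.
move=> bF; elim => {g} [//|x g cg IH|t g h /andP[t0 t1] cg IHg ch IHh|g_ g _ cg IH gg].
- have bg := conv_bm bF cg.
  by rewrite (@Ex_act x (fun w => g w * g w))//; exact: bmM.
- have bg := conv_bm bF cg; have bh := conv_bm bF ch.
  have bgg := bmM bg bg; have bhh := bmM bh bh.
  have bm1 : bm (fun w => t * g w + (1 - t) * h w) by apply: bmD; exact: bmZ.
  apply: (@le_trans _ _ (Ex (fun w => t * (g w * g w) + (1 - t) * (h w * h w)))).
    apply: le_Ex => //; [exact: bmM|by apply: bmD; exact: bmZ|].
    move=> w _; rewrite -subr_ge0.
    have -> : t * (g w * g w) + (1 - t) * (h w * h w) -
      (t * g w + (1 - t) * h w) * (t * g w + (1 - t) * h w) =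
      t * (1 - t) * ((g w - h w) * (g w - h w)) by ring.
    by apply: mulr_ge0; [rewrite mulr_ge0 ?subr_ge0|rewrite -expr2 sqr_ge0].
  rewrite ExD ?ExZ//; [|exact: bmZ|exact: bmZ].
  have t10 : 0 <= 1 - t by rewrite subr_ge0.
  have := ler_wpM2l t0 IHg; have := ler_wpM2l t10 IHh; lra.
- have [mF [C FC]] := bF.
  have [|||_ _ + _] := @Ex_dominated _ _ _ mu X mX X1
      (fun n w => g_ n w * g_ n w) (fun w => g w * g w) (C * C).
  + by move=> n; have [mg _] := conv_bdd mF FC (cg n); exact: measurable_funM.
  + move=> n w wX; have [_ gC] := conv_bdd mF FC (cg n).
    by rewrite normrM ler_pM// gC.
  + by move=> w wX; apply: cvgM; exact: gg.
  by apply: cvg_le_cst => n /=.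
Qed.

(** L1 density of the finite combinations: each limit in the construction of [g] is replaced by one
    term of its sequence, which is L1-close by dominated convergence. *)
Lemma conv_approx F g (e : R) : bm F -> conv true F g -> 0 < e ->
  exists2 g', conv false F g' & Ex (fun w => `|g w - g' w|) <= e.
Proof.
move=> bF cg; elim: cg e => {g} [|x g cg IH|t g h t01 cg IHg ch IHh|g_ g _ cg IH gg] e e0.
- exists F; first exact: conv_refl.
  rewrite (_ : (fun w => _) = fun=> 0) ?Ex_cst ?ltW//.
  by apply/funext => w; rewrite subrr normr0.
- have [g' cg' gg'] := IH e e0; exists (fun w => g' (act x w)); first exact: conv_act.
  rewrite (@Ex_act x (fun w => `|g w - g' w|))//.
  by apply/bm_norm/bmB; [exact: conv_bm cg|exact: conv_bm cg'].
- have [g' cg' gg'] := IHg e e0; have [h' ch' hh'] := IHh e e0.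
  exists (fun w => t * g' w + (1 - t) * h' w); first exact: conv_mix.
  have [bg bg' bh bh'] : [/\ bm g, bm g', bm h & bm h'].
    by split; [exact: conv_bm cg|exact: conv_bm cg'|exact: conv_bm ch|exact: conv_bm ch'].
  have bng : bm (fun w => `|g w - g' w|) by exact/bm_norm/bmB.
  have bnh : bm (fun w => `|h w - h' w|) by exact/bm_norm/bmB.
  apply: (@le_trans _ _ (Ex (fun w => t * `|g w - g' w| + (1 - t) * `|h w - h' w|))).
    apply: le_Ex => //.
    + by apply/bm_norm/bmB; apply: bmD; exact: bmZ.
    + by apply: bmD; exact: bmZ.
    + move=> w _; move: t01 => /andP[t0 t1].
      have -> : t * g w + (1 - t) * h w - (t * g' w + (1 - t) * h' w) =
         t * (g w - g' w) + (1 - t) * (h w - h' w) by ring.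
      apply: le_trans (ler_normD _ _) _.
      by rewrite !normrM (ger0_norm t0) (@ger0_norm _ (1 - t)) ?subr_ge0.
  move: t01 => /andP[t0 t1]; rewrite ExD ?ExZ//; [|exact: bmZ|exact: bmZ].
  have t10 : 0 <= 1 - t by rewrite subr_ge0.
  have := ler_wpM2l t0 gg'; have := ler_wpM2l t10 hh'; lra.
- have [mF [C FC]] := bF.
  have [|||_ _ _ /cvgrPdist_le] := @Ex_dominated _ _ _ mu X mX X1 g_ g C.
  + by move=> n; have [] := conv_bdd mF FC (cg n).
  + by move=> n; have [] := conv_bdd mF FC (cg n).
  + exact: gg.
  have e2 : 0 < e / 2 by rewrite divr_gt0.
  move=> /(_ _ e2) [N _ /(_ N (leqnn N))] /=.
  rewrite sub0r normrN => HN.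
  have [g' cg' gg'] := IH N _ e2.
  exists g' => //.
  have bg : bm g by exact: conv_bm bF (@conv_lim true _ _ _ isT cg gg).
  have bg_ : bm (g_ N) by exact: conv_bm (cg N).
  have bg' := conv_bm bF cg'.
  have b1 : bm (fun w => `|g_ N w - g w|) by exact/bm_norm/bmB.
  have b2 : bm (fun w => `|g_ N w - g' w|) by exact/bm_norm/bmB.
  apply: (@le_trans _ _ (Ex (fun w => `|g_ N w - g w| + `|g_ N w - g' w|))).
    apply: le_Ex => //; [exact/bm_norm/bmB|exact: bmD|].
    move=> w _; have -> : g w - g' w = - (g_ N w - g w) + (g_ N w - g' w) by ring.
    by apply: le_trans (ler_normD _ _) _; rewrite normrN.
  rewrite ExD//; have := le_trans (ler_norm _) HN; lra.
Qed.

Lemma conv_avg lim F (g : nat -> T -> R) N : (forall i, conv lim F (g i)) ->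
  conv lim F (fun w => N.+1%:R^-1 * \sum_(i < N.+1) g i w).
Proof.
move=> cg; elim: N => [|N IH].
  rewrite (_ : (fun w => _) = g 0%N)//.
  by apply/funext => w; rewrite big_ord1 invr1 mul1r.
have n0 : N.+2%:R != 0 :> R by rewrite pnatr_eq0.
have n1 : N.+1%:R != 0 :> R by rewrite pnatr_eq0.
rewrite (_ : (fun w => _) = fun w => N.+2%:R^-1 * g N.+1 w +
  (1 - N.+2%:R^-1) * (N.+1%:R^-1 * \sum_(i < N.+1) g i w)).
  apply: conv_mix => //; rewrite invr_ge0 ler0n invf_le1 ?ltr0n//.
  by rewrite ler1n.
apply/funext => w; rewrite big_ord_recr/=.
have E : N.+2%:R = N.+1%:R + 1 :> R by rewrite natr1.
rewrite E in n0 *; field.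
by rewrite nat1r n1 natr1 pnatr_eq0.
Qed.

(** * Cube averages along orbits *)

Definition orb f w : (nat -> R) -> R := fun y => f (act (\row_i y i) w).
(** Continuity along orbits is what makes cube averages limits of Riemann sums; it is required at
    every point of [X], so that no exceptional set appears. *)
Definition goodf f := bm f /\ forall w, X w -> luc (fun y => f (act y w)).
Definition cavg (M : R) f w := cube d M (orb f w).

Lemma orb_lucn f w : goodf f -> X w -> lucn d (orb f w).
Proof. by move=> [_ lf] /lf lw; exact: (luc_row lw). Qed.

(** Averaging in one variable is a limit of Riemann means, so each level of [ibox] stays in the
    class by [conv_avg] and [conv_lim]; at the bottom stands a single translate of [f]. *)
Lemma conv_cavg f (M : R) : 0 < M -> goodf f -> conv true f (cavg M f).
Proof.
move=> M0 gf; rewrite /cavg /cube.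
have ab (j : nat) : - (M / 2) < M / 2 by exact: half_lt.
suff H k x : conv true f
    (fun w => ibox (fun=> - (M / 2)) (fun=> M / 2) k (orb f w) x) by exact: H.
elim: k x => [|k IH] x /=.
  by apply: conv_act; exact: conv_refl.
pose t N i := - (M / 2) + (M / 2 - - (M / 2)) * (i%:R / N.+1%:R).
apply: (@conv_lim _ _ (fun N w => N.+1%:R^-1 * \sum_(i < N.+1)
   ibox (fun=> - (M / 2)) (fun=> M / 2) k (orb f w) (upd x k (t N i)))) => //.
  move=> N; apply: (@conv_avg true f (fun i w => ibox (fun=> - (M / 2))
    (fun=> M / 2) k (orb f w) (upd x k (t N i))) N) => i; exact: IH.
move=> w wX; apply: riemann_cvg; last exact: (ab 0%N).
by apply: luc1_ibox => //; exact: orb_lucn.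
Qed.

Definition ext_row (x : 'rV[R]_d) : nat -> R := fun j => oapp (x 0) 0 (insub j).

Lemma ext_rowE x (y : nat -> R) : \row_(i < d) (y i + ext_row x i) = \row_i y i + x.
Proof. by apply/rowP => i; rewrite !mxE /ext_row valK. Qed.

Lemma cavg_shift_le f C (M : R) x w : 0 < M -> goodf f -> bdd f C -> X w ->
  `|cube d M (orb f (act x w)) - cavg M f w| <= 8 * C * d%:R * `|x| / M.
Proof.
move=> M0 gf fC wX.
have -> : orb f (act x w) = (fun y => orb f w (fun j => y j + ext_row x j)).
  by apply/funext => y; rewrite /orb actD ext_rowE.
apply: cube_shift_le => //.
- exact: orb_lucn.
- by move=> y; apply: fC; exact: Xact.
- by move=> j; rewrite /ext_row; case: insub => [i|]/=; rewrite ?normr0// rV_coord_le.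
Qed.

(** Stated for finite combinations: a pointwise limit may lose the continuity along orbits. *)
Lemma conv_good F g : goodf F -> conv false F g -> goodf g.
Proof.
move=> [bF lF] cg; split; first exact: conv_bm cg.
elim: cg => {g} [//|x g _ IH|t g h _ _ IHg _ IHh|//] w wX.
- have := luc_shift x (IH w wX); congr luc; apply/funext => y.
  by rewrite actD addrC.
- by apply: lucD; apply: lucZ; [exact: IHg|exact: IHh].
Qed.

(** Averages over a large cube are linear and change by O(1/M) under a fixed translation, so those
    of a finite combination track those of [F]. The threshold is uniform in [w], since the
    translation error involves only a bound of the function. *)
Lemma conv_close F g (e : R) : goodf F -> conv false F g -> 0 < e ->
  exists2 M0 : R, 0 < M0 & forall M w, M0 <= M -> X w ->
    `|cavg M g w - cavg M F w| <= e.
Proof.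
move=> gF cg; elim: cg e => {g} [|x g cg IH|t g h t01 cg IHg ch IHh|//] e e0.
- by exists 1 => // M w _ _; rewrite subrr normr0 ltW.
- have gg := conv_good gF cg; have [[mg [C gC]] _] := gg.
  have e2 : 0 < e / 2 by rewrite divr_gt0.
  have [M0 M00 H] := IH _ e2.
  pose K := `|8 * C * d%:R * `|x| |.
  (* The second summand makes the translation error [K / M] at most [e / 2]. *)
  exists (M0 + K / (e / 2)).
    by rewrite ltr_wpDr// divr_ge0 ?normr_ge0// ltW.
  move=> M w MM wX.
  have K0 : 0 <= K / (e / 2) by rewrite divr_ge0 ?normr_ge0// ltW.
  have M1 : M0 <= M by apply: le_trans MM; rewrite lerDl.
  have M2 : 0 < M by apply: lt_le_trans M1.
  have := H M w M1 wX; have := @cavg_shift_le g C M x w M2 gg gC wX.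
  have -> : cube d M (orb g (act x w)) = cavg M (fun w => g (act x w)) w.
    by congr cube; apply/funext => y; rewrite /orb !actD addrC.
  have KM : 8 * C * d%:R * `|x| / M <= e / 2.
    rewrite ler_pdivrMr// (le_trans (ler_norm _))// -/K -ler_pdivrMl//.
    rewrite mulrC; apply: le_trans MM; rewrite lerDr; exact: ltW.
  rewrite !ler_norml; lra.
- have gg := conv_good gF cg; have gh := conv_good gF ch.
  have [M1 M10 H1] := IHg _ e0; have [M2 M20 H2] := IHh _ e0.
  exists (M1 + M2); first by rewrite addr_gt0.
  move=> M w MM wX; have MM1 : M1 <= M by lra.
  have MM2 : M2 <= M by lra.
  have M0 : 0 < M by lra.
  have -> : cavg M (fun w => t * g w + (1 - t) * h w) w =
     t * cavg M g w + (1 - t) * cavg M h w.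
    have lg := orb_lucn gg wX; have lh := orb_lucn gh wX.
    by rewrite /cavg -!cubeZ// -cubeD//; exact: lucnZ.
  have := H1 M w MM1 wX; have := H2 M w MM2 wX; rewrite !ler_norml.
  move: t01 => /andP[t0 t1] /andP[h1 h2] /andP[g1 g2].
  by apply/andP; split; nra.
Qed.

(** * Convergence of a minimising sequence and the ergodic theorem *)

Local Notation hpow n := ((2%:R^-1 : R) ^+ n).

Lemma sum_hpow k N : \sum_(i < N) hpow (k + i) = 2 * (hpow k - hpow (k + N)).
Proof.
elim: N => [|N IH]; first by rewrite big_ord0 addn0 subrr mulr0.
rewrite big_ord_recr/= IH addnS exprS; lra.
Qed.

Lemma hpow_gt0 n : 0 < hpow n.
Proof. by rewrite exprn_gt0// invr_gt0. Qed.

Lemma hpow_small (e : R) : 0 < e -> exists k, forall n, (k <= n)%N -> hpow n <= e.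
Proof.
move=> e0; have : hpow n @[n --> \oo] --> (0 : R).
  by apply: cvg_expr; rewrite gtr0_norm ?invr_gt0// invf_lt1// ltr1n.
move=> /cvgrPdist_le /(_ e e0) [k _ H]; exists k => n kn.
by have := H n kn; rewrite /= sub0r normrN gtr0_norm ?hpow_gt0.
Qed.

(** The majorant is the limit of truncated partial sums of [|h (k + i) - h (k + i).+1|], which
    dominates every later deviation from [h k]; the geometric series starting at [k] gives the
    factor 2. *)
Lemma tail_bound (h : nat -> T -> R) (C K : R) (k : nat) :
  (forall n, measurable_fun X (h n)) -> (forall n, bdd (h n) C) ->
  (forall n, Ex (fun w => `|h n w - h n.+1 w|) <= K * hpow n) ->
  exists f, [/\ bm f, forall n w, (k <= n)%N -> X w -> `|h n w - h k w| <= f w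
    & Ex f <= 2 * K * hpow k].
Proof.
move=> mh hC hK.
have bh n : bm (h n) by split=> //; exists C.
pose z i w := `|h (k + i)%N w - h (k + i).+1 w|.
have bz i : bm (z i) by exact/bm_norm/bmB.
pose D N w := \sum_(i < N) z i w.
have bD N : bm (D N) by exact: bm_sum.
have D0 N w : 0 <= D N w by rewrite sumr_ge0// => i _; exact: normr_ge0.
have K0 : 0 <= K.
  have := le_trans _ (hK 0%N); rewrite expr0 mulr1; apply.
  by rewrite -(@Ex_cst _ _ _ mu X mX X1 0); apply: le_Ex => //; [exact: bm_cst|exact/bm_norm/bmB].
have [w0 Xw0] : exists w, X w.
  apply/not_existsP => X0; have : X = set0 by apply/seteqP; split=> // w /X0.
  by move=> XE; move: X1; rewrite XE measure0 => /eqP; rewrite eqe eq_sym oner_eq0.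
have C0 : 0 <= C by exact: le_trans (hC 0%N _ Xw0).
(* Truncation at [2 * C], which bounds every [|h n - h k|], keeps the majorant finite and bounded
   even where the series diverges. *)
pose fN N w := Num.min (D N w) (2 * C).
have bfN N : bdd (fN N) (2 * C).
  move=> w _; rewrite ger0_norm ?ge_min ?lexx ?orbT// le_min D0/= mulr_ge0//.
have mfN N : measurable_fun X (fN N).
  by apply: measurable_minr => //; have [] := bD N.
have nd w : nondecreasing_seq (fN ^~ w).
  apply/nondecreasing_seqP => N; rewrite /fN le_min !ge_min lexx orbT andbT.
  by rewrite /D big_ord_recr/= lerDl /z normr_ge0.
have cv w : X w -> fN ^~ w @ \oo --> limn (fN ^~ w).
  move=> Xw; apply: nondecreasing_is_cvgn; first exact: nd.
  exists (2 * C) => _ [N _ <-]; exact: le_trans (ler_norm _) (bfN N w Xw).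
pose f w := limn (fN ^~ w).
have [mf fC Ef _] := @Ex_dominated _ _ _ mu X mX X1 fN f (2 * C) mfN bfN cv.
exists f; split; first by split=> //; exists (2 * C).
- move=> n w kn Xw; apply: (@le_trans _ _ (fN (n - k)%N w)); last first.
    by apply: nondecreasing_cvgn_le; [exact: nd|apply: cvgP (cv w Xw)].
  rewrite /fN le_min; apply/andP; split; last first.
    have := hC n w Xw; have := hC k w Xw; rewrite !ler_norml; lra.
  rewrite -{1}(subnKC kn); elim: (n - k)%N => [|N IH].
    by rewrite addn0 subrr normr0.
  rewrite /D big_ord_recr/=; apply: le_trans (lerD IH (lexx _)).
  rewrite addnS /z; have -> : h (k + N).+1 w - h k w = (h (k + N)%N w - h k w) -
    (h (k + N)%N w - h (k + N).+1 w) by ring.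
  exact: ler_normB.
- apply: cvg_le_cst Ef => N /=.
  have bf : bm (fN N) by split=> //; exists (2 * C).
  apply: (@le_trans _ _ (Ex (D N))).
    by apply: le_Ex => // w _; rewrite ge_min lexx.
  rewrite Ex_sum//; apply: (@le_trans _ _ (\sum_(i < N) K * hpow (k + i))).
    by apply: ler_sum => i _; exact: hK.
  rewrite -mulr_sumr sum_hpow; have := hpow_gt0 (k + N); nra.
Qed.

(* [limsup (s * (h n - c)) > q], written with countable operations so that both
   measurability and strict invariance are immediate. *)
Definition exceed (h : nat -> T -> R) (c s q : R) : set T :=
  \bigcup_j \bigcap_N \bigcup_(n in [set n | (N <= n)%N])
    (X `&` (fun w => s * (h n w - c)) @^-1` `]q + j.+1%:R^-1, +oo[).

Lemma exceed_measurable h c s q : (forall n, measurable_fun X (h n)) ->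
  measurable (exceed h c s q).
Proof.
move=> mh; apply: bigcup_measurable => j _; apply: bigcapT_measurable => N.
apply: bigcup_measurable => n _.
have mg : measurable_fun X (fun w => s * (h n w - c)).
  by apply: measurable_funM => //; exact: measurable_funB.
by apply: mg => //; exact: measurable_itv.
Qed.

(** The margin above [q] is allowed to drop from [1/(j+1)] to [1/(j+2)]: a translation moves [h n]
    by at most [K/(n+1)], which is eventually below the difference [e] of the two margins. *)
Lemma exceed_act h c (s q K : R) x w : `|s| = 1 ->
  (forall n, `|h n (act x w) - h n w| <= K / n.+1%:R) ->
  exceed h c s q w -> exceed h c s q (act x w).
Proof.
move=> s1 hK [j _ H]; exists j.+1 => // N _.
pose e : R := j.+1%:R^-1 - j.+2%:R^-1.
have e0 : 0 < e by rewrite subr_gt0 ltf_pV2 ?posrE ?ltr0n// ltr_nat.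
have [m /= _ Hm] := @nbhs_infty_ger R (`|K| / e).
have [n /= nN [Xw]] := H (maxn N m) I; rewrite in_itv/= andbT => Hn.
exists n; first by rewrite /= (leq_trans _ nN)// leq_maxl.
split; first exact: Xact.
rewrite /= in_itv/= andbT.
have Kn : K / n.+1%:R <= e.
  rewrite ler_pdivrMr// (le_trans (ler_norm _))// -ler_pdivrMl// mulrC.
  apply: (@le_trans _ _ n%:R); last by rewrite ler_nat.
  by apply: Hm; rewrite /= (leq_trans _ nN)// leq_maxr.
have : `|s * (h n (act x w) - h n w)| <= e.
  by rewrite normrM s1 mul1r (le_trans (hK n)).
move: Hn; rewrite ler_norml /e.
by move: (j.+1%:R^-1) (j.+2%:R^-1) => u v; lra.
Qed.

Lemma exceed_invariant h c (s q : R) : `|s| = 1 ->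
  (forall x, exists K : R, forall n w, X w -> `|h n (act x w) - h n w| <= K / n.+1%:R) ->
  forall x, act x @^-1` exceed h c s q = exceed h c s q.
Proof.
move=> s1 hK x; apply/seteqP; split=> w /= Pw.
  have Xw : X w.
    have [j _ /(_ 0%N I) [n _ [Xw _]]] := Pw.
    by rewrite -(Xact_pre x).
  have -> : w = act (- x) (act x w) by rewrite actD addNr act0.
  have [K HK] := hK (- x); apply: (exceed_act s1 (K := K)) => // n.
  by apply: HK; exact: Xact.
have Xw : X w by have [j _ /(_ 0%N I) [n _ [Xw _]]] := Pw.
have [K HK] := hK x; apply: (exceed_act s1 (K := K)) => // n.
exact: HK.
Qed.

(** By ergodicity the set has measure 0 or 1. If it were 1, almost every point would have some
    [n >= k] with [s * (h n - c) > q], hence [s * (h k - c) >= q - f]; taking expectations gives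
    [0 >= q - Ex f], which is absurd for large [k]. *)
Lemma exceed_null h c (s q K : R) : `|s| = 1 -> 0 < q ->
  (forall n, bm (h n)) -> (forall n, Ex (h n) = c) ->
  (forall x, exists K : R, forall n w, X w -> `|h n (act x w) - h n w| <= K / n.+1%:R) ->
  (forall k, exists f, [/\ bm f,
    forall n w, (k <= n)%N -> X w -> `|h n w - h k w| <= f w & Ex f <= K * hpow k]) ->
  mu (exceed h c s q) = 0%E.
Proof.
move=> s1 q0 bh hc hK hf.
have mP : measurable (exceed h c s q).
  by apply: exceed_measurable => n; have [] := bh n.
case: (mu_erg mP) => //.
- by move=> w [j _ /(_ 0%N I) [n _ [Xw _]]].
- exact: exceed_invariant.
move=> P1; exfalso.
(* The denominator is positive whatever the sign of [K], and makes [K * hpow k] at most [q / 2]. *)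
have e0 : 0 < q / 2 / (`|K| + 1) by rewrite !divr_gt0// ltr_wpDl.
have [k Hk] := hpow_small e0; have [f [bf fh fK]] := hf k.
have mN : measurable (~` exceed h c s q) by exact: measurableC.
have N0 : mu (~` exceed h c s q) = 0%E.
  by rewrite probability_setC// P1 -EFinB subrr.
have bs : bm (fun w => s * (h k w - c)) by apply: bmZ; apply: bmB => //; exact: bm_cst.
have bqf : bm (fun w => q - f w) by apply: bmB => //; exact: bm_cst.
have : Ex (fun w => q - f w) <= Ex (fun w => s * (h k w - c)).
  apply: (le_Ex_ae mN N0) => // w Xw /contrapT [j _ /(_ k I) [n /= kn [_]]].
  rewrite /= in_itv/= andbT => qn.
  have j0 : 0 < j.+1%:R^-1 :> R by rewrite invr_gt0.
  have : `|s * (h n w - h k w)| <= f w by rewrite normrM s1 mul1r fh.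
  by move: qn j0; rewrite ler_norml; move: (j.+1%:R^-1) => u; lra.
have bc : bm (fun=> c) by exact: bm_cst.
have bq : bm (fun=> q) by exact: bm_cst.
rewrite ExB// ExZ//; last exact: bmB.
rewrite ExB// hc !Ex_cst// subrr mulr0.
have := Hk k (leqnn k); rewrite ler_pdivlMr ?ltr_wpDl// => Hk'.
have := ler_wpM2r (ltW (hpow_gt0 k)) (ler_norm K); have := hpow_gt0 k.
lra.
Qed.

(** From [(g - h)^2 = 2 g^2 + 2 h^2 - 4 ((g + h) / 2)^2]: near-minimisers of the second moment are
    L2-close, because their midpoint cannot go below [m]. The midpoint is spelled with [1 - 2^-1] to
    match [conv_mix]. *)
Lemma parallelogram_Ex g h (m a b : R) : bm g -> bm h ->
  m <= Ex (fun w => (2^-1 * g w + (1 - 2^-1) * h w) * (2^-1 * g w + (1 - 2^-1) * h w)) ->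
  Ex (fun w => g w * g w) <= m + a -> Ex (fun w => h w * h w) <= m + b ->
  Ex (fun w => (g w - h w) * (g w - h w)) <= 2 * a + 2 * b.
Proof.
move=> bg bh; pose k w := 2^-1 * g w + (1 - 2^-1) * h w => mk ga hb.
have {}mk : m <= Ex (fun w => k w * k w) by exact: mk.
have bgg : bm (fun w => 2 * (g w * g w)) by apply: bmZ; exact: bmM.
have bhh : bm (fun w => 2 * (h w * h w)) by apply: bmZ; exact: bmM.
have bk : bm k by apply: bmD; exact: bmZ.
have bkk : bm (fun w => 4 * (k w * k w)) by apply: bmZ; exact: bmM.
have -> : Ex (fun w => (g w - h w) * (g w - h w)) =
   Ex (fun w => 2 * (g w * g w) + 2 * (h w * h w) - 4 * (k w * k w)).
  by congr Ex; apply/funext => w; rewrite /k; field.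
rewrite ExB ?ExD ?ExZ//; try exact: bmM; try exact: bmD.
lra.
Qed.

Lemma mean_ergodic F (e : R) : goodf F -> 0 < e ->
  exists2 g, conv false F g & Ex (fun w => `|g w - Ex F|) <= e.
Proof.
move=> gF e0; have [bF lF] := gF; have [mF [C FC]] := bF.
set c := Ex F.
pose S := [set r | exists2 g, conv false F g & r = Ex (fun w => g w * g w)].
have Slb : lbound S 0.
  move=> _ [g cg ->]; rewrite -(@Ex_cst _ _ _ mu X mX X1 0).
  have bg := conv_bm bF cg.
  by apply: le_Ex => //; [exact: bm_cst|exact: bmM|move=> w _; rewrite -expr2 sqr_ge0].
have hS : has_inf S.
  split; last by exists 0.
  by exists (Ex (fun w => F w * F w)); exists F => //; exact: conv_refl.
pose m := inf S.
have [w0 Xw0] : exists w, X w.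
  apply/not_existsP => X0; have : X = set0 by apply/seteqP; split=> // w /X0.
  by move=> XE; move: X1; rewrite XE measure0 => /eqP; rewrite eqe eq_sym oner_eq0.
have C0 : 0 <= C by exact: le_trans (FC _ Xw0).
(* The infimum over finite combinations also bounds their limits: [h] is approximated in L1 by a
   finite combination [g], and [|g^2 - h^2| <= 2 C |g - h|]. *)
have mle h : conv true F h -> m <= Ex (fun w => h w * h w).
  move=> ch; have bh := conv_bm bF ch; apply/ler_addgt0Pr => z z0.
  have z1 : 0 < z / (2 * C + 1) by rewrite divr_gt0//; lra.
  have [g cg gh] := conv_approx bF ch z1.
  have bg := conv_bm bF cg.
  have mg : m <= Ex (fun w => g w * g w).
    by apply: ge_inf; [exists 0|exists g].
  apply: (le_trans mg).
  have bhg : bm (fun w => `|h w - g w|) by exact/bm_norm/bmB.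
  apply: (@le_trans _ _ (Ex (fun w => h w * h w + (2 * C) * `|h w - g w|))).
    apply: le_Ex => //; [exact: bmM|by apply: bmD; [exact: bmM|exact: bmZ]|].
    move=> w Xw; have [_ gC] := conv_bdd mF FC cg; have [_ hC] := conv_bdd mF FC ch.
    have : (g w - h w) * (g w + h w) <= `|h w - g w| * (2 * C).
      apply: le_trans (ler_norm _) _; rewrite normrM distrC ler_wpM2l//.
      by rewrite (le_trans (ler_normD _ _))// mulr2n mulrDl mul1r lerD ?gC ?hC.
    lra.
  rewrite ExD ?ExZ//; [|exact: bmM|exact: bmZ].
  rewrite lerD2l; have := ler_wpM2l (mulr_ge0 (ler0n R 2) C0) gh.
  have : 2 * C * (z / (2 * C + 1)) <= z.
    by rewrite mulrA ler_pdivrMr; [nra|lra].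
  lra.
(* The excess over the infimum is the square of [hpow n], so that L1 distances come out of order
   [hpow n]. *)
have /choice[g Hg] : forall n, exists g, conv false F g /\
    Ex (fun w => g w * g w) < m + hpow n * hpow n.
  move=> n; have p0 : 0 < hpow n * hpow n by rewrite mulr_gt0 ?hpow_gt0.
  by have [_ [g cg ->] H] := inf_adherent p0 hS; exists g.
(* Averaging over the cube of side [n.+1] does not raise the second moment and makes [h n] change by
   O(1/(n+1)) under a fixed translation, which yields the strict invariance of the level sets. *)
pose h n := cavg n.+1%:R (g n).
have gg n : goodf (g n) by have [cg _] := Hg n; exact: conv_good cg.
have cgh n : conv true (g n) (h n) by apply: conv_cavg => //; rewrite ltr0n.
have ch n : conv true F (h n).
  by have [/conv_weak cg _] := Hg n; exact: conv_trans (cgh n).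
have bh n : bm (h n) by exact: conv_bm (ch n).
have hC n : bdd (h n) C by have [] := conv_bdd mF FC (ch n).
have hsq n : Ex (fun w => h n w * h n w) <= m + hpow n * hpow n.
  by have [_ /ltW] := Hg n; apply: le_trans; apply: conv_sq (cgh n); have [] := gg n.
have hsq' n : Ex (fun w => h n.+1 w * h n.+1 w) <= m + hpow n * hpow n.
  apply: le_trans (hsq n.+1) _; rewrite lerD2l exprS.
  have := mulr_gt0 (hpow_gt0 n) (hpow_gt0 n); lra.
(* With [p = hpow n] and [z] the difference, [|z| <= p + z^2 / p] and [Ex z^2 <= 4 p^2] give the
   5. *)
have hK n : Ex (fun w => `|h n w - h n.+1 w|) <= 5 * hpow n.
  have bd : bm (fun w => h n w - h n.+1 w) by exact: bmB.
  have H : Ex (fun w => (h n w - h n.+1 w) * (h n w - h n.+1 w)) <=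
      2 * (hpow n * hpow n) + 2 * (hpow n * hpow n).
    apply: (parallelogram_Ex (m := m)) => //; apply: mle.
    by apply: conv_mix => //; rewrite invr_ge0 ler0n invf_le1// ler1n.
  have p0 := hpow_gt0 n.
  have bdd2 : bm (fun w => (hpow n)^-1 * ((h n w - h n.+1 w) * (h n w - h n.+1 w))).
    by apply: bmZ; exact: bmM.
  have bp : bm (fun=> hpow n) by exact: bm_cst.
  apply: (@le_trans _ _ (Ex (fun w => hpow n +
      (hpow n)^-1 * ((h n w - h n.+1 w) * (h n w - h n.+1 w))))).
    apply: le_Ex => //; [exact: bm_norm|exact: bmD|].
    move=> w _; set z := h n w - h n.+1 w.
    rewrite -(ler_pM2l p0) mulrDr mulrA mulfV ?gt_eqF// mul1r.
    have -> : z * z = `|z| * `|z| by rewrite -normrM ger0_norm// -expr2 sqr_ge0.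
    have := normr_ge0 z; nra.
  rewrite ExD// ExZ ?Ex_cst//; last exact: bmM.
  have pi0 : 0 <= (hpow n)^-1 by rewrite invr_ge0 ltW.
  have := ler_wpM2l pi0 H.
  have -> : (hpow n)^-1 * (2 * (hpow n * hpow n) + 2 * (hpow n * hpow n)) = 4 * hpow n.
    by field; rewrite gt_eqF.
  lra.
have mh n : measurable_fun X (h n) by have [] := bh n.
have hf k := tail_bound k mh hC hK.
have hc n : Ex (h n) = c by apply: conv_Ex (ch n).
have hinv x : exists K : R, forall n w, X w ->
    `|h n (act x w) - h n w| <= K / n.+1%:R.
  exists (8 * C * d%:R * `|x|) => n w Xw; apply: cavg_shift_le => //.
  by have [cg _] := Hg n; have [] := conv_bdd mF FC cg.
(* Level [e / 8] plus a margin [1/(j+1) <= e / 8] leave [|h n - c| <= e / 4] for all large [n], off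
   a null set. *)
have q0 : 0 < e / 8 by rewrite divr_gt0.
have s1 : `|1| = 1 :> R by rewrite normr1.
have s2 : `|-1| = 1 :> R by rewrite normrN1.
have P1 := exceed_null s1 q0 bh hc hinv hf.
have P2 := exceed_null s2 q0 bh hc hinv hf.
(* Since [Ex f <= 10 * hpow k], this choice makes the deviation of [h k] from later terms at most
   [e / 4] in mean. *)
have k0 : 0 < e / 40 by rewrite divr_gt0.
have [k /(_ k (leqnn k)) Hk] := hpow_small k0.
have [f [bf fh fK]] := hf k.
have bc : bm (fun=> c) by exact: bm_cst.
have bkc : bm (fun w => `|h k w - c|) by exact/bm_norm/bmB.
have be4 : bm (fun=> e / 4) by exact: bm_cst.
have Hkc : Ex (fun w => `|h k w - c|) <= e / 2.
  apply: (@le_trans _ _ (Ex (fun w => e / 4 + f w))); last first.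
    rewrite ExD// Ex_cst//; have := hpow_gt0 k; lra.
  pose N := exceed h c 1 (e / 8) `|` exceed h c (-1) (e / 8).
  have mN : measurable N by apply: measurableU; exact: exceed_measurable.
  have N0 : mu N = 0%E.
    by apply: null_set_setU => //; exact: exceed_measurable.
  apply: (le_Ex_ae mN N0) => //; first exact: bmD.
  move=> w Xw /not_orP[n1 n2].
  have [j _ /(_ j (leqnn j)) Hj] := @nbhs_infty_ger R (8 / e).
  have jj : j.+1%:R^-1 <= e / 8.
    rewrite -[e / 8]invrK invf_div lef_pV2 ?posrE ?divr_gt0//.
    by rewrite (le_trans Hj)// ler_nat.
  have get (s : R) : ~ exceed h c s (e / 8) w -> exists N, forall n, (N <= n)%N ->
      s * (h n w - c) <= e / 4.
    move=> nP; apply: contrapT => /forallNP Q; apply: nP; exists j => // M _.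
    have /existsNP[n /not_implyP[Mn /negP]] := Q M; rewrite -ltNge => hn.
    exists n => //; split=> //; rewrite /= in_itv/= andbT.
    by move: jj hn; move: (j.+1%:R^-1) => u; lra.
  have [N1 H1] := get _ n1; have [N2 H2] := get _ n2.
  pose n := maxn k (maxn N1 N2).
  have := fh n w (leq_maxl _ _) Xw.
  have nN1 : (N1 <= n)%N by rewrite leq_max leq_maxl orbT.
  have nN2 : (N2 <= n)%N by rewrite leq_max leq_maxr orbT.
  have := H1 n nN1; have := H2 n nN2.
  rewrite !ler_norml; lra.
have e2 : 0 < e / 2 by rewrite divr_gt0.
(* [h k] is only known to lie in the large class; a finite combination close to it is returned. *)
have [g' cg' Hg'] := conv_approx bF (ch k) e2.
exists g' => //; have bg' := conv_bm bF cg'.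
have b1 : bm (fun w => `|h k w - g' w|) by exact/bm_norm/bmB.
apply: (@le_trans _ _ (Ex (fun w => `|h k w - g' w| + `|h k w - c|))).
  apply: le_Ex => //; [exact/bm_norm/bmB|exact: bmD|].
  move=> w _; have -> : g' w - c = - (h k w - g' w) + (h k w - c) by ring.
  by apply: le_trans (ler_normD _ _) _; rewrite normrN.
rewrite ExD//; lra.
Qed.

Lemma goodf_cst c : goodf (fun=> c).
Proof. by split=> [|w _]; [exact: bm_cst|exact: luc_cst]. Qed.

Lemma goodfD f g : goodf f -> goodf g -> goodf (fun w => f w + g w).
Proof.
move=> [bf lf] [bg lg]; split; first exact: bmD.
by move=> w Xw; apply: lucD; [exact: lf|exact: lg].
Qed.

Lemma goodf_norm f : goodf f -> goodf (fun w => `|f w|).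
Proof.
move=> [bf lf]; split; first exact: bm_norm.
by move=> w Xw; apply: luc_norm; exact: lf.
Qed.

Lemma goodf_sum n (f : nat -> T -> R) : (forall k, goodf (f k)) ->
  goodf (fun w => \sum_(k < n) f k w).
Proof.
move=> gf; elim: n => [|n IH].
  by under eq_fun do rewrite big_ord0; exact: goodf_cst.
by under eq_fun do rewrite big_ord_recr/=; exact: goodfD.
Qed.

(** Each observable is replaced by a finite combination [g k] that is L1-close to its mean. The
    absolute deviations are summed before averaging, so that a single small cube average of [G]
    controls all observables at the same [w]; such a [w] exists because the average of [G] has
    expectation at most [e / 4]. [conv_close] then returns from [g k] to [f k]. *)
Lemma generic_point (f : nat -> T -> R) n (e : R) : (forall k, goodf (f k)) -> 0 < e ->
  exists2 M0 : R, 0 < M0 & forall M, M0 <= M -> exists2 w, X w &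
    forall k, (k < n)%N -> `|cavg M (f k) w - Ex (f k)| <= e.
Proof.
(* The [n] deviations add up to at most [e / 4]; dividing by [n.+1] also covers [n = 0]. *)
move=> gf e0; pose eta := e / 4 / n.+1%:R.
have eta0 : 0 < eta by rewrite !divr_gt0// ltr0n.
have e2 : 0 < e / 2 by rewrite divr_gt0.
have /choice[g Hg] : forall k, exists g, conv false (f k) g /\
    Ex (fun w => `|g w - Ex (f k)|) <= eta.
  by move=> k; have [g] := mean_ergodic (gf k) eta0; exists g.
have gg k : goodf (g k) by have [cg _] := Hg k; exact: conv_good cg.
have /choice[M0 HM0] : forall k, exists M0 : R, 0 < M0 /\ forall M w, M0 <= M ->
    X w -> `|cavg M (g k) w - cavg M (f k) w| <= e / 2.
  move=> k; have [cg _] := Hg k.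
  by have [M0] := conv_close (gf k) cg e2; exists M0.
pose M1 := 1 + \sum_(k < n) M0 k.
have S0 : 0 <= \sum_(k < n) M0 k.
  by apply: sumr_ge0 => k _; have [/ltW] := HM0 k.
exists M1; first by rewrite ltr_pwDl.
move=> M MM.
have Mpos : 0 < M by rewrite (lt_le_trans _ MM)// ltr_pwDl.
have Mk k : (k < n)%N -> M0 k <= M.
  move=> kn; apply: le_trans MM; rewrite /M1 (bigD1 (Ordinal kn))//= addrCA.
  by rewrite lerDl addr_ge0// sumr_ge0// => i _; have [/ltW] := HM0 i.
pose G w := \sum_(k < n) `|g k w + -1 * Ex (f k)|.
have gk k : goodf (fun w => `|g k w + -1 * Ex (f k)|).
  by apply: goodf_norm; apply: goodfD => //; exact: goodf_cst.
have gG : goodf G by exact: (goodf_sum n gk).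
have EG : Ex (cavg M G) <= e / 4.
  rewrite (conv_Ex gG.1 (conv_cavg Mpos gG)).
  rewrite (@Ex_sum _ _ _ mu X mX X1 n (fun k w => `|g k w + -1 * Ex (f k)|)); last first.
    by move=> k; have [] := gk k.
  apply: (@le_trans _ _ (\sum_(k < n) eta)).
    apply: ler_sum => k _; have [_] := Hg k; apply: le_trans.
    by rewrite le_eqVlt; apply/orP; left; apply/eqP; congr Ex; apply/funext => w;
       rewrite mulN1r.
  rewrite sumr_const card_ord -[X in X <= _]mulr_natr /eta.
  rewrite mulrAC ler_pdivrMr ?ltr0n// ler_pM2l ?divr_gt0// ler_nat.
  exact: leqnSn.
have bcG : bm (cavg M G) by exact: (conv_bm gG.1 (conv_cavg Mpos gG)).
have [w Xw Gw] : exists2 w, X w & cavg M G w <= e / 2.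
  apply: contrapT => /forall2NP H.
  have : e / 2 <= Ex (cavg M G).
    rewrite -(@Ex_cst _ _ _ mu X mX X1 (e / 2)); apply: le_Ex => //; first exact: bm_cst.
    by move=> w Xw; have [//|/negP] := H w; rewrite -ltNge => /ltW.
  lra.
exists w => // k kn.
have lG := orb_lucn gG Xw; have lgk := orb_lucn (gg k) Xw.
have lc : lucn d (fun=> Ex (f k)) by exact: lucn_cst.
have gG' y : `|orb (g k) w y - Ex (f k)| <= orb G w y.
  rewrite /orb /G (bigD1 (Ordinal kn))//= mulN1r lerDl.
  by apply: sumr_ge0 => i _; exact: normr_ge0.
have u1 : cavg M (g k) w <= cavg M G w + Ex (f k).
  rewrite -[X in _ + X](@cube_cst _ d M _ Mpos) -cubeD//.
  apply: le_cube => //; first exact: lucnD.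
  by move=> y; have := gG' y; rewrite ler_norml; lra.
have u2 : Ex (f k) <= cavg M (g k) w + cavg M G w.
  rewrite -[X in X <= _](@cube_cst _ d M _ Mpos) -cubeD//.
  apply: le_cube => //; first exact: lucnD.
  by move=> y; have := gG' y; rewrite ler_norml; lra.
have [_ HMk] := HM0 k; have := HMk M w (Mk k kn) Xw; rewrite !ler_norml; lra.
Qed.

End MeanErgodicTheorem.

(** * The topology of the space of environments *)

Section MetricSum.
Context {R : realType}.
Implicit Types s : nat -> R.

Let part s N := \sum_(1 <= k < N) (2 ^- k * (s k / (1 + s k))).

Lemma frac_bound (x : R) : 0 <= x -> 0 <= x / (1 + x) <= 1.
Proof.
by move=> x0; rewrite divr_ge0 ?addr_ge0//= ler_pdivrMr ?mul1r ?lerDr ?ltr_pwDl.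
Qed.

Lemma pow2V_gt0 k : 0 < 2 ^- k :> R.
Proof. by rewrite invr_gt0 exprn_gt0. Qed.

Lemma pow2VS k : 2 ^- k.+1 = 2 ^- k / 2 :> R.
Proof. by rewrite exprS invfM mulrC. Qed.

Lemma pow2V_small (e : R) : 0 < e -> exists K, 2 ^- K < e.
Proof.
move=> e0.
have : (2^-1 : R) ^+ n @[n --> \oo] --> (0 : R).
  by apply: cvg_expr; rewrite gtr0_norm ?invr_gt0// invf_lt1// ltr1n.
move=> /cvgrPdist_lt /(_ e e0) [k _ /(_ k (leqnn k))].
rewrite /= sub0r normrN exprVn gtr0_norm ?pow2V_gt0//; by exists k.
Qed.

Lemma part_nondecreasing s : (forall k, 0 <= s k) -> nondecreasing_seq (part s).
Proof.
move=> s0; apply/nondecreasing_seqP => -[|n]; rewrite /part.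
  by rewrite !big_geq.
rewrite [leRHS]big_nat_recr//= lerDl mulr_ge0 ?(ltW (pow2V_gt0 _))//.
by have /andP[] := frac_bound (s0 n.+1).
Qed.

(** Terms up to [K] are at most [2 ^- k * s K] and later ones at most [2 ^- k]; the two geometric
    sums give the bound. *)
Lemma part_le s K N : (forall k, 0 <= s k) -> {homo s : m n / (m <= n)%N >-> m <= n} ->
  part s N.+1 <= (1 - 2 ^- N) * s K + (if (N <= K)%N then 0 else 2 ^- K - 2 ^- N).
Proof.
move=> s0 smono; elim: N => [|N IH].
  by rewrite /part big_geq// expr0 invr1 subrr mul0r add0r.
rewrite /part big_nat_recr//= -/(part s N.+1).
have /andP[t0 t1] := frac_bound (s0 N.+1).
rewrite pow2VS; have p0 := pow2V_gt0 N; have p20 : 0 <= 2 ^- N / 2 :> R by rewrite divr_ge0 ?ltW.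
have t2 : s N.+1 / (1 + s N.+1) <= s N.+1.
  by rewrite ler_pdivrMr ?ltr_pwDl// mulrDr mulr1 lerDl mulr_ge0.
have pK := mulr_ge0 p20 (s0 K).
case: (ltngtP N K) IH => [NK|KN|NK] IH.
- have := ler_wpM2l p20 (le_trans t2 (smono _ _ NK)); lra.
- have := ler_wpM2l p20 t1; lra.
- rewrite NK in IH p20 pK t1 *; have := ler_wpM2l p20 t1; lra.
Qed.

Lemma part_le1 s N : (forall k, 0 <= s k) -> part s N <= 1.
Proof.
move=> s0; case: N => [|N]; first by rewrite /part big_geq.
suff : part s N.+1 <= 1 - 2 ^- N by have := pow2V_gt0 N; lra.
elim: N => [|N IH]; first by rewrite /part big_geq// expr0 invr1 subrr.
rewrite /part big_nat_recr//= -/(part s N.+1).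
have /andP[t0 t1] := frac_bound (s0 N.+1).
have := ler_wpM2l (ltW (pow2V_gt0 N.+1)) t1; rewrite mulr1.
have := pow2VS N; lra.
Qed.

Lemma part_cvg s : (forall k, 0 <= s k) -> cvgn (part s).
Proof.
move=> s0; apply: nondecreasing_is_cvgn; first exact: part_nondecreasing.
by exists 1 => _ [N _ <-]; exact: part_le1.
Qed.

Lemma metric_sum_ge s k : (forall k, 0 <= s k) -> (0 < k)%N ->
  2 ^- k * (s k / (1 + s k)) <= metric_sum R s.
Proof.
move=> s0 k0; apply: (@le_trans _ _ (part s k.+1)).
  rewrite /part big_nat_recr//= lerDr sumr_ge0// => i _.
  by rewrite mulr_ge0 ?(ltW (pow2V_gt0 _))//; have /andP[] := frac_bound (s0 i).
by apply: nondecreasing_cvgn_le; [exact: part_nondecreasing|exact: part_cvg].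
Qed.

Lemma metric_sum_le s K : (forall k, 0 <= s k) ->
  {homo s : m n / (m <= n)%N >-> m <= n} -> metric_sum R s <= s K + 2 ^- K.
Proof.
move=> s0 smono.
have cv : part s @ \oo --> metric_sum R s by exact: part_cvg.
apply: cvg_le_cst cv => N.
apply: (@le_trans _ _ (part s N.+1)); first exact: part_nondecreasing.
apply: (le_trans (part_le K N s0 smono)).
have := s0 K; have := mulr_ge0 (ltW (pow2V_gt0 N)) (s0 K).
have := pow2V_gt0 K; have := pow2V_gt0 N.
by case: ifP; lra.
Qed.

End MetricSum.

Section SupK.
Context {R : realType} {d : nat}.
Implicit Types f : 'rV[R]_d -> R.

Lemma supK_le f K (C : R) : (forall x, `|x| <= K%:R -> f x <= C) -> supK R d f K <= C.
Proof.
move=> fC; apply: ge_sup; first by exists (f 0); exists 0 => //=; rewrite normr0.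
by move=> _ [x /= xK <-]; exact: fC.
Qed.

Lemma le_supK f K (C : R) x : (forall x, `|x| <= K%:R -> f x <= C) ->
  `|x| <= K%:R -> f x <= supK R d f K.
Proof.
move=> fC xK; apply: ub_le_sup; last by exists x.
by exists C => _ [y /= yK <-]; exact: fC.
Qed.

Lemma supK_ge0 f K : (forall x, 0 <= f x) -> 0 <= supK R d f K.
Proof.
move=> f0; rewrite /supK; set E := [set _ | _ in _].
(* When the values are unbounded, [sup] takes its default value 0. *)
have [[_ ubE]|/sup_out->//] := pselect (has_sup E).
apply: (le_trans (f0 0)); apply: ub_le_sup => //.
by exists 0 => //=; rewrite normr0.
Qed.

Lemma supK_mono f : (forall K, exists C : R, forall x, `|x| <= K%:R -> f x <= C) ->
  {homo supK R d f : m n / (m <= n)%N >-> m <= n}.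
Proof.
move=> fb m n mn; apply: supK_le => x xm; have [C fC] := fb n.
by apply: le_supK fC _; rewrite (le_trans xm)// ler_nat.
Qed.

End SupK.

Section Mnorm.
Context {R : realType} {d : nat}.
Implicit Types a b : 'M[R]_d.
Local Notation mnorm := (mnorm R d).

Lemma mnorm_ge0 a : 0 <= mnorm a.
Proof. by apply: sumr_ge0 => i _; exact: sumr_ge0. Qed.

Lemma mnorm_entry a i j : `|a i j| <= mnorm a.
Proof.
rewrite /Defs.mnorm (bigD1 i)//= (bigD1 j)//= -addrA lerDl addr_ge0 ?sumr_ge0//.
by move=> k _; exact: sumr_ge0.
Qed.

Lemma mnorm_le a (e : R) : (forall i j, `|a i j| <= e) -> mnorm a <= (d * d)%:R * e.
Proof.
move=> ae; apply: (@le_trans _ _ (\sum_(i < d) \sum_(j < d) e)).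
  by apply: ler_sum => i _; apply: ler_sum.
by rewrite !sumr_const card_ord -mulrnA -[leLHS]mulr_natl.
Qed.

Lemma mnormB a b : mnorm (a - b) <= mnorm a + mnorm b.
Proof.
rewrite /Defs.mnorm -big_split/=; apply: ler_sum => i _.
rewrite -big_split/=; apply: ler_sum => j _; rewrite !mxE; exact: ler_normB.
Qed.

End Mnorm.

(** * Entries and partial derivatives of environments, and translations *)

Section Jets.
Context {R : realType} {d : nat}.
Implicit Types w : Fn R d.

(* Entry of [w], or of one of its partial derivatives. *)
Definition jet := (option 'I_d * ('I_d * 'I_d))%type.

Definition J (c : jet) w (x : 'rV[R]_d) : R :=
  (if c.1 is Some k then 'D_('e_k) w x else w x) c.2.1 c.2.2.

Lemma derive_tau w x k y :
  'D_('e_k) (tau R d x w) y = 'D_('e_k) w (x + y).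
Proof.
rewrite /derive; set g := (fun h : R => _).
set g' := (fun h : R => h^-1 *: ((w \o shift (x + y)) _ - _)).
by have -> : g = g' by apply/funext => h; rewrite /g /g' /tau /= addrCA.
Qed.

Lemma J_tau c w x y : J c (tau R d x w) y = J c w (x + y).
Proof. by rewrite /J; case: c.1 => [k|]; [rewrite derive_tau|]. Qed.

Lemma tauD x y w : tau R d x (tau R d y w) = tau R d (x + y) w.
Proof. by apply/funext => z; rewrite /tau addrA (addrC y). Qed.

Lemma tau0 w : tau R d 0 w = w.
Proof. by apply/funext => z; rewrite /tau add0r. Qed.

Lemma translate_continuous (x : 'rV[R]_d) : continuous (fun z : 'rV[R]_d => x + z).
Proof. by move=> y; apply: continuousD; [exact: cst_continuous|exact: id]. Qed.

Lemma Omega_tau lam Lam x w : Omega R d lam Lam w -> Omega R d lam Lam (tau R d x w).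
Proof.
move=> [cw hw]; split; last by move=> y; exact: hw.
by move=> y; apply: (cvg_comp _ _ (@translate_continuous x y)); exact: cw.
Qed.

Lemma C1_tau x w : C1 R d w -> C1 R d (tau R d x w).
Proof.
move=> [dw cw]; split.
  move=> y; apply: (@differentiable_comp _ _ _ _ (fun z => x + z) w) => //.
move=> i; rewrite (_ : (fun y => _) = fun y => 'D_('e_i) w (x + y)); last first.
  by apply/funext => y; rewrite derive_tau.
move=> y; apply: (@continuous_comp _ _ _ (fun z => x + z) (fun z => 'D_('e_i) w z));
  [exact: translate_continuous|exact: cw].
Qed.

Lemma OmegaR_tau lam Lam r x w :
  OmegaR R d lam Lam r w -> OmegaR R d lam Lam r (tau R d x w).
Proof.
by move=> [Ow [Cw rw]]; split; [exact: Omega_tau|split; [exact: C1_tau|move=> y; exact: rw]].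
Qed.

Lemma J_continuous c w : continuous w -> C1 R d w -> continuous (J c w).
Proof.
move=> cw [_ dw]; rewrite /J; case: c => -[k|] [i j] /= x.
  apply: (@continuous_comp _ _ _ (fun z => 'D_('e_k) w z) (fun M : 'M[R]_d => M i j)).
    exact: dw.
  exact: coord_continuous.
apply: (@continuous_comp _ _ _ w (fun M : 'M[R]_d => M i j)); first exact: cw.
exact: coord_continuous.
Qed.

Lemma continuous_bounded_ball (f : 'rV[R]_d -> R) K : continuous f ->
  exists C : R, forall x, `|x| <= K%:R -> `|f x| <= C.
Proof.
move=> cf; have cK : compact [set x : 'rV[R]_d | `|x| <= K%:R] by exact: rV_ball_compact.
have := @continuous_compact _ _ f _ (continuous_subspaceT cf) cK.
move/compact_bounded => [C [_ HC]]; exists (C + 1) => x xK.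
by apply: (HC (C + 1)); [rewrite ltrDl|exists x].
Qed.

End Jets.

(** * Continuous differentiability in terms of difference quotients *)

Section DifferenceQuotients.
Context {R : realType} {d : nat}.
Implicit Types (w : Fn R d) (x y : 'rV[R]_d).

Lemma mx_norm_leP m n (a : 'M[R]_(m, n)) (B : R) : 0 <= B ->
  reflect (forall i j, `|a i j| <= B) (`|a| <= B).
Proof.
move=> B0; rewrite /Num.norm/= mx_normrE; apply: (iffP (bigmax_leP _ _ _ _)).
  by move=> [_ H] i j; exact: (H (i, j)).
by move=> H; split=> // -[i j] _; exact: H.
Qed.

Lemma norm_delta_le (i : 'I_d) : `|'e_i : 'rV[R]_d| <= 1.
Proof.
apply/rV_norm_leP => // j; rewrite mxE eqxx/=.
by case: eqP => _; rewrite ?normr1// normr0.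
Qed.

Definition dq w i a b x (h : R) : R := (w (x + h *: 'e_i) a b - w x a b) / h.

(** Equivalent to [C1] ([C1_dq_uniform], [dq_uniform_C1]), yet it mentions only values of [w]: for
    fixed [K], [e] and [del] it is a closed condition for locally uniform convergence, which makes
    [OmegaR] measurable. *)
Definition dq_uniform w := forall (K : nat) (e : R), 0 < e ->
  exists2 del : R, 0 < del & forall i a b x y h h', `|x| <= K%:R -> `|y| <= K%:R ->
    `|x - y| <= del -> h != 0 -> h' != 0 -> `|h| <= del -> `|h'| <= del ->
    `|dq w i a b x h - dq w i a b y h'| <= e.

Lemma J_is_derive w (i a b : 'I_d) x (t : R) : differentiable w (x + t *: 'e_i) ->
  is_derive t 1 (fun t => w (x + t *: 'e_i) a b) (J (Some i, (a, b)) w (x + t *: 'e_i)).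
Proof.
move=> dw; set z := x + t *: 'e_i.
have dv : derivable w z 'e_i by exact: diff_derivable.
have cv : (fun h : R => h^-1 *: (w (h *: 'e_i + z) - w z)) @ 0^' --> 'D_('e_i) w z.
  exact: dv.
have E : (fun h : R => h^-1 *: (w (x + (h *: (1 : R) + t) *: 'e_i) a b - w z a b)) =
   (fun M : 'M[R]_d => M a b) \o (fun h : R => h^-1 *: (w (h *: 'e_i + z) - w z)).
  apply/funext => h /=; rewrite !mxE /z; congr (_ * (w _ a b - _)).
  by rewrite scalerDl [h *: (1 : R)]mulr1 addrCA.
have cv' : (fun h : R => h^-1 *: (w (x + (h *: (1 : R) + t) *: 'e_i) a b - w z a b))
    @ 0^' --> ('D_('e_i) w z) a b.
  by rewrite E; apply: (cvg_comp _ _ cv); exact: coord_continuous.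
pose f (s : R) : R := w (x + s *: 'e_i) a b.
have dd : derivable f t 1.
  by apply/cvg_ex; exists (('D_('e_i) w z) a b).
split=> //; rewrite /J/= /derive; apply: cvg_lim => //.
Qed.

Lemma dq_mvt w (i a b : 'I_d) x (h : R) : (forall x, differentiable w x) -> h != 0 ->
  exists2 t : R, `|t| <= `|h| & dq w i a b x h = J (Some i, (a, b)) w (x + t *: 'e_i).
Proof.
move=> dw h0; pose f (t : R) : R := w (x + t *: 'e_i) a b.
have df (t : R) : is_derive t 1 f (J (Some i, (a, b)) w (x + t *: 'e_i)).
  exact: J_is_derive.
have cf : continuous f.
  by move=> t; apply/differentiable_continuous/derivable1_diffP; case: (df t).
have f0 : f 0 = w x a b by rewrite /f scale0r addr0.
case: (ltrgt0P h) h0 => // hs _.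
- have [t] := MVT_segment (ltW hs) (fun t _ => df t) (continuous_subspaceT cf).
  rewrite in_itv/= f0 subr0 => /andP[t0 th] E; exists t.
    by rewrite ger0_norm// ger0_norm// ltW.
  by rewrite /dq -/(f h) E mulfK// gt_eqF.
- have [t] := MVT_segment (ltW hs) (fun t _ => df t) (continuous_subspaceT cf).
  rewrite in_itv/= f0 sub0r => /andP[th t0] E; exists t.
    by rewrite ler0_norm// lerN2.
  rewrite /dq -/(f h) -opprB E mulrN opprK mulfK// lt_eqF//.
Qed.

Lemma C1_dq_uniform w : C1 R d w -> dq_uniform w.
Proof.
move=> Cw K e e0; have [dw cdw] := Cw.
have cw : continuous w by move=> x; exact: differentiable_continuous.
have Jluc (c : jet) : exists del : R, 0 < del /\ forall x y,
    `|x| <= K%:R + 1 -> `|y| <= K%:R + 1 -> `|x - y| <= del -> `|J c w x - J c w y| <= e.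
  have [del d0 H] := continuous_luc (J_continuous (c := c) cw Cw) (K%:R + 1) e0.
  by exists del.
have /choice[del Hdel] := Jluc.
pose D : R := \big[Num.min/1]_(c : jet) del c.
have D0 : 0 < D by apply: lt_bigmin => // c _; have [] := Hdel c.
have D1 : D <= 1 by exact: bigmin_le_id.
have Dc c : D <= del c by exact: bigmin_le_cond.
(* One third for [x - y] and one for each of the two mean value displacements; [D <= 1] keeps the
   mean value points in the ball of radius [K + 1]. *)
exists (D / 3); first by rewrite divr_gt0.
move=> i a b x y h h' xK yK xy h0 h'0 hD h'D.
have [t th ->] := dq_mvt i a b x dw h0.
have [t' th' ->] := dq_mvt i a b y dw h'0.
have nt (s : R) : `|s *: ('e_i : 'rV[R]_d)| <= `|s|.
  by rewrite normrZ ler_piMr// norm_delta_le.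
have [_ H] := Hdel (Some i, (a, b)); apply: H.
- apply: (le_trans (ler_normD _ _)); apply: lerD => //.
  by apply: (le_trans (nt t)); lra.
- apply: (le_trans (ler_normD _ _)); apply: lerD => //.
  by apply: (le_trans (nt t')); lra.
- apply: le_trans (Dc _).
  have -> : x + t *: 'e_i - (y + t' *: 'e_i) = (x - y) + (t *: 'e_i - t' *: 'e_i).
    by rewrite opprD addrACA.
  apply: (le_trans (ler_normD _ _)).
  have := le_trans (ler_normB (t *: ('e_i : 'rV[R]_d)) (t' *: 'e_i)) (lerD (nt t) (nt t')).
  lra.
Qed.

Section Converse.
Variable w : Fn R d.
Hypothesis hw : dq_uniform w.

Let bound x : exists K : nat, `|x| + 1 <= K%:R.
Proof.
have [m _ Hm] := @nbhs_infty_ger R (`|x| + 1).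
by exists m; apply: (Hm m) => /=.
Qed.

(** The case [x = y] of the hypothesis is the Cauchy criterion as the step tends to 0. *)
Lemma dq_cvg i a b x : cvg (dq w i a b x @ 0^').
Proof.
have [K xK] := bound x.
apply/cauchy_cvgP/cauchy_exP => e e0.
have e2 : 0 < e / 2 by rewrite divr_gt0.
have [del d0 H] := hw K e2.
exists (dq w i a b x del); rewrite /=; near=> h.
rewrite -ball_normE /=; apply: (@le_lt_trans _ _ (e / 2)); last lra.
have xK' : `|x| <= K%:R by rewrite (le_trans _ xK)// lerDl.
apply: H => //.
- by rewrite subrr normr0 ltW.
- by rewrite gt_eqF.
- near: h; exact: nbhs_dnbhs_neq.
- by rewrite gtr0_norm.
- near: h; apply/dnbhs0_le; exact: d0.
Unshelve. all: by end_near. Qed.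

Let D i a b x : R := lim (dq w i a b x @ 0^').

Lemma dq_near (K : nat) (e : R) : 0 < e -> exists2 del : R, 0 < del &
  forall i a b x y h, `|x| <= K%:R -> `|y| <= K%:R -> `|x - y| <= del ->
    h != 0 -> `|h| <= del -> `|dq w i a b x h - D i a b y| <= e.
Proof.
move=> e0; have [del d0 H] := hw K e0; exists del => // i a b x y h xK yK xy h0 hd.
have cv : (fun h' => `|dq w i a b x h - dq w i a b y h'|) @ 0^' -->
    `|dq w i a b x h - D i a b y|.
  apply: cvg_norm; apply: cvgB; [exact: cvg_cst|exact: dq_cvg].
apply: (closed_cvg (fun t => t <= e) _ _ _ cv); first exact: closed_le.
near=> h'; apply: H => //.
- near: h'; exact: nbhs_dnbhs_neq.
- near: h'; apply/dnbhs0_le; exact: d0.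
Unshelve. all: by end_near. Qed.

Lemma D_uniform (K : nat) (e : R) : 0 < e -> exists2 del : R, 0 < del &
  forall i a b x y, `|x| <= K%:R -> `|y| <= K%:R -> `|x - y| <= del ->
    `|D i a b x - D i a b y| <= e.
Proof.
move=> e0; have [del d0 H] := dq_near K e0; exists del => // i a b x y xK yK xy.
have cv : (fun h => `|dq w i a b x h - D i a b y|) @ 0^' --> `|D i a b x - D i a b y|.
  by apply: cvg_norm; apply: cvgB; [exact: dq_cvg|exact: cvg_cst].
apply: (closed_cvg (fun t => t <= e) _ _ _ cv); first exact: closed_le.
near=> h; apply: H => //.
- near: h; exact: nbhs_dnbhs_neq.
- near: h; apply/dnbhs0_le; exact: d0.
Unshelve. all: by end_near. Qed.

Let Dmx i x : 'M[R]_d := \matrix_(a, b) D i a b x.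

(** Matrix of the candidate differential, which sends [u] to the sum of the [u 0 i *: Dmx i x];
    going through a matrix product makes [df] linear by construction. *)
Let L x : 'M[R]_(d, d * d) := \matrix_(i < d) mxvec (Dmx i x).

Let df x : {linear 'rV[R]_d -> 'M[R]_d} := vec_mx \o mulmxr (L x).

Let dfE x u : df x u = \sum_i u 0 i *: Dmx i x.
Proof.
rewrite /df/= mulmx_sum_row linear_sum/=; apply: eq_bigr => i _.
by rewrite linearZ/= rowK mxvecK.
Qed.

Let df_continuous x : continuous (df x).
Proof.
rewrite (_ : (df x : _ -> _) = \sum_(i < d) (fun u : 'rV[R]_d => u 0 i *: Dmx i x)).
  move=> u; apply: differentiable_continuous; apply: differentiable_sum => i.
  by apply: differentiableZl; exact: differentiable_coord.
by apply/funext => u; rewrite dfE fct_sumE.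
Qed.

(** Vertices of the path from 0 to [u] that switches on one coordinate at a time. *)
Let trunc (u : 'rV[R]_d) (k : nat) : 'rV[R]_d := \row_j (if (j < k)%N then u 0 j else 0).

Let trunc_le u k : `|trunc u k| <= `|u|.
Proof.
apply/rV_norm_leP => // j; rewrite mxE; case: ifP => _; first exact: rV_coord_le.
by rewrite normr0.
Qed.

Let truncS u (i : 'I_d) : trunc u i.+1 = trunc u i + u 0 i *: 'e_i.
Proof.
apply/rowP => j; rewrite !mxE eqxx/= ltnS leq_eqVlt.
case: (eqVneq j i) => [->|ji]; first by rewrite eqxx ltnn /= mulr1 add0r.
by rewrite -(inj_eq val_inj) in ji; rewrite (negbTE ji)/= mulr0 addr0.
Qed.

Let increment x u a b : w (u + x) a b - w x a b =
  \sum_(i < d) (w (trunc u i.+1 + x) a b - w (trunc u i + x) a b).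
Proof.
rewrite -(big_mkord xpredT (fun i => w (trunc u i.+1 + x) a b - w (trunc u i + x) a b)).
rewrite telescope_sumr//; congr (w (_ + _) _ _ - w _ _ _).
  by apply/rowP => j; rewrite mxE ltn_ord.
rewrite (_ : trunc u 0 = 0) ?add0r//; by apply/rowP => j; rewrite !mxE.
Qed.

(** The increment of [w] telescopes along the coordinate path; its [i]-th piece is [u 0 i] times a
    difference quotient at a point near [x], hence close to [u 0 i] times the limit quotient at
    [x]. *)
Lemma dq_differential x : w \o shift x = cst (w x) + df x +o_ (0 : 'rV[R]_d) id.
Proof.
apply/eqaddoP => _/posnumP[e]; have [K xK] := bound x.
have d1 : 0 < d%:R + 1 :> R by rewrite ltr_wpDl.
have e1 : 0 < e%:num / (d%:R + 1) by rewrite divr_gt0.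
have [del d0 H] := dq_near K e1.
near=> u.
have u1 : `|u| <= 1.
  by near: u; apply: cvgr0_norm_le => //; exact: cvg_id.
have ud : `|u| <= del.
  by near: u; apply: cvgr0_norm_le => //; exact: cvg_id.
rewrite /= -[X in `|X|]/(w (u + x) - (w x + df x u)).
apply/mx_norm_leP; first by rewrite mulr_ge0.
move=> a b; rewrite dfE !mxE summxE opprD addrA increment -sumrB.
apply: le_trans (ler_norm_sum _ _ _) _.
apply: (@le_trans _ _ (\sum_(i < d) e%:num / (d%:R + 1) * `|u|)); last first.
  rewrite sumr_const card_ord -[leLHS]mulr_natl mulrA ler_wpM2r//.
  by rewrite mulrA ler_pdivrMr// mulrC ler_wpM2l// lerDl.
apply: ler_sum => i _; rewrite !mxE truncS.
(* A zero coordinate has no difference quotient; its increment and its linear term both vanish. *)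
have [u0|u0] := eqVneq (u 0 i) 0.
  by rewrite u0 scale0r addr0 subrr mul0r subr0 normr0 mulr_ge0// ltW.
have -> : w (trunc u i + u 0 i *: 'e_i + x) a b - w (trunc u i + x) a b =
   u 0 i * dq w i a b (trunc u i + x) (u 0 i).
  by rewrite /dq mulrCA divff// mulr1 addrAC.
rewrite -mulrBr normrM mulrC; apply: ler_pM => //; last exact: rV_coord_le.
apply: H => //.
- apply: le_trans xK; rewrite addrC; apply: (le_trans (ler_normD _ _)).
  by rewrite lerD2l (le_trans (trunc_le _ _)).
- by rewrite (le_trans _ xK)// lerDl.
- by rewrite addrK (le_trans (trunc_le _ _)).
- exact: le_trans (rV_coord_le _ _) ud.
Unshelve. all: by end_near. Qed.

Lemma dq_uniform_C1 : C1 R d w.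
Proof.
have dE x : 'd w x = df x :> (_ -> _).
  by apply: diff_unique; [exact: df_continuous|exact: dq_differential].
have dw x : differentiable w x.
  by apply/diff_locallyP; rewrite dE; split; [exact: df_continuous|exact: dq_differential].
split=> // i.
rewrite (_ : (fun x => _) = Dmx i); last first.
  apply/funext => x; rewrite deriveE// dE dfE (bigD1 i)//= big1 => [|j ji].
    by rewrite mxE !eqxx scale1r addr0.
  by rewrite mxE eqxx/= (negbTE ji) scale0r.
move=> x; apply/(@cvgrPdist_le _ _ _ (nbhs x)) => e e0; have [K xK] := bound x.
have [del d0 H] := D_uniform K e0.
near=> y; apply/mx_norm_leP => [|a b]; first exact: ltW.
have xy : `|x - y| <= Num.min 1 del.
  near: y; apply/nbhs_ballP; exists (Num.min 1 del); first by rewrite /= lt_min ltr01.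
  by move=> z; rewrite -ball_normE => /ltW.
rewrite !mxE; apply: H.
- by rewrite (le_trans _ xK)// lerDl.
- have -> : y = x - (x - y) by rewrite opprB addrC subrK.
  apply: le_trans xK; apply: (le_trans (ler_normB _ _)); rewrite lerD2l.
  by apply: (le_trans xy); rewrite ge_min lexx.
- by apply: (le_trans xy); rewrite ge_min lexx orbT.
Unshelve. all: by end_near. Qed.

End Converse.

End DifferenceQuotients.

(** * Open and measurable sets of environments *)

Section EnvironmentSpace.
Context {R : realType} {d : nat}.
Variables (lam Lam r : R).
Local Notation Om := (Omega R d lam Lam).
Local Notation OO := (OmegaOpen R d lam Lam).
Local Notation T := (OmegaMeas R d lam Lam).
Local Notation X := (OmegaR R d lam Lam r).
Local Notation mnorm := (mnorm R d).
Implicit Types w : Fn R d.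

Lemma Omega_mnormB w w' x : Om w -> Om w' -> mnorm (w x - w' x) <= 2 * Lam.
Proof.
move=> [_ hw] [_ hw']; apply: (le_trans (mnormB _ _)).
by have [_ h1 _] := hw x; have [_ h2 _] := hw' x; lra.
Qed.

Lemma dist0_le w w' K (e : R) : Om w -> Om w' ->
  (forall x, `|x| <= K%:R -> mnorm (w x - w' x) <= e) -> dist0 R d w w' <= e + 2 ^- K.
Proof.
move=> Ow Ow' he; apply: le_trans (metric_sum_le K _ _) _.
- by move=> k; apply: supK_ge0 => x; exact: mnorm_ge0.
- by apply: supK_mono => k; exists (2 * Lam) => x _; exact: Omega_mnormB.
- by rewrite lerD2r; exact: supK_le.
Qed.

Lemma frac_mono (x y : R) : 0 <= x -> x <= y -> x / (1 + x) <= y / (1 + y).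
Proof.
move=> x0 xy; have y0 := le_trans x0 xy.
have x1 : 0 < 1 + x by rewrite ltr_pwDl.
have y1 : 0 < 1 + y by rewrite ltr_pwDl.
rewrite ler_pdivrMr// mulrAC ler_pdivlMr//; lra.
Qed.

(** One term of the series already controls a ball. The term [K.+1] is taken because the series
    starts at 1 and [K] may be 0. *)
Lemma dist0_lt w w' K (e : R) x : Om w -> Om w' -> 0 < e ->
  dist0 R d w w' < 2 ^- K.+1 * (e / (1 + e)) -> `|x| <= K%:R ->
  mnorm (w x - w' x) <= e.
Proof.
move=> Ow Ow' e0 H xK; set f := fun x => mnorm (w x - w' x).
have fb y : `|y| <= K.+1%:R -> f y <= 2 * Lam by move=> _; exact: Omega_mnormB.
have fx : f x <= supK R d f K.+1.
  by apply: le_supK fb _; rewrite (le_trans xK)// ler_nat.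
apply: (le_trans fx); rewrite leNgt; apply/negP => es; move: H; apply/negP; rewrite -leNgt.
apply: (@le_trans _ _ (2 ^- K.+1 * (supK R d f K.+1 / (1 + supK R d f K.+1)))).
  by rewrite ler_pM2l ?pow2V_gt0//; apply: frac_mono; exact: ltW.
apply: (@metric_sum_ge _ (supK R d f) K.+1) => // k.
by apply: supK_ge0 => y; exact: mnorm_ge0.
Qed.

Definition locally_open (A : set (Fn R d)) := forall w, A w ->
  exists (K : nat) (del : R), 0 < del /\ forall w', Om w' ->
    (forall x, `|x| <= K%:R -> mnorm (w x - w' x) <= del) -> A w'.

(** Trades the series metric for closeness on a single ball, the form in which openness is checked
    from here on. *)
Lemma OmegaOpenP A : OO A <-> A `<=` Om /\ locally_open A.
Proof.
split=> [[AO H]|[AO H]]; split=> // w Aw.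
  have [e e0 He] := H w Aw; have e2 : 0 < e / 2 by rewrite divr_gt0.
  have [K HK] := pow2V_small e2.
  exists K, (e / 2); split=> // w' Ow' ww'; apply: He => //.
  by apply: le_lt_trans (dist0_le (AO _ Aw) Ow' ww') _; lra.
have [K [del [d0 Hd]]] := H w Aw.
exists (2 ^- K.+1 * (del / (1 + del))).
  by rewrite mulr_gt0 ?pow2V_gt0// divr_gt0// addr_gt0.
move=> w' Ow' ww'; apply: Hd => // x xK; exact: (dist0_lt (AO _ Aw) Ow' d0 ww' xK).
Qed.

Lemma OmegaOpen_measurable (A : set (Fn R d)) : OO A -> measurable (A : set T).
Proof. exact: sub_gen_smallest. Qed.

Lemma measurable_Omega : measurable (Om : set T).
Proof.
apply: OmegaOpen_measurable; apply/OmegaOpenP; split=> // w Ow.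
by exists 0%N; exists 1; split.
Qed.

Lemma Omega_tau_pre x : tau R d x @^-1` Om = Om.
Proof.
apply/seteqP; split=> w /=; last exact: Omega_tau.
by move=> /(Omega_tau (- x)); rewrite tauD addNr tau0.
Qed.

Lemma measurable_tau x : measurable_fun (setT : set T) (tau R d x : T -> T).
Proof.
apply: (@measurability _ _ T T setT (tau R d x) OO) => //.
move=> _ [A /OmegaOpenP [AO HA] <-]; rewrite setTI.
apply: OmegaOpen_measurable; apply/OmegaOpenP; split.
  by rewrite -(Omega_tau_pre x) => w /=; exact: AO.
move=> w /= Aw; have [K [del [d0 H]]] := HA _ Aw.
have [m _ Hm] := @nbhs_infty_ger R (`|x|).
(* A window of radius [K] translated by [x] lies in the ball of radius [m + K], since [m >= |x|]. *)
exists (m + K)%N, del; split=> // w' Ow' ww'; apply: H; first exact: Omega_tau.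
move=> y yK; apply: ww'; rewrite (le_trans (ler_normD _ _))// natrD lerD//.
exact: (Hm m (leqnn m)).
Qed.

Lemma eval_close (w w' : Fn R d) x a b : `|w x a b - w' x a b| <= mnorm (w x - w' x).
Proof. by have := mnorm_entry (w x - w' x) a b; rewrite !mxE. Qed.

Lemma measurable_eval x a b : measurable_fun (Om : set T) (fun w : T => w x a b : R).
Proof.
apply: (measurability _ (RGenOInfty.measurableE R)) => //.
move=> _ [_ [c ->] <-]; apply: OmegaOpen_measurable; apply/OmegaOpenP.
split=> [w []//|w [Ow]]; rewrite /= in_itv/= andbT => cw.
have [m _ Hm] := @nbhs_infty_ger R (`|x|).
exists m, ((w x a b - c) / 2); split; first by rewrite divr_gt0// subr_gt0.
move=> w' Ow' ww'; split=> //; rewrite /= in_itv/= andbT.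
have := le_trans (eval_close w w' x a b) (ww' x (Hm m (leqnn m))).
rewrite ler_norml; lra.
Qed.

(* Both conditions cutting [OmegaR] out of [Omega] are countable combinations of
   sets that are closed in the locally uniform topology. *)
Definition quadratic (a : 'M[R]_d) (v : 'rV[R]_d) : R := (v *m a *m v^T) 0 0.

Lemma quadraticE a v : quadratic a v = \sum_j (\sum_i v 0 i * a i j) * v 0 j.
Proof.
rewrite /quadratic mxE; apply: eq_bigr => j _; rewrite !mxE; congr (_ * _).
Qed.

Lemma quadratic_close (a b : 'M[R]_d) v :
  `|quadratic a v - quadratic b v| <= `|v| ^+ 2 * mnorm (a - b).
Proof.
rewrite !quadraticE -sumrB /Defs.mnorm exchange_big/= mulr_sumr.
apply: (le_trans (ler_norm_sum _ _ _)); apply: ler_sum => j _.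
rewrite -mulrBl -sumrB normrM.
apply: (@le_trans _ _ ((\sum_i `|v| * `|(a - b) i j|) * `|v|)).
  apply: ler_pM => //; last exact: rV_coord_le.
  apply: (le_trans (ler_norm_sum _ _ _)); apply: ler_sum => i _.
  by rewrite -mulrBr normrM !mxE ler_wpM2r// rV_coord_le.
by rewrite -mulr_sumr expr2 mulrAC.
Qed.

Lemma psd_shift w x : Om w -> psd R d (w x - r%:M) <->
  forall v, 0 <= quadratic (w x - r%:M) v.
Proof.
move=> [_ /(_ x) [[wT _] _ _]]; split=> [[]//|H]; split=> //.
by rewrite linearB/= wT tr_scalar_mx.
Qed.

Lemma measurable_psd :
  measurable ([set w | Om w /\ forall x, psd R d (w x - r%:M)] : set T).
Proof.
pose B : set (Fn R d) := [set w | Om w /\ exists x v, quadratic (w x - r%:M) v < 0].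
rewrite (_ : [set w | _] = Om `\` B); last first.
  apply/seteqP; split=> [w [Ow H]|w [Ow nB]]; split=> //.
    by move=> [_ [x [v]]]; apply/negP; rewrite -leNgt; exact: ((psd_shift x Ow).1 (H x) v).
  move=> x; apply/(psd_shift x Ow) => v; rewrite leNgt; apply/negP => neg.
  by apply: nB; split=> //; exists x, v.
apply: measurableD; first exact: measurable_Omega.
apply: OmegaOpen_measurable; apply/OmegaOpenP; split=> [w []//|w [Ow [x [v neg]]]].
have [m _ Hm] := @nbhs_infty_ger R (`|x|).
have v1 : 0 < `|v| ^+ 2 + 1 by rewrite ltr_wpDl// exprn_ge0.
(* Chosen so that the quadratic form at [v] moves by at most half of its negative value; the [+ 1]
   keeps the denominator positive. *)
pose del := - quadratic (w x - r%:M) v / (`|v| ^+ 2 + 1) / 2.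
exists m, del; split; first by rewrite !divr_gt0// oppr_gt0.
move=> w' Ow' ww'; split=> //; exists x, v.
have := quadratic_close (w x - r%:M) (w' x - r%:M) v.
rewrite opprB addrA subrK => qc.
have := ww' x (Hm m (leqnn m)) => mn.
have n0 := mnorm_ge0 (w x - w' x).
have : `|v| ^+ 2 * mnorm (w x - w' x) <= - quadratic (w x - r%:M) v / 2.
  apply: (@le_trans _ _ ((`|v| ^+ 2 + 1) * mnorm (w x - w' x))).
    by rewrite ler_wpM2r// lerDl.
  apply: le_trans (ler_wpM2l (ltW v1) mn) _.
  by rewrite /del mulrCA mulrA divfK ?gt_eqF// mulrC.
move: qc; rewrite ler_norml; lra.
Qed.

Definition dq_bounded (K m n : nat) : set (Fn R d) :=
  [set w | Om w /\ forall i a b x y h h', `|x| <= K%:R -> `|y| <= K%:R ->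
    `|x - y| <= n.+1%:R^-1 -> h != 0 -> h' != 0 ->
    `|h| <= n.+1%:R^-1 -> `|h'| <= n.+1%:R^-1 ->
    `|dq w i a b x h - dq w i a b y h'| <= m.+1%:R^-1].

Lemma dq_close w w' (e : R) i a b x h : h != 0 ->
  mnorm (w (x + h *: 'e_i) - w' (x + h *: 'e_i)) <= e -> mnorm (w x - w' x) <= e ->
  `|dq w i a b x h - dq w' i a b x h| <= 2 * e / `|h|.
Proof.
move=> h0 e1 e2; rewrite /dq -mulrBl normrM normfV ler_pM2r ?invr_gt0 ?normr_gt0//.
have := le_trans (eval_close _ _ _ a b) e1; have := le_trans (eval_close _ _ _ a b) e2.
rewrite !ler_norml; lra.
Qed.

Lemma dist_quad_le (p q p' q' e : R) : `|p - p'| <= e -> `|q - q'| <= e ->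
  `|p - q| <= `|p' - q'| + e + e.
Proof.
move=> pe qe; have -> : p - q = (p' - q') + (p - p') - (q - q') by ring.
apply: (le_trans (ler_normB _ _)); apply: lerD => //.
by apply: (le_trans (ler_normD _ _)); apply: lerD.
Qed.

(** A violation involves fixed nonzero steps and only four points, so it survives a small uniform
    perturbation on a ball containing them: the complement in [Omega] is open. *)
Lemma measurable_dq_bounded K m n : measurable (dq_bounded K m n : set T).
Proof.
pose adm (x y : 'rV[R]_d) (h h' : R) : Prop :=
  [/\ `|x| <= K%:R, `|y| <= K%:R, `|x - y| <= n.+1%:R^-1, h != 0 & h' != 0].
pose small (h : R) : Prop := `|h| <= n.+1%:R^-1.
pose B : set (Fn R d) := [set w | Om w /\ exists i a b x y h h',
  [/\ adm x y h h', small h, small h' &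
    m.+1%:R^-1 < `|dq w i a b x h - dq w i a b y h'|]].
rewrite (_ : dq_bounded K m n = Om `\` B); last first.
  apply/seteqP; split=> [w [Ow H]|w [Ow nB]]; split=> //.
    move=> [_ [i [a [b [x [y [h [h' [[? ? ? ? ?] ? ?]]]]]]]]]; apply/negP.
    by rewrite -leNgt; exact: H.
  move=> i a b x y h h' xK yK xy h0 h0' hn hn'; rewrite leNgt; apply/negP => neg.
  by apply: nB; split=> //; exists i, a, b, x, y, h, h'.
apply: measurableD; first exact: measurable_Omega.
apply: OmegaOpen_measurable; apply/OmegaOpenP; split=> [w []//|w [Ow]].
move=> [i [a [b [x [y [h [h' [[xK yK xy h0 h'0] hn hn' neg]]]]]]]].
have [k _ Hk] := @nbhs_infty_ger R
  (`|x| + `|y| + `|x + h *: 'e_i| + `|y + h' *: 'e_i|).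
have {}Hk : `|x| + `|y| + `|x + h *: 'e_i| + `|y + h' *: 'e_i| <= k%:R.
  exact: (Hk k (leqnn k)).
have nx := normr_ge0 x; have ny := normr_ge0 y.
have nxh := normr_ge0 (x + h *: 'e_i); have nyh := normr_ge0 (y + h' *: 'e_i).
pose gap := `|dq w i a b x h - dq w i a b y h'| - m.+1%:R^-1.
have gap0 : 0 < gap by rewrite subr_gt0.
have nh : 0 < `|h| by rewrite normr_gt0.
have nh' : 0 < `|h'| by rewrite normr_gt0.
(* Each quotient moves by at most [2 * del / |h| <= gap / 4] (likewise for [h']), so half of the gap
   remains. *)
pose del := Num.min `|h| `|h'| * gap / 8.
have del0 : 0 < del by rewrite divr_gt0// mulr_gt0// lt_min nh nh'.
have d1 : 2 * del / `|h| <= gap / 4.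
  have : Num.min `|h| `|h'| <= `|h| by rewrite ge_min lexx.
  rewrite ler_pdivrMr// /del => mh; have := ler_wpM2r (ltW gap0) mh; lra.
have d2 : 2 * del / `|h'| <= gap / 4.
  have : Num.min `|h| `|h'| <= `|h'| by rewrite ge_min lexx orbT.
  rewrite ler_pdivrMr// /del => mh; have := ler_wpM2r (ltW gap0) mh; lra.
exists k, del; split=> // w' Ow' ww'; split=> //.
exists i, a, b, x, y, h, h'; split=> //.
have c1 : `|dq w i a b x h - dq w' i a b x h| <= gap / 4.
  by apply: le_trans d1; apply: dq_close => //; apply: ww'; lra.
have c2 : `|dq w i a b y h' - dq w' i a b y h'| <= gap / 4.
  by apply: le_trans d2; apply: dq_close => //; apply: ww'; lra.
have := dist_quad_le c1 c2; move: gap0; rewrite /gap; move: (m.+1%:R^-1) => u; lra.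
Qed.

(** The quantifiers over [e] and [del] in [dq_uniform] are rounded to [1/(m+1)] and [1/(n+1)], which
    makes the description countable. *)
Lemma OmegaRE : X = [set w | Om w /\ forall x, psd R d (w x - r%:M)] `&`
  \bigcap_K \bigcap_m \bigcup_n dq_bounded K m n.
Proof.
apply/seteqP; split=> [w [Ow [Cw rw]]|w [[Ow rw] H]].
  split=> // K _ m _.
  have m0 : 0 < m.+1%:R^-1 :> R by rewrite invr_gt0.
  have [del d0 Hd] := C1_dq_uniform Cw K m0.
  have [n _ /(_ n (leqnn n)) Hn] := @nbhs_infty_ger R del^-1.
  have nd : n.+1%:R^-1 <= del.
    rewrite -[del]invrK lef_pV2 ?posrE ?invr_gt0//.
    by rewrite (le_trans Hn)// ler_nat.
  exists n => //; split=> // i a b x y h h' xK yK xy h0 h'0 hn h'n.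
  by apply: Hd => //; exact: le_trans nd.
split=> //; split=> //; apply: dq_uniform_C1 => K e e0.
have [m _ /(_ m (leqnn m)) Hm] := @nbhs_infty_ger R e^-1.
have me : m.+1%:R^-1 <= e.
  rewrite -[e]invrK lef_pV2 ?posrE ?invr_gt0//.
  by rewrite (le_trans Hm)// ler_nat.
have [n _ [_ Hn]] := H K I m I.
exists n.+1%:R^-1; first by rewrite invr_gt0.
move=> i a b x y h h' xK yK xy h0 h'0 hn h'n.
by apply: le_trans me; exact: Hn.
Qed.

Lemma measurable_OmegaR : measurable (X : set T).
Proof.
rewrite OmegaRE; apply: measurableI; first exact: measurable_psd.
apply: bigcapT_measurable => K; apply: bigcapT_measurable => m.
by apply: bigcupT_measurable => n; exact: measurable_dq_bounded.
Qed.

Lemma OmegaR_continuous w : X w -> continuous w.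
Proof. by move=> [[]]. Qed.

Lemma OmegaR_Jcont c w : X w -> continuous (J c w).
Proof. by move=> Xw; apply: J_continuous; [exact: OmegaR_continuous|case: Xw => _ []]. Qed.

(** Partial derivatives are pointwise limits on [X] of quotients with step [1/(n+1)], and these are
    built from evaluations. *)
Lemma measurable_J c x : measurable_fun (X : set T) (fun w : T => J c w x : R).
Proof.
have XO : X `<=` Om by move=> w [].
case: c => -[k|] [a b]; last first.
  by apply: measurable_funS (measurable_eval x a b) => //; exact: measurable_Omega.
apply: (@measurable_fun_cvg _ T R X
  (fun n (w : T) => (w (x + n.+1%:R^-1 *: 'e_k) a b - w x a b) * n.+1%:R)).
  move=> n; apply: measurable_funM => //; apply: measurable_funB.
    by apply: measurable_funS (measurable_eval _ a b) => //; exact: measurable_Omega.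
  by apply: measurable_funS (measurable_eval x a b) => //; exact: measurable_Omega.
move=> w Xw; have [_ [[dw _] _]] := Xw.
apply/cvgrPdist_le => e e0.
have cJ := OmegaR_Jcont (c := (Some k, (a, b))) Xw.
have [del d0 H] := continuous_luc cJ (`|x| + 1) e0.
have m0 : 0 < Num.min 1 del by rewrite lt_min ltr01.
near=> n.
have n0 : n.+1%:R^-1 != 0 :> R by rewrite invr_eq0 pnatr_eq0.
have [t th E] := dq_mvt k a b x dw n0.
move: E; rewrite /dq invrK => ->.
have tm : `|t *: ('e_k : 'rV[R]_d)| <= Num.min 1 del.
  rewrite normrZ (le_trans (ler_wpM2l (normr_ge0 t) (norm_delta_le k)))// mulr1.
  apply: (le_trans th); rewrite ger0_norm ?invr_ge0//.
  rewrite -[leRHS]invrK lef_pV2 ?posrE ?invr_gt0//.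
  apply: (@le_trans _ _ n%:R); last by rewrite ler_nat.
  near: n; exact: nbhs_infty_ger.
apply: H.
- by rewrite lerDl.
- by apply: (le_trans (ler_normD _ _)); rewrite lerD2l (le_trans tm)// ge_min lexx.
- by rewrite opprD addrA subrr sub0r normrN (le_trans tm)// ge_min lexx orbT.
Unshelve. all: by end_near. Qed.

End EnvironmentSpace.

(** * Local observables *)

Section Observables.
Context {R : realType} {d : nat}.
Variables (lam Lam r : R).
Local Notation T := (OmegaMeas R d lam Lam).
Local Notation X := (OmegaR R d lam Lam r).
Local Notation jet := (jet (d := d)).
Implicit Types (v w : Fn R d) (F : Fn R d -> R).

Definition jclose (K : nat) (eta : R) v v' := forall (c : jet) x,
  `|x| <= K%:R -> `|J c v x - J c v' x| <= eta.

Lemma jclose_le (K K' : nat) (eta : R) v v' : (K' <= K)%N ->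
  jclose K eta v v' -> jclose K' eta v v'.
Proof. by move=> KK H c x xK; apply: H; rewrite (le_trans xK)// ler_nat. Qed.

(** Continuity on [OmegaR] for locally uniform convergence of values and gradients, phrased with
    windows instead of the series defining [distR]. *)
Definition jcont F := forall v, X v -> forall e : R, 0 < e ->
  exists (K : nat) (eta : R), 0 < eta /\ forall v', X v' -> jclose K eta v v' ->
    `|F v - F v'| <= e.

Lemma J_uniform w (B eta : R) : X w -> 0 < eta ->
  exists2 del : R, 0 < del & forall (c : jet) x y, `|x| <= B -> `|y| <= B ->
    `|x - y| <= del -> `|J c w x - J c w y| <= eta.
Proof.
move=> Xw eta0.
have /choice[del Hdel] : forall c : jet, exists del : R, 0 < del /\ forall x y,
    `|x| <= B -> `|y| <= B -> `|x - y| <= del -> `|J c w x - J c w y| <= eta.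
  move=> c; have [del d0 H] := continuous_luc (OmegaR_Jcont (c := c) Xw) B eta0.
  by exists del.
exists (\big[Num.min/1]_(c : jet) del c).
  by apply: lt_bigmin => // c _; have [] := Hdel c.
move=> c x y xB yB xy; have [_ H] := Hdel c; apply: H => //.
by apply: (le_trans xy); exact: bigmin_le_cond.
Qed.

(** Jets of [w] are uniformly continuous on balls, so the translates of [w] move continuously for
    the topology of values and gradients. *)
Lemma jcont_luc F w : jcont F -> X w -> luc (fun y => F (tau R d y w)).
Proof.
move=> jF Xw; apply: continuous_luc => y; apply/(@cvgrPdist_le _ _ _ (nbhs y)) => e e0.
have [K [eta [eta0 H]]] := jF _ (OmegaR_tau y Xw) e e0.
have [del d0 Hd] := J_uniform (`|y| + K%:R + 1) Xw eta0.
have m0 : 0 < Num.min 1 del by rewrite lt_min ltr01.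
near=> z.
have yz : `|y - z| <= Num.min 1 del.
  near: z; apply/nbhs_ballP; exists (Num.min 1 del) => //.
  by move=> z; rewrite -ball_normE => /ltW.
have [yz1 yzd] : `|y - z| <= 1 /\ `|y - z| <= del.
  by split; apply: (le_trans yz); rewrite ge_min lexx ?orbT.
apply: H => [|c x xK]; first exact: OmegaR_tau.
rewrite !J_tau; apply: Hd.
- by apply: (le_trans (ler_normD _ _)); lra.
- have -> : z + x = (y + x) - (y - z) by apply/rowP => j; rewrite !mxE; ring.
  apply: (le_trans (ler_normB _ _)); apply: lerD => //.
  by apply: (le_trans (ler_normD _ _)); rewrite lerD2l.
- by rewrite opprD addrACA subrr addr0.
Unshelve. all: by end_near. Qed.

Lemma J_bounded v K : X v -> exists C : R, forall (c : jet) x, `|x| <= K%:R ->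
  `|J c v x| <= C.
Proof.
move=> Xv.
have /choice[C HC] : forall c : jet, exists C : R, forall x, `|x| <= K%:R -> `|J c v x| <= C.
  by move=> c; exact: continuous_bounded_ball (OmegaR_Jcont Xv).
exists (\sum_c `|C c|) => c x xK; apply: (le_trans (HC c x xK)).
by rewrite (le_trans (ler_norm _))// (bigD1 c)//= lerDl sumr_ge0.
Qed.

Lemma distR_le v v' K (eta : R) : X v -> X v' -> 0 <= eta -> jclose K eta v v' ->
  distR R d v v' <= (d * d)%:R * eta + d%:R * ((d * d)%:R * eta) + 2 ^- K.
Proof.
move=> Xv Xv' eta0 vv'.
pose f x := mnorm R d (v x - v' x).
pose g x := \sum_(i < d) mnorm R d ('D_('e_i) v x - 'D_('e_i) v' x).
have f0 x : 0 <= f x by exact: mnorm_ge0.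
have g0 x : 0 <= g x by apply: sumr_ge0 => i _; exact: mnorm_ge0.
have fle (e : R) x : (forall c : jet, `|J c v x - J c v' x| <= e) -> f x <= (d * d)%:R * e.
  by move=> H; apply: mnorm_le => i j; have := H (None, (i, j)); rewrite /J/= !mxE.
have gle (e : R) x : (forall c : jet, `|J c v x - J c v' x| <= e) ->
    g x <= d%:R * ((d * d)%:R * e).
  move=> H; apply: (@le_trans _ _ (\sum_(i < d) (d * d)%:R * e)).
    apply: ler_sum => k' _; apply: mnorm_le => i j.
    by have := H (Some k', (i, j)); rewrite /J/= !mxE.
  by rewrite sumr_const card_ord -[leLHS]mulr_natl.
have JB k : exists C : R, forall (c : jet) x, `|x| <= k%:R -> `|J c v x - J c v' x| <= C.
  have [C HC] := J_bounded k Xv; have [C' HC'] := J_bounded k Xv'.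
  exists (C + C') => c x xk; apply: (le_trans (ler_normB _ _)).
  by rewrite lerD ?HC ?HC'.
have fb k : exists C : R, forall x, `|x| <= k%:R -> f x <= C.
  have [C HC] := JB k; exists ((d * d)%:R * C) => x xk.
  by apply: fle => c; exact: HC.
have gb k : exists C : R, forall x, `|x| <= k%:R -> g x <= C.
  have [C HC] := JB k; exists (d%:R * ((d * d)%:R * C)) => x xk.
  by apply: gle => c; exact: HC.
apply: le_trans (metric_sum_le K _ _) _.
- by move=> k; rewrite addr_ge0//; exact: supK_ge0.
- by move=> m n mn; apply: lerD; exact: supK_mono mn.
- rewrite lerD2r; apply: lerD; apply: supK_le => x xK.
    by apply: fle => c; exact: vv'.
  by apply: gle => c; exact: vv'.
Qed.

Lemma distR_jcont F :
  (forall v, X v -> forall e : R, 0 < e -> exists2 del : R, 0 < del &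
     forall v', X v' -> distR R d v v' < del -> `|F v - F v'| < e) -> jcont F.
Proof.
move=> HF v Xv e e0; have [del d0 H] := HF v Xv e e0.
have d2 : 0 < del / 2 by rewrite divr_gt0.
have [K HK] := pow2V_small d2.
pose M : R := (d * d)%:R + d%:R * (d * d)%:R + 1.
have M0 : 0 < M by rewrite ltr_wpDl// addr_ge0// mulr_ge0.
exists K, (del / 2 / M); split; first by rewrite divr_gt0.
move=> v' Xv' vv'; apply/ltW/H => //.
have eta0 : 0 <= del / 2 / M by rewrite ltW// divr_gt0.
apply: le_lt_trans (distR_le Xv Xv' eta0 vv') _.
set eta := del / 2 / M in eta0 *.
have -> : del = M * eta + del / 2 by rewrite /eta mulrCA divff ?gt_eqF// mulr1; field.
rewrite /M; move: ((d * d)%:R : R) (d%:R : R) => u t; lra.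
Qed.

(** With [eta = 0] this says that [F] sees only a window of radius [K], which is why periodization
    affects its averages only through a boundary layer. *)
Definition jlip F := exists (K : nat) (L : R), 0 <= L /\ forall (eta : R) v v',
  0 <= eta -> jclose K eta v v' -> `|F v - F v'| <= L * eta.

Lemma jlip_jcont F : jlip F -> jcont F.
Proof.
move=> [K [L [L0 H]]] v Xv e e0.
have L1 : 0 < L + 1 by rewrite ltr_wpDl.
exists K, (e / (L + 1)); split; first by rewrite divr_gt0.
move=> v' Xv' vv'.
have e1 : 0 <= e / (L + 1) by rewrite ltW// divr_gt0.
apply: (le_trans (H _ _ _ e1 vv')).
by rewrite mulrA ler_pdivrMr// mulrC ler_wpM2l ?(ltW e0)// lerDl.
Qed.

Definition ratv (z : 'rV[rat]_d) : 'rV[R]_d := map_mx ratr z.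

Lemma ratv_dense (x : 'rV[R]_d) (e : R) : 0 < e -> exists z, `|x - ratv z| <= e.
Proof.
move=> e0.
have /choice[q Hq] : forall i, exists q : rat, `|x 0 i - ratr q| <= e.
  move=> i; have : x 0 i - e < x 0 i + e by lra.
  move=> /rat_in_itvoo[q]; rewrite in_itv/= => /andP[q1 q2]; exists q.
  by rewrite ler_norml; apply/andP; split; lra.
exists (\row_i q i); apply/rV_norm_leP; first exact: ltW.
by move=> i; rewrite !mxE.
Qed.

Definition clamp (u : R) : R := Num.max 0 (Num.min 1 u).

Variant clamp_spec (u : R) : R -> Prop :=
  | ClampLow of u <= 0 : clamp_spec u 0
  | ClampMid of 0 <= u & u <= 1 : clamp_spec u u
  | ClampHigh of 1 <= u : clamp_spec u 1.

Lemma clampP u : clamp_spec u (clamp u).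
Proof.
rewrite /clamp; case: (lerP u 0) => u0.
  by rewrite min_r ?(le_trans u0)// max_l//; exact: ClampLow.
case: (lerP u 1) => u1.
  by rewrite ?min_r// max_r ?(ltW u0)//; apply: ClampMid => //; exact: ltW.
by rewrite ?min_l ?(ltW u1)// max_r//; apply: ClampHigh; exact: ltW.
Qed.

Lemma clamp_lip (u v : R) : `|clamp u - clamp v| <= `|u - v|.
Proof.
have h1 := ler_norm (u - v); have h2 := ler_norm (v - u); rewrite distrC in h2.
by case: (clampP u) => [?|? ?|?]; case: (clampP v) => [?|? ?|?];
  rewrite ler_norml; apply/andP; split; lra.
Qed.

(** For [n > 0], a trapezoid around [a]: 1 up to distance [1 / (2 n)], 0 from distance [1 / n]
    on. *)
Definition tent (n : nat) (a t : R) : R := clamp (2 - 2 * n%:R * `|t - a|).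

Lemma tent01 n (a t : R) : 0 <= tent n a t <= 1.
Proof. by rewrite /tent; case: clampP => *; apply/andP; split; lra. Qed.

Lemma tent_lip n (a t t' : R) : `|tent n a t - tent n a t'| <= 2 * n%:R * `|t - t'|.
Proof.
apply: (le_trans (clamp_lip _ _)).
have -> : 2 - 2 * n%:R * `|t - a| - (2 - 2 * n%:R * `|t' - a|) =
  2 * n%:R * (`|t' - a| - `|t - a|) by ring.
rewrite normrM ger0_norm ?mulr_ge0// ler_wpM2l ?mulr_ge0//.
apply: (le_trans (ler_dist_dist _ _)); rewrite opprB addrA subrK distrC//.
Qed.

Lemma tent1 n (a t : R) : n%:R * `|t - a| <= 1 / 2 -> tent n a t = 1.
Proof. by rewrite /tent; case: clampP => *; lra. Qed.

Lemma tent_gt0 n (a t : R) : 0 < tent n a t -> n%:R * `|t - a| < 1.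
Proof. by rewrite /tent; case: clampP => *; lra. Qed.

(* [(c, p, m, a, n)]: the component [c] of the jet should stay within about [1/n]
   of [a] on the ball of radius [1/(m+1)] around [p]. *)
Definition entry := (jet * 'rV[rat]_d * nat * rat * nat)%type.

(** The index [k] enumerates rational points. It yields 1, neutral for the infimum in [beta], when
    it codes no point or a point outside the ball. *)
Definition probe (i : entry) (k : nat) w : R :=
  let: (c, p, m, a, n) := i in
  if (unpickle k : option 'rV[rat]_d) is Some z then
    if `|ratv z - ratv p| <= m.+1%:R^-1 then tent n (ratr a) (J c w (ratv z)) else 1
  else 1.

(** An infimum over rational points, hence countable and measurable; continuity of jets on [OmegaR]
    recovers the other points. *)
Definition beta (i : entry) w : R := infs (probe i ^~ w) 0%N.

Lemma probe01 i k w : 0 <= probe i k w <= 1.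
Proof.
case: i => [[[[c p] m] a] n]; rewrite /probe; case: unpickle => [z|]; last first.
  by rewrite ler01 lexx.
by case: ifP => _; [exact: tent01|rewrite ler01 lexx].
Qed.

Lemma beta_le i k w : beta i w <= probe i k w.
Proof.
apply: ge_inf; last by exists k.
by exists 0 => _ [j _ <-]; have /andP[] := probe01 i j w.
Qed.

Lemma beta_ge i w (t : R) : (forall k, t <= probe i k w) -> t <= beta i w.
Proof.
move=> H; apply: lb_le_inf; first by exists (probe i 0%N w); exists 0%N.
by move=> _ [j _ <-].
Qed.

Lemma beta01 i w : 0 <= beta i w <= 1.
Proof.
apply/andP; split; first by apply: beta_ge => k; have /andP[] := probe01 i k w.
by apply: (le_trans (beta_le i 0%N w)); have /andP[] := probe01 i 0%N w.
Qed.

Lemma beta_lip i : jlip (beta i).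
Proof.
case: i => [[[[c p] m] a] n]; set i := (c, p, m, a, n).
(* The probed points lie within [1/(m+1) <= 1] of [p], and all probes share the Lipschitz constant
   [2 n], which passes to their infimum. *)
have [K _ /(_ K (leqnn K)) HK] := @nbhs_infty_ger R (`|ratv p| + 1).
have L0 : 0 <= 2 * n%:R :> R by rewrite mulr_ge0.
exists K, (2 * n%:R); split=> // eta v v' eta0 vv'.
have H k : `|probe i k v - probe i k v'| <= 2 * n%:R * eta.
  rewrite /probe/=; case: unpickle => [z|]; last by rewrite subrr normr0 mulr_ge0.
  case: ifP => zp; last by rewrite subrr normr0 mulr_ge0.
  apply: (le_trans (tent_lip _ _ _ _)); rewrite ler_wpM2l//; apply: vv'.
  apply: le_trans HK; have -> : ratv z = ratv p + (ratv z - ratv p) by rewrite addrC subrK.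
  apply: (le_trans (ler_normD _ _)); rewrite lerD2l (le_trans zp)//.
  by rewrite invf_le1// ler1n.
have h1 : beta i v - 2 * n%:R * eta <= beta i v'.
  apply: beta_ge => k; have := beta_le i k v; have := H k; rewrite ler_norml; lra.
have h2 : beta i v' - 2 * n%:R * eta <= beta i v.
  apply: beta_ge => k; have := beta_le i k v'; have := H k; rewrite ler_norml; lra.
by rewrite ler_norml; apply/andP; split; lra.
Qed.

Lemma jlip_cst (c : R) : jlip (fun=> c).
Proof. by exists 0%N, 0; split=> // eta v v' _ _; rewrite subrr normr0 mul0r. Qed.

Lemma jlipZ (c : R) F : jlip F -> jlip (fun w => c * F w).
Proof.
move=> [K [L [L0 H]]]; exists K, (`|c| * L); split; first by rewrite mulr_ge0.
by move=> eta v v' eta0 /(H _ _ _ eta0) h; rewrite -mulrBr normrM -mulrA ler_wpM2l.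
Qed.

Lemma jlip2 (op : R -> R -> R) F G :
  (forall a b a' b', `|op a b - op a' b'| <= `|a - a'| + `|b - b'|) ->
  jlip F -> jlip G -> jlip (fun w => op (F w) (G w)).
Proof.
move=> Hop [K [L [L0 H]]] [K' [L' [L'0 H']]]; exists (K + K')%N, (L + L').
split; first by rewrite addr_ge0.
move=> eta v v' eta0 vv'; apply: (le_trans (Hop _ _ _ _)); rewrite mulrDl lerD//.
  by apply: H => //; apply: jclose_le vv'; exact: leq_addr.
by apply: H' => //; apply: jclose_le vv'; exact: leq_addl.
Qed.

Lemma min_lip (a b a' b' : R) :
  `|Num.min a b - Num.min a' b'| <= `|a - a'| + `|b - b'|.
Proof.
have h1 := ler_norm (a - a'); have h2 := ler_norm (a' - a); rewrite distrC in h2.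
have h3 := ler_norm (b - b'); have h4 := ler_norm (b' - b); rewrite distrC in h4.
by rewrite ler_norml; case: (leP a b) => ?; case: (leP a' b') => ?;
  apply/andP; split; lra.
Qed.

Lemma max_lip (a b a' b' : R) :
  `|Num.max a b - Num.max a' b'| <= `|a - a'| + `|b - b'|.
Proof.
have h1 := ler_norm (a - a'); have h2 := ler_norm (a' - a); rewrite distrC in h2.
have h3 := ler_norm (b - b'); have h4 := ler_norm (b' - b); rewrite distrC in h4.
by rewrite ler_norml; case: (leP a b) => ?; case: (leP a' b') => ?;
  apply/andP; split; lra.
Qed.

Definition bump (l : seq entry) w : R := foldr (fun i t => Num.min (beta i w) t) 1 l.

(** Codes are finite lists over countable types, so the family is countable. The 0 at the end of the
    fold makes every member non-negative, and concatenating codes gives the maximum of two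
    members. *)
Definition fam (ll : seq (rat * seq entry)) w : R :=
  foldr (fun b t => Num.max (ratr b.1 * bump b.2 w) t) 0 ll.

Lemma bump01 l w : 0 <= bump l w <= 1.
Proof.
elim: l => [|i l /andP[h0 h1]] /=; first by rewrite ler01 lexx.
have /andP[b0 b1] := beta01 i w.
by rewrite le_min b0 h0 ge_min b1.
Qed.

Lemma bump_lip l : jlip (bump l).
Proof.
elim: l => [|i l IH] /=; first exact: jlip_cst.
by apply: (jlip2 min_lip) => //; exact: beta_lip.
Qed.

Lemma fam_lip ll : jlip (fam ll).
Proof.
elim: ll => [|b ll IH] /=; first exact: jlip_cst.
by apply: (jlip2 max_lip) => //; apply: jlipZ; exact: bump_lip.
Qed.

Lemma fam_bounded ll : exists C : R, forall w, `|fam ll w| <= C.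
Proof.
elim: ll => [|b ll [C HC]] /=; first by exists 0 => w; rewrite normr0.
exists (`|ratr b.1| + C) => w; have := HC w; have /andP[b0 b1] := bump01 b.2 w.
have nb : `|ratr b.1 * bump b.2 w| <= `|ratr b.1 : R|.
  by rewrite normrM (ger0_norm b0) ler_piMr.
have C0 : 0 <= C by exact: le_trans (HC w).
have := normr_ge0 (ratr b.1 : R); move: nb; rewrite !ler_norml.
by case: (leP (ratr b.1 * bump b.2 w) (fam ll w)) => ? /andP[? ?] ? /andP[? ?];
  apply/andP; split; lra.
Qed.

Lemma fam_ge0 ll w : 0 <= fam ll w.
Proof. by elim: ll => [|b ll IH] //=; rewrite le_max IH orbT. Qed.

Lemma fam_cat l1 l2 w : fam (l1 ++ l2) w = Num.max (fam l1 w) (fam l2 w).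
Proof.
elim: l1 => [|b l1 IH] /=; first by rewrite max_r// fam_ge0.
by rewrite IH maxA.
Qed.

Lemma measurable_beta i : measurable_fun (X : set T) (beta i : T -> R).
Proof.
apply: (@measurable_fun_infs _ T R X (fun k (w : T) => probe i k w) 0%N).
  by move=> w _; exists 0 => _ [j _ <-]; have /andP[] := probe01 i j w.
move=> k; case: i => [[[[c p] m] a] n]; rewrite /probe; case: unpickle => [z|//].
case: (`|ratv z - ratv p| <= m.+1%:R^-1) => //; rewrite /tent /clamp.
apply: measurable_maxr => //; apply: measurable_minr => //.
apply: measurable_funB => //; apply: measurable_funM => //.
apply: measurableT_comp => //; apply: measurable_funB => //.
exact: measurable_J.
Qed.

Lemma measurable_bump l : measurable_fun (X : set T) (bump l : T -> R).
Proof.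
elim: l => [|i l IH]; first exact: measurable_cst.
exact: (measurable_minr (measurable_beta i) IH).
Qed.

Lemma measurable_fam ll : measurable_fun (X : set T) (fam ll : T -> R).
Proof.
elim: ll => [|b ll IH]; first exact: measurable_cst.
exact: (measurable_maxr (measurable_funM (measurable_cst _) (measurable_bump b.2)) IH).
Qed.

Lemma beta_eq1 c p m a n v :
  (forall z, `|ratv z - ratv p| <= m.+1%:R^-1 ->
    n%:R * `|J c v (ratv z) - ratr a| <= 1 / 2) -> beta (c, p, m, a, n) v = 1.
Proof.
move=> H; apply/eqP; rewrite eq_le; have /andP[_ ->] := beta01 (c, p, m, a, n) v.
apply: beta_ge => k; rewrite /probe/=; case: unpickle => [z|//].
by case: ifP => // /H/tent1->.
Qed.

Lemma beta_gt0 c p m a n v z : 0 < beta (c, p, m, a, n) v ->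
  `|ratv z - ratv p| <= m.+1%:R^-1 -> n%:R * `|J c v (ratv z) - ratr a| < 1.
Proof.
move=> b0 zp; have := lt_le_trans b0 (beta_le (c, p, m, a, n) (pickle z) v).
by rewrite /probe/= pickleK zp; exact: tent_gt0.
Qed.

Lemma bump_eq1 l v : (forall i, i \in l -> beta i v = 1) -> bump l v = 1.
Proof.
elim: l => [//|i l IH] H /=; rewrite H ?mem_head// IH ?minxx// => j jl.
by apply: H; rewrite in_cons jl orbT.
Qed.

Lemma bump_gt0 l v i : 0 < bump l v -> i \in l -> 0 < beta i v.
Proof.
elim: l => [//|j l IH] /=; rewrite lt_min => /andP[b0 l0].
by rewrite in_cons => /predU1P[->|/(IH l0)].
Qed.

Lemma rational_cover (K : nat) (e : R) : 0 < e -> exists s : seq 'rV[rat]_d,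
  (forall p, p \in s -> `|ratv p| <= K%:R + e) /\
  forall x : 'rV[R]_d, `|x| <= K%:R -> exists2 p, p \in s & `|x - ratv p| < e.
Proof.
move=> e0.
have cK : compact [set x : 'rV[R]_d | `|x| <= K%:R] by exact: rV_ball_compact.
rewrite compact_cover in cK.
have [|x /= xK|D' DD' cD'] := cK _ [set p : 'rV[rat]_d | `|ratv p| <= K%:R + e]
    (fun p => ball (ratv p) e).
- by move=> p _; exact: ball_open.
- have e2 : 0 < e / 2 by rewrite divr_gt0.
  have [z xz] := ratv_dense x e2; exists z => /=.
    have -> : ratv z = x - (x - ratv z) by rewrite opprB addrC subrK.
    by apply: (le_trans (ler_normB _ _)); apply: lerD => //; lra.
  by rewrite -ball_normE/= distrC; lra.
exists (finmap.enum_fset D'); split=> [p pD|x xK].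
  by have := DD' p pD; rewrite inE.
have [p pD] := cD' x xK; rewrite -ball_normE/= distrC => xp.
by exists p.
Qed.

(** A Urysohn-type function: 1 at [v] and supported in a prescribed neighbourhood of [v]. The jet of
    [v] is recorded at finitely many rational centres whose cells are small enough for it to
    oscillate little; positivity at [w] forces the jet of [w] to follow the record on each cell. *)
Lemma jet_bump v K (eta : R) : X v -> 0 < eta -> exists l, bump l v = 1 /\
  forall w, X w -> 0 < bump l w -> jclose K eta v w.
Proof.
move=> Xv eta0.
(* [n >= 2 / eta] suffices: the errors [e1] to [e4] below add up to at most [7 / (4 n)]. *)
have [n0 _ /(_ n0 (leqnn n0)) Hn0] := @nbhs_infty_ger R (2 / eta).
pose n := n0.+1.
have nn : 2 / eta <= n%:R by rewrite (le_trans Hn0)// ler_nat.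
have npos : 0 < n%:R :> R by rewrite ltr0n.
(* Oscillation of [v] over a cell and rounding of its value at the centre cost [1 / (4 n)] each,
   which stays on the plateau of [tent]. *)
have n4 : 0 < (4 * n%:R)^-1 :> R by rewrite invr_gt0 mulr_gt0.
have [del d0 Hd] := J_uniform (K%:R + 2) Xv n4.
have [m _ /(_ m (leqnn m)) Hm] := @nbhs_infty_ger R del^-1.
have md : m.+1%:R^-1 <= del.
  rewrite -[del]invrK lef_pV2 ?posrE ?invr_gt0//.
  by rewrite (le_trans Hm)// ler_nat.
have m1 : m.+1%:R^-1 <= 1 :> R by rewrite invf_le1// ler1n.
have m0 : 0 < m.+1%:R^-1 :> R by rewrite invr_gt0.
have rho0 : 0 < m.+1%:R^-1 / 2 :> R by rewrite divr_gt0.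
set rho := m.+1%:R^-1 in md m1 m0 rho0.
(* Covering at half the radius leaves room to move from [x] to a rational point of the same cell. *)
have [s [sK scov]] := rational_cover K rho0.
have /choice[a Ha] : forall cp : jet * 'rV[rat]_d, exists a : rat,
    `|J cp.1 v (ratv cp.2) - ratr a| <= (4 * n%:R)^-1.
  move=> cp; set t := J _ _ _.
  have : t - (4 * n%:R)^-1 < t + (4 * n%:R)^-1 by move: n4; lra.
  move=> /rat_in_itvoo[q]; rewrite in_itv/= => /andP[q1 q2]; exists q.
  by rewrite ler_norml; apply/andP; split; lra.
pose l : seq entry := [seq (c, p, m, a (c, p), n) | c <- enum [set: jet], p <- s].
have n4E : n%:R * (4 * n%:R)^-1 = 1 / 4 :> R by field; rewrite gt_eqF.
have near_p c p z : p \in s -> `|ratv z - ratv p| <= rho ->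
    `|J c v (ratv z) - J c v (ratv p)| <= (4 * n%:R)^-1.
  move=> /sK ps zp; apply: Hd; [|lra|exact: le_trans md].
  have -> : ratv z = ratv p + (ratv z - ratv p) by rewrite addrC subrK.
  by apply: (le_trans (ler_normD _ _)); lra.
exists l; split.
  apply: bump_eq1 => _ /allpairsP[[c p] /= [_ ps ->]]; apply: beta_eq1 => z zp.
  have := near_p c p z ps zp; have := Ha (c, p) => /= h1 h2.
  have : `|J c v (ratv z) - ratr (a (c, p))| <= 2 * (4 * n%:R)^-1.
    have -> : J c v (ratv z) - ratr (a (c, p)) = (J c v (ratv z) - J c v (ratv p)) +
      (J c v (ratv p) - ratr (a (c, p))) by ring.
    by apply: (le_trans (ler_normD _ _)); lra.
  move=> /(ler_wpM2l (ltW npos)); lra.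
move=> w Xw lw c x xK.
have [p ps xp] := scov x xK.
have il : (c, p, m, a (c, p), n) \in l.
  by apply/allpairsP; exists (c, p); split=> //=; rewrite mem_enum in_setT.
have b0 := bump_gt0 lw il.
(* This modulus depends on [w]; it only serves to pick a rational point near [x] and does not enter
   the bump. *)
have [del' d'0 Hd'] := J_uniform (K%:R + 2) Xw n4.
have mn0 : 0 < Num.min (rho / 2) del' by rewrite lt_min rho0.
have [z] := ratv_dense x mn0; rewrite le_min => /andP[xz1 xz2].
have zp : `|ratv z - ratv p| <= rho.
  have -> : ratv z - ratv p = (x - ratv p) - (x - ratv z).
    by rewrite opprB addrACA [- ratv p + _]addrC addrACA subrr add0r addrC.
  by apply: (le_trans (ler_normB _ _)); lra.
have zK : `|ratv z| <= K%:R + 2.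
  have -> : ratv z = x - (x - ratv z) by rewrite opprB addrC subrK.
  by apply: (le_trans (ler_normB _ _)); lra.
have xK2 : `|x| <= K%:R + 2 by lra.
have pK2 : `|ratv p| <= K%:R + 2 by have := sK _ ps; lra.
have e1 : `|J c w x - J c w (ratv z)| <= (4 * n%:R)^-1 by exact: Hd'.
have e2 : `|J c w (ratv z) - ratr (a (c, p))| <= 4 * (4 * n%:R)^-1.
  rewrite -(ler_pM2l npos) mulrCA n4E.
  by have := beta_gt0 b0 zp; lra.
have e3 : `|J c v x - J c v (ratv p)| <= (4 * n%:R)^-1 by apply: Hd => //; lra.
have e4 := Ha (c, p); rewrite /= in e4.
have e5 : 8 * (4 * n%:R)^-1 <= eta.
  rewrite ler_pdivrMr in nn => //.
  rewrite -(ler_pM2l npos) mulrCA n4E; lra.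
have -> : J c v x - J c w x = (J c v x - J c v (ratv p)) +
   (J c v (ratv p) - ratr (a (c, p))) - (J c w (ratv z) - ratr (a (c, p)))
   - (J c w x - J c w (ratv z)) by ring.
apply: (le_trans (ler_normB _ _)); apply: (le_trans (lerD (ler_normB _ _) (lexx _))).
have := ler_normD (J c v x - J c v (ratv p)) (J c v (ratv p) - ratr (a (c, p))).
lra.
Qed.

(** A bump at [v] times a rational [q] slightly below [F v]: on its support [F] exceeds
    [F v - e / 2 > q], up to equality, and elsewhere the product is 0. *)
Lemma fam_below F v (e : R) : jcont F -> (forall w, X w -> 0 <= F w) -> X v -> 0 < e ->
  exists ll, (forall w, X w -> fam ll w <= F w) /\ F v - e <= fam ll v.
Proof.
move=> jF F0 Xv e0; case: (lerP (F v) e) => Fe.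
  (* The zero function is enough here; otherwise [F v - e] is positive, and so is [q]. *)
  by exists [::]; split=> [w /F0//|/=]; lra.
have : F v - e < F v - e / 2 by lra.
move=> /rat_in_itvoo[q]; rewrite in_itv/= => /andP[q1 q2].
have e2 : 0 < e / 2 by rewrite divr_gt0.
have [K [eta [eta0 HK]]] := jF v Xv _ e2.
have [l [lv lw]] := jet_bump K Xv eta0.
exists [:: (q, l)]; split=> [w Xw|] /=; last first.
  by rewrite lv mulr1 le_max (ltW q1).
rewrite ge_max F0// andbT.
have /andP[b0 b1] := bump01 l w; have [bpos|] := ltP 0 (bump l w); last first.
  move=> bneg; have -> : bump l w = 0 by apply/eqP; rewrite eq_le bneg.
  by rewrite mulr0 F0.
have := HK w Xw (lw w Xw bpos); rewrite ler_norml => /andP[h1 h2].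
have q0 : 0 <= ratr q :> R by lra.
have := ler_wpM2l q0 b1; lra.
Qed.

End Observables.

(** * Periodization *)

Section Fold.
Context {R : realType}.
Variable M : R.
Hypothesis M2 : 2 < M.

Definition possq (u : R) : R := Num.max 0 u * Num.max 0 u.

Lemma possq_taylor (u h : R) :
  `|possq (u + h) - possq u - 2 * Num.max 0 u * h| <= h * h.
Proof.
rewrite /possq ler_norml.
case: (leP 0 u) => u0; case: (leP 0 (u + h)) => uh0; apply/andP; split; nra.
Qed.

Local Notation alpha := (M / 2 - 1).

(* A C1 step from 0 (left of [M/2 - 1]) to 1 (right of [M/2 + 1]). *)
Definition ramp (t : R) : R :=
  2^-1 * (possq (t - alpha) - 2 * possq (t - alpha - 1) + possq (t - alpha - 2)).

Definition dramp (t : R) : R :=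
  Num.max 0 (t - alpha) - 2 * Num.max 0 (t - alpha - 1) + Num.max 0 (t - alpha - 2).

Lemma ramp0 t : t <= alpha -> ramp t = 0.
Proof.
move=> ta; by rewrite /ramp /possq !(@max_l _ _ 0); lra.
Qed.

Lemma ramp1 t : alpha + 2 <= t -> ramp t = 1.
Proof.
move=> ta; by rewrite /ramp /possq !(@max_r _ _ 0); lra.
Qed.

Lemma ramp_taylor t h : `|ramp (t + h) - ramp t - dramp t * h| <= 2 * (h * h).
Proof.
have := possq_taylor (t - alpha) h; have := possq_taylor (t - alpha - 1) h.
have := possq_taylor (t - alpha - 2) h.
have -> : t - alpha + h = t + h - alpha by ring.
have -> : t - alpha - 1 + h = t + h - alpha - 1 by ring.
have -> : t - alpha - 2 + h = t + h - alpha - 2 by ring.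
rewrite /ramp /dramp !ler_norml => /andP[? ?] /andP[? ?] /andP[? ?].
by apply/andP; split; lra.
Qed.

Lemma dramp_lip t t' : `|dramp t - dramp t'| <= 4 * `|t - t'|.
Proof.
have H (u u' : R) : u - u' = t - t' -> `|Num.max 0 u - Num.max 0 u'| <= `|t - t'|.
  by move=> <-; apply: (le_trans (max_lip _ _ _ _)); rewrite subrr normr0 add0r.
have h1 : t - alpha - (t' - alpha) = t - t' by ring.
have h2 : t - alpha - 1 - (t' - alpha - 1) = t - t' by ring.
have h3 : t - alpha - 2 - (t' - alpha - 2) = t - t' by ring.
have := H _ _ h1; have := H _ _ h2; have := H _ _ h3.
rewrite /dramp !ler_norml => /andP[? ?] /andP[? ?] /andP[? ?].
by apply/andP; split; lra.
Qed.

(** Equal to [t - k M] between [k M - alpha] and [k M + alpha], and to [t - (k + 1) M] from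
    [(k + 1) M - alpha] on, with a C1 transition in the layer of width 2 between them. *)
Definition branch (k : int) (t : R) : R := t - M * (k%:~R + ramp (t - k%:~R * M)).
Definition dbranch (k : int) (t : R) : R := 1 - M * dramp (t - k%:~R * M).

(** A quadratic Taylor bound gives the derivative at every point at once, knots of the piecewise
    quadratic [ramp] included. *)
Lemma taylor_is_derive (f df : R -> R) (C : R) : 0 <= C ->
  (forall t h, `|f (t + h) - f t - df t * h| <= C * (h * h)) ->
  forall t : R, is_derive t 1 f (df t).
Proof.
move=> C0 H t.
have cv : (fun h : R => h^-1 *: (f (h *: (1 : R) + t) - f t)) @ 0^' --> df t.
  apply/cvgrPdist_le => e e0; have C1 : 0 < C + 1 by rewrite ltr_wpDl.
  near=> h.
  have h0 : h != 0 by near: h; exact: nbhs_dnbhs_neq.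
  have he : `|h| <= e / (C + 1).
    by near: h; apply: dnbhs0_le; rewrite divr_gt0.
  have E : df t - h^-1 *: (f (h *: (1 : R) + t) - f t) =
      - (h^-1 * (f (t + h) - f t - df t * h)).
    rewrite [h *: (1 : R)]mulr1 [h + t]addrC /GRing.scale/=; field; exact: h0.
  rewrite E normrN normrM normfV.
  apply: (@le_trans _ _ (`|h|^-1 * (C * (h * h)))); first by rewrite ler_wpM2l ?invr_ge0.
  have -> : h * h = `|h| * `|h| by rewrite -normrM ger0_norm// -expr2 sqr_ge0.
  rewrite mulrCA mulKf ?normr_eq0//.
  apply: (le_trans (ler_wpM2l C0 he)).
  by rewrite mulrA ler_pdivrMr// mulrC ler_wpM2l ?(ltW e0)// lerDl.
have dd : derivable f t 1 by apply/cvg_ex; exists (df t).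
by split=> //; rewrite /derive; apply: cvg_lim.
Unshelve. all: by end_near. Qed.

Lemma branch_is_derive k (t : R) : is_derive t 1 (branch k) (dbranch k t).
Proof.
apply: (@taylor_is_derive _ _ (M * 2)) => [|{}t h]; first by move: M2; lra.
have := ramp_taylor (t - k%:~R * M) h.
have -> : t - k%:~R * M + h = t + h - k%:~R * M by ring.
set A := ramp _; set B := ramp _; set D := dramp _ => H.
rewrite /branch /dbranch -/A -/B -/D.
have -> : t + h - M * (k%:~R + A) - (t - M * (k%:~R + B)) - (1 - M * D) * h =
  - (M * (A - B - D * h)) by ring.
have M0 : 0 < M by move: M2; lra.
by rewrite normrN normrM gtr0_norm// -mulrA ler_wpM2l// ltW.
Qed.

Lemma dbranch_continuous k : continuous (dbranch k).
Proof.
move=> t; apply/cvgrPdist_le => e e0; have M0 : 0 < M by move: M2; lra.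
near=> s.
have ts : `|t - s| <= e / (4 * M).
  by near: s; apply: cvgr_dist_le; [exact: cvg_id|rewrite divr_gt0// mulr_gt0].
rewrite /dbranch; set A := dramp _; set B := dramp _.
have -> : 1 - M * A - (1 - M * B) = - (M * (A - B)) by ring.
rewrite normrN normrM gtr0_norm//.
have := dramp_lip (t - k%:~R * M) (s - k%:~R * M); rewrite -/A -/B.
have -> : t - k%:~R * M - (s - k%:~R * M) = t - s by ring.
move=> H; apply: (le_trans (ler_wpM2l (ltW M0) H)).
by move: ts; rewrite ler_pdivlMr ?mulr_gt0//; lra.
Unshelve. all: by end_near. Qed.

(* [M]-periodic, C1, and equal to the identity for [|t| <= M/2 - 1]. *)
Definition fold (t : R) : R := branch (Num.floor (t / M)) t.

(** Neighbouring branches agree near the multiples of [M], where [ramp] is constantly 0 or 1. The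
    jump of [Num.floor] is therefore invisible, and each branch is valid on an interval overlapping
    the next one. *)
Lemma fold_branch (k : int) t : k%:~R * M - alpha <= t -> t <= (k%:~R + 1) * M + alpha ->
  fold t = branch k t.
Proof.
move=> t1 t2; have M0 : 0 < M by move: M2; lra.
have fl (j : int) : j%:~R * M <= t -> t < (j%:~R + 1) * M -> Num.floor (t / M) = j.
  move=> j1 j2; apply: floor_def.
  by rewrite rmorphD/= ler_pdivlMr// ltr_pdivrMr// j1 j2.
rewrite /fold; have [tk|kt] := ltP t (k%:~R * M).
  rewrite (fl (k - 1)); rewrite ?rmorphB/=; [|lra|lra].
  rewrite /branch rmorphB/= ramp1; last lra.
  by rewrite ramp0; [ring|lra].
have [tk'|kt'] := ltP t ((k%:~R + 1) * M); first by rewrite (fl k).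
rewrite (fl (k + 1)); rewrite ?rmorphD/=; [|lra|lra].
rewrite /branch rmorphD/= ramp0; last lra.
by rewrite ramp1; [ring|lra].
Qed.

Lemma fold_periodic t : fold (M + t) = fold t.
Proof.
have M0 : 0 < M by move: M2; lra.
rewrite /fold; have -> : (M + t) / M = 1 + t / M by rewrite mulrDl divff// gt_eqF.
rewrite floorDzr// floor1 /branch; set k := Num.floor _.
have kE : (1 + k)%:~R = 1 + k%:~R :> R by rewrite rmorphD.
have E : M + t - (1 + k%:~R) * M = t - k%:~R * M by ring.
by rewrite kE E; ring.
Qed.

Lemma fold_id t : `|t| <= alpha -> fold t = t.
Proof.
rewrite ler_norml => /andP[t1 t2].
rewrite (@fold_branch 0); [|by rewrite mul0r sub0r|lra].
by rewrite /branch mul0r subr0 ramp0// addr0 mulr0 subr0.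
Qed.

Lemma fold_near (t : R) : \forall s \near t, fold s = branch (Num.floor (t / M)) s.
Proof.
set k := Num.floor _; have M0 : 0 < M by move: M2; lra.
have a0 : 0 < alpha by move: M2; lra.
have /andP[k1 k2] := floor_itv (t / M); rewrite -/k in k1 k2.
rewrite ler_pdivlMr// in k1; rewrite ltr_pdivrMr// rmorphD/= in k2.
near=> s; have : `|t - s| <= alpha.
  by near: s; apply: cvgr_dist_le; [exact: cvg_id|exact: a0].
by rewrite ler_norml => /andP[s1 s2]; apply: fold_branch; lra.
Unshelve. all: by end_near. Qed.

Lemma fold_is_derive (t : R) : is_derive t 1 fold (dbranch (Num.floor (t / M)) t).
Proof.
have [db vb] := branch_is_derive (Num.floor (t / M)) t.
have H := fold_near t; split.
  apply: near_eq_derivable db; near=> s.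
  by apply/esym; near: s; exact: H.
rewrite -vb; exact: near_eq_derive H.
Unshelve. all: by end_near. Qed.

Definition dfold (t : R) : R := 'D_1 fold t.

Lemma dfold_continuous : continuous dfold.
Proof.
move=> t; set k := Num.floor (t / M).
have M0 : 0 < M by move: M2; lra.
have a0 : 0 < alpha by move: M2; lra.
have a20 : 0 < alpha / 2 by rewrite divr_gt0.
have /andP[k1 k2] := floor_itv (t / M); rewrite -/k in k1 k2.
rewrite ler_pdivlMr// in k1; rewrite ltr_pdivrMr// rmorphD/= in k2.
have E : forall s, `|t - s| <= alpha / 2 -> dfold s = dbranch k s.
  move=> s; rewrite ler_norml => /andP[s1 s2].
  have [_ vb] := branch_is_derive k s; rewrite /dfold -vb.
  apply: near_eq_derive; near=> u.
  have : `|s - u| <= alpha / 2.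
    by near: u; apply: cvgr_dist_le; [exact: cvg_id|exact: a20].
  by rewrite ler_norml => /andP[u1 u2]; apply: fold_branch; lra.
have Et : dfold t = dbranch k t by apply: E; rewrite subrr normr0 ltW.
apply/cvgrPdist_le => e e0; near=> s.
rewrite Et E; last by near: s; apply: cvgr_dist_le; [exact: cvg_id|exact: a20].
near: s; apply: cvgr_dist_le => //; exact: dbranch_continuous.
Unshelve. all: by end_near. Qed.

End Fold.

Section Periodization.
Context {R : realType} {d : nat}.
Variable M : R.
Hypothesis M2 : 2 < M.
Implicit Types w : Fn R d.

Definition foldv (x : 'rV[R]_d) : 'rV[R]_d := \row_i fold M (x 0 i).

Definition per w : Fn R d := fun x => w (foldv x).

Lemma foldvE : foldv = \sum_(i < d) (fun x : 'rV[R]_d => fold M (x 0 i) *: 'e_i).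
Proof.
apply/funext => x; rewrite fct_sumE; apply/rowP => j; rewrite mxE summxE (bigD1 j)//=.
rewrite !mxE !eqxx mulr1 big1 ?addr0// => i ij.
by rewrite !mxE eqxx/= eq_sym (negbTE ij) mulr0.
Qed.

Lemma foldv_differentiable x : differentiable foldv x.
Proof.
rewrite foldvE; apply: differentiable_sum => i; apply: differentiableZl.
apply: (@differentiable_comp _ _ _ _ (fun x : 'rV[R]_d => x 0 i) (fold M)).
  exact: differentiable_coord.
by apply/derivable1_diffP; case: (fold_is_derive M2 (x 0 i)).
Qed.

Lemma foldv_derive x (i : 'I_d) : 'd foldv x 'e_i = dfold M (x 0 i) *: 'e_i.
Proof.
rewrite -deriveE; last exact: foldv_differentiable.
have [df _] := fold_is_derive M2 (x 0 i).
have cv : (fun h : R => h^-1 *: (fold M (h *: (1 : R) + x 0 i) - fold M (x 0 i)))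
   @ 0^' --> dfold M (x 0 i) by exact: df.
rewrite /derive; apply: cvg_lim => //.
have -> : (fun h : R => h^-1 *: ((foldv \o shift x) (h *: 'e_i) - foldv x)) =
  (fun h : R => (h^-1 *: (fold M (h *: (1 : R) + x 0 i) - fold M (x 0 i))) *: 'e_i).
  apply/funext => h; apply/rowP => j; rewrite !mxE eqxx/=.
  case: (eqVneq j i) => [->|_]; first by rewrite /GRing.scale/= !mulr1.
  by rewrite !mulr0 add0r subrr mulr0.
exact: cvgZr_tmp cv.
Qed.

Lemma per_derive w x (i : 'I_d) : differentiable w (foldv x) ->
  'D_('e_i) (per w) x = dfold M (x 0 i) *: 'D_('e_i) w (foldv x).
Proof.
move=> dw; have df := foldv_differentiable x.
have dc : differentiable (w \o foldv) x by exact: differentiable_comp.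
rewrite [LHS](deriveE (f := w \o foldv))// diff_comp//= foldv_derive linearZ/=.
by rewrite deriveE.
Qed.

Lemma foldv_continuous : continuous foldv.
Proof. by move=> x; apply: differentiable_continuous; exact: foldv_differentiable. Qed.

Lemma per_OmegaR lam Lam r w : OmegaR R d lam Lam r w -> OmegaR R d lam Lam r (per w).
Proof.
move=> [[cw hw] [[dw cdw] rw]]; split; last split.
- split; last by move=> x; exact: hw.
  move=> x; apply: (@continuous_comp _ _ _ foldv w); [exact: foldv_continuous|exact: cw].
- split.
    move=> x; apply: (@differentiable_comp _ _ _ _ foldv w) => //.
    exact: foldv_differentiable.
  move=> i; rewrite (_ : (fun x => _) = fun x : 'rV[R]_d => dfold M (x 0 i) *: 'D_('e_i) w (foldv x)).
    have c1 : continuous (fun x : 'rV[R]_d => dfold M (x 0 i)).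
      by move=> x; apply: continuous_comp; [exact: coord_continuous|exact: dfold_continuous].
    have c2 : continuous (fun x => 'D_('e_i) w (foldv x)).
      move=> x; apply: (@continuous_comp _ _ _ foldv (fun z => 'D_('e_i) w z)).
        exact: foldv_continuous.
      exact: cdw.
    by move=> x; exact: (cvgZ (c1 x) (c2 x)).
  by apply/funext => x; rewrite per_derive.
- by move=> x; exact: rw.
Qed.

Lemma per_periodic w (i : 'I_d) : tau R d (M *: 'e_i) (per w) = per w.
Proof.
apply/funext => x; rewrite /tau /per; congr w; apply/rowP => j; rewrite !mxE eqxx/=.
case: eqP => _; first by rewrite mulr1 fold_periodic.
by rewrite mulr0 add0r.
Qed.

(** The margin [K + 2] consists of [K] for the window, 1 for the neighbourhood in which derivatives
    are taken, and 1 for the transition layer of [fold]. *)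
Lemma per_jclose w K (y : 'rV[R]_d) : (forall j, `|y 0 j| <= M / 2 - (K%:R + 2)) ->
  jclose K 0 (tau R d y (per w)) (tau R d y w).
Proof.
move=> yM c x xK.
have loc z : `|z| <= K%:R + 1 -> tau R d y (per w) z = tau R d y w z.
  move=> zK; rewrite /tau /per; congr w; apply/rowP => j; rewrite !mxE.
  apply: fold_id => //; apply: (le_trans (ler_normD _ _)).
  have := yM j; have := le_trans (rV_coord_le z j) zK; lra.
suff -> : J c (tau R d y (per w)) x = J c (tau R d y w) x by rewrite subrr normr0.
rewrite /J; case: c.1 => [k|]; last by rewrite loc// (le_trans xK)// lerDl.
congr (_ _ _ _); apply: near_eq_derive; near=> z; apply: loc.
have xz : `|x - z| <= 1.
  near: z; apply/nbhs_ballP; exists 1 => //=.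
  by move=> z; rewrite -ball_normE => /ltW.
have -> : z = x - (x - z) by rewrite opprB addrC subrK.
by apply: (le_trans (ler_normB _ _)); exact: lerD.
Unshelve. all: by end_near. Qed.

End Periodization.

(** * Weak convergence *)

Section WeakConvergence.
Context {R : realType} {d : nat}.
Variables (lam Lam r : R).
Local Notation T := (OmegaMeas R d lam Lam).
Local Notation Om := (Omega R d lam Lam).
Local Notation X := (OmegaR R d lam Lam r).
Local Notation code := (seq (rat * seq (entry (d := d)))).
Local Notation jcont := (jcont lam Lam r).
Implicit Types (w : Fn R d) (F : Fn R d -> R).

Definition orbf F w : (nat -> R) -> R := fun y => F (tau R d (\row_i y i) w).

Lemma orbf_lucn F w : jcont F -> X w -> lucn d (orbf F w).
Proof. by move=> jF Xw; exact: luc_row (jcont_luc jF Xw). Qed.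

Lemma fam_jcont (ll : code) : jcont (fam ll).
Proof. by apply: jlip_jcont; exact: fam_lip. Qed.

Lemma iter_int_ibox (a b : R) k (h : (nat -> R) -> R) x : a < b -> lucn d h ->
  iter_int R a b k h x = (b - a) ^+ k * ibox (fun=> a) (fun=> b) k h x.
Proof.
move=> ab lh; have ab' (j : nat) : (fun=> a) j < (fun=> b) j by [].
elim: k x => [|k IH] x /=; first by rewrite expr0 mul1r.
have -> : (fun t => iter_int R a b k h (fun j => if j == k then t else x j)) =
  (fun t => (b - a) ^+ k * ibox (fun=> a) (fun=> b) k h (upd x k t)).
  by apply/funext => t; exact: IH.
rewrite -/(integ a b _) integZ; last exact: (luc1_ibox ab' k k x lh).
by rewrite exprSr /avg -mulrA mulVKf// gt_eqF// subr_gt0.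
Qed.

Lemma cube_avgE (M : R) w F : 0 < M -> lucn d (orbf F w) ->
  cube_avg R d M w F = cube d M (orbf F w).
Proof.
move=> M0 lF; rewrite /cube_avg iter_int_ibox//; last exact: half_lt.
have -> : M / 2 - - (M / 2) = M by field.
by rewrite mulrA mulVf ?mul1r// expf_neq0// gt_eqF.
Qed.

(** Both averages are compared with those over the cube shrunk by [l = K + 2] on each side, on which
    the two environments look the same to [F]. *)
Lemma per_cube_close F (C e : R) : jlip F -> (forall w, `|F w| <= C) -> 0 < e ->
  exists2 M1 : R, 2 < M1 & forall M v, M1 <= M -> X v ->
    `|cube d M (orbf F (per M v)) - cube d M (orbf F v)| <= e.
Proof.
move=> lF FC e0; have jF : jcont F by exact: jlip_jcont.
have [K [L [L0 HL]]] := lF.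
have C0 : 0 <= C by exact: le_trans (FC (fun=> 0)).
pose l : R := K%:R + 2; have l2 : 2 <= l by rewrite lerDr.
pose A : R := 8 * d%:R * C * l.
have A0 : 0 <= A by rewrite /A !mulr_ge0//; lra.
have Ae0 : 0 <= A / e by rewrite divr_ge0// ltW.
(* The two shrinkings cost [A / M] in total, at most [e] beyond [A / e]; the rest ensures
   [2 * l < M]. *)
exists (2 * l + 1 + A / e); first lra.
move=> M v MM Xv; have M2 : 2 < M by lra.
have M0 : 0 < M by lra.
have lM : 2 * l < M by lra.
have l0 : 0 < l by lra.
have Xp := per_OmegaR M2 Xv.
have lu1 := orbf_lucn jF Xv; have lu2 := orbf_lucn jF Xp.
have b1 y : `|orbf F v y| <= C by exact: FC.
have b2 y : `|orbf F (per M v) y| <= C by exact: FC.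
have c1 := cube_shrink_le l0 lM lu1 b1; have c2 := cube_shrink_le l0 lM lu2 b2.
have E : cube d (M - 2 * l) (orbf F (per M v)) = cube d (M - 2 * l) (orbf F v).
  apply: (eq_ibox lu2 lu1) => // y yb _.
  rewrite /orbf; apply/eqP; rewrite -subr_eq0 -normr_eq0 eq_le normr_ge0 andbT.
  (* The Lipschitz bound is used with [eta = 0]: the jets coincide on the window. *)
  rewrite -(mulr0 L); apply: HL => //; apply: per_jclose => // j; rewrite mxE.
  by have := yb j (ltn_ord j); rewrite ler_norml -/l => /andP[h1 h2]; apply/andP; split; lra.
rewrite E in c2.
have err : d%:R * (4 * C * l / M) + d%:R * (4 * C * l / M) <= e.
  have -> : d%:R * (4 * C * l / M) + d%:R * (4 * C * l / M) = A / M by rewrite /A; ring.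
  rewrite ler_pdivrMr// mulrC -ler_pdivrMr//; lra.
move: c1 c2 err; rewrite !ler_norml => /andP[? ?] /andP[? ?] ?.
by apply/andP; split; lra.
Qed.

Section Measure.
Variable mu : probability T R.
Hypothesis X1 : mu X = 1%E.
Local Notation Ex := (Ex mu X).
Local Notation mX := (@measurable_OmegaR R d lam Lam r).

Definition decode (k : nat) : code := odflt [::] (unpickle k).

Lemma decode_pickle (ll : code) : decode (pickle ll) = ll.
Proof. by rewrite /decode pickleK. Qed.

(** Concatenates those among the first [J] codes that satisfy [P]; by [fam_cat] the member it names
    is the maximum of theirs. *)
Fixpoint collect (P : pred code) (J : nat) : code :=
  if J is J'.+1 then (if P (decode J') then decode J' else [::]) ++ collect P J'
  else [::].

Lemma collectS P J :
  collect P J.+1 = (if P (decode J) then decode J else [::]) ++ collect P J.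
Proof. by []. Qed.

Lemma collect_le (P : pred code) w (B : R) J : 0 <= B ->
  (forall ll, P ll -> fam ll w <= B) -> fam (collect P J) w <= B.
Proof.
move=> B0 PB; elim: J => [//|J IH]; rewrite collectS fam_cat ge_max IH andbT.
by case: ifP => // /PB.
Qed.

Lemma collect_ge (P : pred code) k w J : P (decode k) -> (k < J)%N ->
  fam (decode k) w <= fam (collect P J) w.
Proof.
move=> Pk; elim: J => [//|J IH]; rewrite ltnS leq_eqVlt collectS fam_cat le_max.
by move=> /predU1P[<-|/IH->]; [rewrite Pk lexx|rewrite orbT].
Qed.

(** Maxima of the first members below [F] converge to [F] on [X], and dominated convergence handles
    the expectations. The same limit gives the measurability of [F], which is not immediate: [F] is
    continuous for [distR], while the sigma-field comes from the coarser topology of [Omega]. *)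
Lemma approx_below F (C : R) : jcont F -> (forall w, X w -> 0 <= F w <= C) ->
  measurable_fun (X : set T) (F : T -> R) /\
  forall e : R, 0 < e -> exists ll : code,
    (forall w, X w -> fam ll w <= F w) /\ Ex F - e <= Ex (fam ll).
Proof.
move=> jF F0C.
pose P ll := `[< forall w, X w -> fam ll w <= F w >].
pose f J : T -> R := fam (collect P J).
have fF J w : X w -> f J w <= F w.
  move=> Xw; apply: collect_le; first by have /andP[] := F0C w Xw.
  by move=> ll /asboolP/(_ w Xw).
have mf J : measurable_fun (X : set T) (f J) by exact: measurable_fam.
have fC J : bdd (X : set T) (f J) C.
  move=> w Xw; rewrite ger0_norm ?fam_ge0//.
  by apply: (le_trans (fF J w Xw)); have /andP[] := F0C w Xw.
have fcv w : X w -> f ^~ w @ \oo --> F w.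
  move=> Xw; apply/cvgrPdist_le => e e0.
  have F0 v : X v -> 0 <= F v by move=> /F0C/andP[].
  have [ll [llF llv]] := fam_below jF F0 Xw e0.
  exists (pickle ll).+1 => // J /= kJ.
  have : fam ll w <= f J w.
    rewrite -[ll]decode_pickle; apply: collect_ge => //.
    by rewrite decode_pickle; exact/asboolP.
  have := fF J w Xw; rewrite ler_norml => h1 h2; apply/andP; split; lra.
have [mF _ Ecv _] := Ex_dominated mX X1 mf fC fcv.
split=> // e e0; move/cvgrPdist_le : Ecv => /(_ e e0)[J _ /(_ J (leqnn J))] /= HJ.
exists (collect P J); split; first by move=> w; exact: fF.
move: HJ; rewrite ler_norml => /andP[_]; rewrite /f; lra.
Qed.

Definition obs (k : nat) : Fn R d -> R := fam (decode k).

Lemma obs_pickle (ll : code) : obs (pickle ll) = fam ll.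
Proof. by rewrite /obs decode_pickle. Qed.

Section Selected.
Variables (M : nat -> R) (w : nat -> Fn R d).
Hypothesis M0 : forall n, 0 < M n.
Hypothesis Xw : forall n, X (w n).
Hypothesis sel : forall n k, (k <= n)%N ->
  `|cube d (M n) (orbf (obs k) (w n)) - Ex (obs k)| <= n.+1%:R^-1.

(** A member below [G] on [X] stays below it along the whole orbit of [w n], and its averages are
    controlled as soon as [n] exceeds its index. Only lower bounds pass from the family to [G]. *)
Lemma selected_liminf G (C e : R) : jcont G -> (forall v, X v -> 0 <= G v <= C) -> 0 < e ->
  \forall n \near \oo, Ex G - e <= cube d (M n) (orbf G (w n)).
Proof.
move=> jG G0C e0; have e2 : 0 < e / 2 by rewrite divr_gt0.
have [_ /(_ _ e2) [ll [llG Ell]]] := approx_below jG G0C.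
near=> n.
have kn : (pickle ll <= n)%N by near: n; exact: nbhs_infty_ge.
have ne : n.+1%:R^-1 <= e / 2.
  rewrite -[e / 2]invrK lef_pV2 ?posrE ?invr_gt0//.
  apply: (@le_trans _ _ n%:R); last by rewrite ler_nat.
  by near: n; exact: nbhs_infty_ger.
have := sel kn; rewrite obs_pickle => S.
have le1 : cube d (M n) (orbf (fam ll) (w n)) <= cube d (M n) (orbf G (w n)).
  apply: le_cube => //; [by apply: orbf_lucn => //; exact: fam_jcont|exact: orbf_lucn|].
  by move=> y; apply: llG; exact: OmegaR_tau.
have := le_trans S ne; rewrite ler_norml => /andP[s1 s2]; lra.
Unshelve. all: by end_near. Qed.

Lemma jcont_affine (a b : R) F : jcont F -> jcont (fun v => a * F v + b).
Proof.
move=> jF v Xv e e0; have a1 : 0 < `|a| + 1 by rewrite ltr_wpDl.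
have [K [eta [eta0 H]]] := jF v Xv (e / (`|a| + 1)) (divr_gt0 e0 a1).
exists K, eta; split=> // v' Xv' vv'; have := H v' Xv' vv'.
rewrite opprD addrACA subrr addr0 -mulrBr normrM ler_pdivlMr// => h.
by apply: le_trans h; rewrite mulrC ler_wpM2l// lerDl.
Qed.

Lemma selected_cvg F (C : R) : jcont F -> (forall v, X v -> `|F v| <= C) ->
  (fun n => (cube_avg R d (M n) (w n) F)%:E) @ \oo -->
    (\int[mu]_(v in X) (F v)%:E)%E.
Proof.
move=> jF FC.
pose G1 v := 1 * F v + C; pose G2 v := -1 * F v + C.
have j1 : jcont G1 by exact: jcont_affine.
have j2 : jcont G2 by exact: jcont_affine.
have b1 v : X v -> 0 <= G1 v <= 2 * C.
  by move=> /FC; rewrite /G1 ler_norml => /andP[? ?]; apply/andP; split; lra.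
have b2 v : X v -> 0 <= G2 v <= 2 * C.
  by move=> /FC; rewrite /G2 ler_norml => /andP[? ?]; apply/andP; split; lra.
have [m1 _] := approx_below j1 b1.
have bF : bm (X : set T) (F : T -> R).
  split; last by exists C.
  have -> : (F : T -> R) = (fun v : T => G1 v - C).
    by apply/funext => v; rewrite /G1 mul1r addrK.
  exact: measurable_funB.
have bC : bm (X : set T) (fun=> C) by exact: bm_cst.
have E1 : Ex G1 = Ex F + C.
  by rewrite /G1 (ExD mX X1 (bmZ 1 bF) bC) (ExZ mX X1 1 bF) (Ex_cst mX X1) mul1r.
have E2 : Ex G2 = - Ex F + C.
  by rewrite /G2 (ExD mX X1 (bmZ (-1) bF) bC) (ExZ mX X1 (-1) bF) (Ex_cst mX X1) mulN1r.
have lF n : lucn d (orbf F (w n)) by exact: orbf_lucn.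
have A1 n : cube d (M n) (orbf G1 (w n)) = cube d (M n) (orbf F (w n)) + C.
  rewrite (_ : orbf G1 _ = fun y => 1 * orbf F (w n) y + C)//.
  by rewrite cubeD ?cubeZ ?cube_cst ?mul1r//; [exact: lucnZ|exact: lucn_cst].
have A2 n : cube d (M n) (orbf G2 (w n)) = - cube d (M n) (orbf F (w n)) + C.
  rewrite (_ : orbf G2 _ = fun y => -1 * orbf F (w n) y + C)//.
  by rewrite cubeD ?cubeZ ?cube_cst ?mulN1r//; [exact: lucnZ|exact: lucn_cst].
have -> : (\int[mu]_(v in X) (F v)%:E)%E = (Ex F)%:E.
  by rewrite /Ex /Rintegral fineK//; exact: (integrable_fin_num mX (bm_integrable mX X1 bF)).
apply/fine_cvgP; split; first exact: nearW.
apply/cvgrPdist_le => e e0; near=> n; rewrite /= cube_avgE//.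
have L1 : Ex G1 - e <= cube d (M n) (orbf G1 (w n)).
  by near: n; exact: selected_liminf b1 e0.
have L2 : Ex G2 - e <= cube d (M n) (orbf G2 (w n)).
  by near: n; exact: selected_liminf b2 e0.
move: L1 L2; rewrite E1 E2 A1 A2 ler_norml => ? ?; apply/andP; split; lra.
Unshelve. all: by end_near. Qed.

End Selected.

Hypothesis Om1 : mu Om = 1%E.
Hypothesis inv : forall (x : 'rV[R]_d) (A : set (Fn R d)),
  <<s OmegaOpen R d lam Lam >> A -> A `<=` Om -> mu (tau R d x @^-1` A) = mu A.
Hypothesis erg : forall A : set (Fn R d),
  <<s OmegaOpen R d lam Lam >> A -> A `<=` Om ->
  (forall x : 'rV[R]_d, tau R d x @^-1` A = A) -> mu A = 0%E \/ mu A = 1%E.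

(** The measure lives on all of [Fn], while invariance is assumed for subsets of [Omega]; as the
    complement of [Omega] is null, intersecting with [Omega] bridges the two. *)
Lemma mu_setIOmega (A : set T) : measurable A -> mu (A `&` Om) = mu A.
Proof.
move=> mA; have mO := @measurable_Omega R d lam Lam.
have E : mu A = (mu (A `\` Om) + mu (A `&` Om))%E by exact: measureDI.
have mC : measurable (~` Om : set T) by exact: measurableC.
have C0 : mu (~` Om) = 0%E by rewrite probability_setC// Om1 -EFinB subrr.
have sub : A `\` Om `<=` ~` Om by move=> v [].
have Z : mu (A `\` Om) = 0%E.
  by apply: (subset_measure0 _ mC sub C0); exact: measurableD.
by rewrite E Z add0e.
Qed.

Lemma mu_tau x (A : set T) : measurable A -> mu (tau R d x @^-1` A) = mu A.
Proof.
move=> mA; have mO := @measurable_Omega R d lam Lam.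
have mB : measurable (tau R d x @^-1` A : set T).
  by have := measurable_tau (lam := lam) (Lam := Lam) x measurableT mA; rewrite setTI.
rewrite -(mu_setIOmega mB) -(mu_setIOmega mA) -[X in _ `&` X](@Omega_tau_pre R d lam Lam x).
rewrite -preimage_setI; apply: inv; first exact: (measurableI _ _ mA mO).
exact: subIsetr.
Qed.

Lemma obs_good k : goodf (X : set T) (tau R d : 'rV[R]_d -> T -> T) (obs k).
Proof.
split.
  split; first exact: measurable_fam.
  by have [C HC] := fam_bounded (R := R) (decode k);
     exists C => v _; exact: HC.
by move=> v Xv; exact: jcont_luc (@fam_jcont _) Xv.
Qed.

Lemma selection n : exists2 M0 : R, 0 < M0 & forall M, M0 <= M -> exists v : Fn R d,
  [/\ X v, forall i : 'I_d, tau R d (M *: 'e_i) v = v &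
   forall k, (k <= n)%N -> `|cube d M (orbf (obs k) v) - Ex (obs k)| <= n.+1%:R^-1].
Proof.
pose e : R := n.+1%:R^-1 / 2; have e0 : 0 < e by rewrite divr_gt0// invr_gt0.
have XO : X `<=` Om by move=> v [].
have actD (x y : 'rV[R]_d) (v : T) : tau R d x (tau R d y v) = tau R d (x + y) v.
  exact: tauD.
have act0 (v : T) : tau R d 0 v = v by exact: tau0.
have Xact (x : 'rV[R]_d) (v : T) : X v -> X (tau R d x v) by exact: OmegaR_tau.
have mact (x : 'rV[R]_d) := measurable_tau (lam := lam) (Lam := Lam) x.
have erg' (A : set T) : measurable A -> A `<=` X ->
    (forall x, tau R d x @^-1` A = A) -> mu A = 0%E \/ mu A = 1%E.
  by move=> mA AX; apply: erg => //; exact: subset_trans XO.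
have [M0 M00 HM0] := generic_point mX X1 actD act0 Xact mact mu_tau erg' n.+1 obs_good e0.
have /choice[M1 HM1] : forall k, exists M1 : R, 2 < M1 /\ forall M v, M1 <= M -> X v ->
    `|cube d M (orbf (obs k) (per M v)) - cube d M (orbf (obs k) v)| <= e.
  move=> k; have [C HC] := fam_bounded (R := R) (decode k).
  have [M1 h1 h2] := per_cube_close (fam_lip (R := R) (decode k)) HC e0.
  by exists M1.
have S0 : 0 <= \sum_(k < n.+1) M1 k.
  by apply: sumr_ge0 => k _; have [h _] := HM1 k; lra.
exists (M0 + 2 + \sum_(k < n.+1) M1 k) => [|M MM]; first lra.
have M0M : M0 <= M by lra.
have M2 : 2 < M by lra.
have M1M k : (k <= n)%N -> M1 k <= M.
  move=> kn; rewrite -ltnS in kn; apply: le_trans MM; rewrite (bigD1 (Ordinal kn))//=.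
  have : 0 <= \sum_(i < n.+1 | i != Ordinal kn) M1 i.
    by apply: sumr_ge0 => i _; have [h _] := HM1 i; lra.
  lra.
have [v Xv Hv] := HM0 M M0M.
exists (per M v); split; [exact: per_OmegaR|exact: per_periodic|move=> k kn].
have [_ H1] := HM1 k; have h1 := H1 M v (M1M k kn) Xv.
have h2 : `|cube d M (orbf (obs k) v) - Ex (obs k)| <= e by exact: Hv.
have ee : n.+1%:R^-1 = e + e :> R by rewrite /e; field; rewrite nat1r pnatr_eq0.
rewrite ee; move: h1 h2; rewrite !ler_norml => /andP[? ?] /andP[? ?].
by apply/andP; split; lra.
Qed.

End Measure.

End WeakConvergence.

Theorem theorem3p3 (R : realType) (d : nat) (lam Lam r : R)
  (mu : probability (OmegaMeas R d lam Lam) R) :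
  (0 < d)%N -> 0 < lam -> 0 < Lam -> 0 < r ->
  mu (Omega R d lam Lam) = 1%E ->
  (* invariance *)
  (forall (x : 'rV[R]_d) (A : set (Fn R d)),
     <<s OmegaOpen R d lam Lam >> A -> A `<=` Omega R d lam Lam ->
     mu (tau R d x @^-1` A) = mu A) ->
  (* ergodicity *)
  (forall A : set (Fn R d),
     <<s OmegaOpen R d lam Lam >> A -> A `<=` Omega R d lam Lam ->
     (forall x : 'rV[R]_d, tau R d x @^-1` A = A) ->
     mu A = 0%E \/ mu A = 1%E) ->
  mu (OmegaR R d lam Lam r) = 1%E ->
  exists (w : nat -> Fn R d) (M : nat -> R),
    (forall n, OmegaR R d lam Lam r (w n)) /\
    (forall n, 0 < M n) /\
    (forall n, M n < M n.+1) /\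
    (M @ \oo --> +oo) /\
    (forall n (i : 'I_d), tau R d (M n *: 'e_i) (w n) = w n) /\
    (forall F : Fn R d -> R,
          (exists C : R, forall v, OmegaR R d lam Lam r v -> `|F v| <= C) ->
          (forall v, OmegaR R d lam Lam r v -> forall e : R, 0 < e ->
             exists2 del : R, 0 < del & forall v', OmegaR R d lam Lam r v' ->
               distR R d v v' < del -> `|F v - F v'| < e) ->
          (fun n => (cube_avg R d (M n) (w n) F)%:E) @ \oo -->
            (\int[mu]_(v in OmegaR R d lam Lam r) (F v)%:E)%E).
Proof.
move=> _ _ _ _ Om1 inv erg X1.
have /choice[M0 HM0] : forall n, exists M0 : R, 0 < M0 /\ forall M, M0 <= M ->
    exists v : Fn R d, [/\ OmegaR R d lam Lam r v,
      forall i : 'I_d, tau R d (M *: 'e_i) v = v &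
      forall k, (k <= n)%N ->
        `|cube d M (orbf (obs k) v) - Ex mu (OmegaR R d lam Lam r) (obs k)|
          <= n.+1%:R^-1].
  by move=> n; have [M0] := selection X1 Om1 inv erg n; exists M0.
(* Partial sums of the thresholds plus 1: strictly increasing, at least [n.+1], and above the
   threshold [M0 n]. *)
pose M n : R := \sum_(k < n.+1) (M0 k + 1).
have M0pos k : 0 < M0 k by have [] := HM0 k.
have MS n : M n.+1 = M n + (M0 n.+1 + 1) by rewrite /M big_ord_recr.
have Mge n : n.+1%:R <= M n.
  elim: n => [|n IH]; first by rewrite /M big_ord1 lerDr ltW.
  by rewrite MS -natr1; have := M0pos n.+1; lra.
have MM0 n : M0 n <= M n.
  case: n => [|n]; first by rewrite /M big_ord1 lerDl.
  by rewrite MS; have := Mge n; have : 0 <= n.+1%:R :> R by []; lra.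
have /choice[w Hw] : forall n, exists v : Fn R d, [/\ OmegaR R d lam Lam r v,
      forall i : 'I_d, tau R d (M n *: 'e_i) v = v &
      forall k, (k <= n)%N ->
        `|cube d (M n) (orbf (obs k) v) - Ex mu (OmegaR R d lam Lam r) (obs k)|
          <= n.+1%:R^-1].
  by move=> n; have [_ H] := HM0 n; exact: H.
have Mpos n : 0 < M n by apply: lt_le_trans (Mge n); rewrite ltr0n.
have Xw n : OmegaR R d lam Lam r (w n) by have [] := Hw n.
exists w, M; do ?[split => //].
- by move=> n; rewrite MS ltrDl addr_gt0.
- apply/cvgryPge => A; near=> n; apply: le_trans (Mge n).
  apply: (@le_trans _ _ n%:R); last by rewrite ler_nat.
  by near: n; exact: nbhs_infty_ger.
- by move=> n; have [] := Hw n.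
- move=> F [C FC] Fcont; apply: selected_cvg => //.
  + by move=> n; have [_ _] := Hw n.
  + exact: distR_jcont Fcont.
  + exact: FC.
Unshelve. all: by end_near. Qed.
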